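(* Let $K\subset\mathbb{R}^2$ be a compact strictly convex set with $0$ in its interior, such that $\partial K$ is $C^{k,\alpha}$ ($k\ge 2$, $0\le\alpha\le 1$), with positive curvature except at a finite number of points. Let $U\subset\mathbb{R}^2$ be a bounded open set with piecewise $C^{k,\alpha}$ boundary (in the sense of the context) satisfying the Boundary Assumption of the context. Then the $d_K$-ridge $R_K$ of $U$ consists exactly of $R_{K,0}$ together with those points $x\in U\setminus R_{K,0}$ at which $$\kappa_K(y(x))\,d_K(x)=1,$$ where $y(x)$ is the unique $d_K$-closest point to $x$ on $\partial U$. Here, if $y=y(x)$ is a reentrant corner, the condition is understood to require that $x-y$ is parallel to one of the inward $K$-normals at $y$, and $\kappa_K$ is the $K$-curvature at $y$ of the corresponding boundary part.
   Context: **Gauge functions.** For a compact convex $K\subset\mathbb{R}^2$ with $0$ in its interior, $\gamma(x)=\gamma_K(x):=\inf\{\lambda>0: x\in\lambda K\}$; the polar is $K^\circ:=\{x:\langle x,y\rangle\le 1\ \text{for all } y\in K\}$; and $\gamma^\circ:=\gamma_{K^\circ}$. Strictly convex means $\partial K$ contains no line segment. $C^{k,\alpha}$ regularity is understood to include $C^\infty$ and real-analytic regularity. $\{\mu_1,\dots,\mu_m\}$ denotes the set of outward unit normals to $\partial K$ at the finitely many points where the curvature of $\partial K$ vanishes. Under the hypotheses, $\gamma^\circ$ is $C^1$ on $\mathbb{R}^2\setminus\{0\}$ and $C^{k,\alpha}$ on $\mathbb{R}^2\setminus\{t\mu_i: t\ge 0,\ i=1,\dots,m\}$. **Distance and ridge.**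 $d_K(x)=d_K(x,\partial U):=\min_{y\in\partial U}\gamma(x-y)$. A point $y\in\partial U$ with $d_K(x)=\gamma(x-y)$ is called a $d_K$-closest point to $x$ on $\partial U$. The $d_K$-ridge $R_K$ of $U$ is the set of all $x\in U$ such that $d_K$ is not $C^{1,1}$ in any neighborhood of $x$. $R_{K,0}$ is the set of points of $U$ with more than one $d_K$-closest point on $\partial U$. **Boundary of $U$.** $\partial U$ is a union of simple closed Jordan curves consisting of arcs $S_1,\dots,S_N$ which are $C^{k,\alpha}$ up to their endpoints; topologically $U$ is the interior of a disk from which, possibly, several disks are removed. If $S_i\cap S_j$ ($i\ne j$) is nonempty it consists of a single point, called a corner (vertex). A corner is nonreentrant if its opening angle (measured inside $U$) is less than $\pi$, and reentrant if it is $\ge\pi$. Opening angles are strictly between $0$ and $2\pi$. **Boundary Assumption.** Let $y\in S_i$ be an interior point of $S_i$ or a reentrant corner. If the inward unit normal to $S_i$ at $y$ belongs to $\{\mu_1,\dots,\mu_m\}$, then either the curvature of $S_i$ at $y$ is positive, or $S_i$ is a line segment. **$K$-curvature.** Write $v^\perp:=(-v_2,v_1)$. For a $C^2$ curve $t\mapsto(x(t),y(t))$ let $\nu:=(-y',x')$, assumed nonzero. If $\nu$ is not a positive multiple of any $\mu_i$, the $K$-curvature is $\kappa_K:=\frac{1}{|\nu|^2}\langle D^2\gamma^\circ(\nu)\nu',\nu^\perp\rangle$; if the curve is a line segment and $\nu\equiv c\mu_i$ for some $c>0$, then $\kappa_K\equiv 0$. It is independent of (orientation preserving) parametrization. For $\partial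 U$, the orientation is chosen so that $\nu$ points into $U$ (the ordinary curvature of $\partial U$ has the corresponding sign, $\kappa=\langle\nu',\nu^\perp\rangle/|\nu|^3$). At a corner $y\in S_i\cap S_j$ there are two (one-sided) $K$-curvatures, those of $S_i$ and of $S_j$ at their endpoint $y$. **$K$-normals.** The inward $K$-normal at $y\in S_i$ is $\nu_K(y):=D\gamma^\circ(\nu(y))$, where $\nu(y)$ is an inward normal to $S_i$ at $y$ (of any length). At a corner there are two inward $K$-normals, one for each of the two arcs meeting there; ''the corresponding boundary part'' is an arc whose inward $K$-normal at $y$ is parallel to $x-y$ (when the opening angle is $\pi$ either arc qualifies, and the condition $\kappa_K d_K=1$ is to hold for at least one of them). *)

(* Defs.v *)
(* The plane is R * R, for an arbitrary R : realType. *)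
From HB Require Import structures.
From mathcomp Require Import all_boot all_order all_algebra all_fingroup.
From mathcomp Require Import all_classical all_reals all_analysis.

Set Implicit Arguments.
Unset Strict Implicit.
Unset Printing Implicit Defensive.

Import Order.TTheory GRing.Theory Num.Theory.
Import numFieldNormedType.Exports.
Local Open Scope classical_set_scope.
Local Open Scope ring_scope.

Section Plane.
Context {R : realType}.
Implicit Types (u v z : R * R) (A B : set (R * R)).

Definition dot u v : R := u.1 * v.1 + u.2 * v.2.

(* The library norm on R * R is the sup norm; metric notions below that are not
   invariant under a change of norm use the Euclidean one. *)
Definition enorm v : R := Num.sqrt (dot v v).

Definition unit_vec v : R * R := (enorm v)^-1 *: v.

Definition perp v : R * R := (- v.2, v.1).

Definition rotate (theta : R) v : R * R :=
  (cos theta * v.1 - sin theta * v.2, sin theta * v.1 + cos theta * v.2).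

Definition same_direction u v : Prop := exists2 l : R, 0 < l & u = l *: v.

Definition segment u v : set (R * R) :=
  [set (1 - s) *: u + s *: v | s in `[0, 1]].

Definition boundary A : set (R * R) := closure A `\` interior A.

Definition homeomorphic A B : Prop :=
  exists f g : R * R -> R * R,
    [/\ {within A, continuous f}, {within B, continuous g},
        (forall x, A x -> B (f x) /\ g (f x) = x)
      & (forall x, B x -> A (g x) /\ f (g x) = x)].

Definition disk_with_holes (n : nat) (z : 'I_n -> R * R) (rad : 'I_n -> R) :
    set (R * R) :=
  [set x | enorm x < 1 /\ forall i, rad i < enorm (x - z i)].

Definition disjoint_holes (n : nat) (z : 'I_n -> R * R) (rad : 'I_n -> R) :
    Prop :=
  (forall i, 0 < rad i /\ enorm (z i) + rad i < 1) /\
  (forall i j, i != j -> rad i + rad j < enorm (z i - z j)).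

Definition grad (f : R * R -> R) z : R * R := ('D_(1, 0) f z, 'D_(0, 1) f z).

(* The product D^2 f(z) v of the Hessian matrix with v. *)
Definition hess (f : R * R -> R) z v : R * R :=
  ('D_v (fun w => (grad f w).1) z, 'D_v (fun w => (grad f w).2) z).

Definition C11_on (V : set (R * R)) (f : R * R -> R) : Prop :=
  (forall z, V z -> differentiable f z) /\ [lipschitz grad f z | z in V].

End Plane.

Section Regularity.
Context {R : realType}.

Inductive regularity : Type :=
  | Holder of nat & R
  | Smooth
  | Analytic.

Definition admissible (r : regularity) : Prop :=
  match r with
  | Holder k alpha => (2 <= k)%N /\ 0 <= alpha <= 1
  | Smooth | Analytic => True
  end.

Definition Cn_on (n : nat) (V : set R) (f : R -> R) : Prop :=
  forall (m : nat) (t : R), (m <= n)%N -> V t ->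
    {for t, continuous (derive1n m f)} /\ ((m < n)%N -> derivable (derive1n m f) t 1).

Definition locally_holder (alpha : R) (V : set R) (f : R -> R) : Prop :=
  forall t, V t -> exists C : R,
    \forall s \near t & s' \near t, `|f s - f s'| <= C * `|s - s'| `^ alpha.

Definition analytic_on (V : set R) (f : R -> R) : Prop :=
  forall t, V t -> exists a : R^nat,
    \forall h \near (0 : R), series (fun n => a n * h ^+ n) @ \oo --> f (t + h).

Definition of_class (r : regularity) (V : set R) (f : R -> R) : Prop :=
  match r with
  | Holder k alpha => Cn_on k V f /\ locally_holder alpha V (derive1n k f)
  | Smooth => forall n, Cn_on n V f
  | Analytic => analytic_on V f
  end.

End Regularity.
Arguments regularity R : clear implicits.

Section Curves.
Context {R : realType}.
Implicit Types (c : R -> R * R) (t : R) (A : set (R * R)).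

Definition curve_of_class (r : regularity R) (V : set R) c : Prop :=
  of_class r V (fun t => (c t).1) /\ of_class r V (fun t => (c t).2).

Definition vel c t : R * R :=
  (derive1 (fun s => (c s).1) t, derive1 (fun s => (c s).2) t).

(* (-y', x'): the (not normalized) normal on the left of the curve. *)
Definition nu c t : R * R := perp (vel c t).

Definition curv c t : R :=
  dot (vel (nu c) t) (perp (nu c t)) / enorm (nu c t) ^+ 3.

(* A lies, at c t, on the side of the curve into which nu points, and only on
   that side; for a Jordan domain the second half follows from the first. *)
Definition nu_into A c t : Prop :=
  \forall s \near (0 : R)^'+,
    A (c t + s *: nu c t) /\ ~ A (c t - s *: nu c t).

Definition is_line_segment c : Prop :=
  exists p q : R * R, p <> q /\ c @` `[0, 1] = segment p q.

End Curves.

Section Gauges.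
Context {R : realType}.
Implicit Types (K : set (R * R)).

Definition gauge K (x : R * R) : R :=
  inf [set l : R | 0 < l /\ exists2 z, K z & x = l *: z].

Definition polar K : set (R * R) :=
  [set x | forall y, K y -> dot x y <= 1].

(* k is a 1-periodic parametrization of the Jordan curve formed by the boundary
   of K. *)
Record gauge_body (r : regularity R) K (k : R -> R * R) : Prop := {
  gb_compact : compact K;
  gb_convex : convex_set K;
  gb_origin : interior K 0;
  gb_strict : forall p q, p <> q -> ~ (segment p q `<=` boundary K);
  gb_periodic : forall t, k (t + 1) = k t;
  gb_injective : {in `[0, 1[ &, injective k};
  gb_boundary : range k = boundary K;
  gb_class : curve_of_class r setT k;
  gb_regular : forall t, vel k t <> 0;
  gb_inward : forall t, nu_into K k t;
  gb_curvature : finite_set [set k t | t in [set t | ~ 0 < curv k t]]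
}.

(* nu points into K, whence the sign. *)
Definition flat_normals (k : R -> R * R) : set (R * R) :=
  [set - unit_vec (nu k t) | t in [set t | curv k t = 0]].

End Gauges.

Section Domains.
Context {R : realType}.
Variables (U : set (R * R)) (N : nat).
(* The arc S_i is the image of [0, 1] under S i. Its endpoint S i 1 is the
   initial point of the arc nxt i, so the Jordan curves forming the boundary
   are the cycles of the permutation nxt. *)
Variables (S : 'I_N -> R -> R * R) (nxt : {perm 'I_N}).

(* a and b are tangent vectors at the corner p pointing away from p along the
   two arcs; the sector swept from a to b counterclockwise is the one in U. *)
Definition opening_angle (p a b : R * R) (theta : R) : Prop :=
  [/\ 0 < theta < 2 * pi,
      unit_vec b = rotate theta (unit_vec a)
    & forall phi, 0 < phi < theta ->
        \forall s \near (0 : R)^'+, U (p + s *: rotate phi a)].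

Definition corner_angle (i : 'I_N) (theta : R) : Prop :=
  opening_angle (S i 1) (vel (S (nxt i)) 0) (- vel (S i) 1) theta.

Definition reentrant_corner (p : R * R) : Prop :=
  exists i theta, [/\ p = S i 1, corner_angle i theta & pi <= theta].

Record piecewise_domain (r : regularity R) : Prop := {
  pd_bounded : bounded_set U;
  pd_open : open U;
  pd_topology : exists n (z : 'I_n -> R * R) (rad : 'I_n -> R),
    disjoint_holes z rad /\ homeomorphic U (disk_with_holes z rad);
  pd_boundary : boundary U = \bigcup_i (S i @` `[0, 1]);
  (* regularity up to the endpoints, stated by extension across them *)
  pd_class : forall i, exists V : set R,
    [/\ open V, `[0, 1] `<=` V & curve_of_class r V (S i)];
  pd_regular : forall i t, t \in `[0, 1] -> vel (S i) t <> 0;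
  pd_injective : forall i, {in `[0, 1] &, injective (S i)};
  pd_next : forall i, S i 1 = S (nxt i) 0;
  pd_disjoint : forall i j s t, i != j -> s \in `[0, 1] -> t \in `[0, 1] ->
    S i s = S j t ->
    (s = 1 /\ t = 0 /\ j = nxt i) \/ (s = 0 /\ t = 1 /\ i = nxt j);
  pd_single : forall i j p q, i != j ->
    (S i @` `[0, 1] `&` S j @` `[0, 1]) p ->
    (S i @` `[0, 1] `&` S j @` `[0, 1]) q -> p = q;
  pd_inward : forall i t, t \in `]0, 1[ -> nu_into U (S i) t;
  pd_angle : forall i, exists theta, corner_angle i theta
}.

Definition boundary_assumption (M : set (R * R)) : Prop :=
  forall i t, t \in `[0, 1] ->
    (t \in `]0, 1[) \/ reentrant_corner (S i t) ->
    M (unit_vec (nu (S i) t)) ->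
    0 < curv (S i) t \/ is_line_segment (S i).

Variable K : set (R * R).

Definition dK (x : R * R) : R := inf [set gauge K (x - y) | y in boundary U].

Definition closest (x y : R * R) : Prop :=
  boundary U y /\ dK x = gauge K (x - y).

Definition ridge : set (R * R) :=
  [set x | U x /\ ~ exists V, [/\ open V, V x & C11_on V dK]].

Definition ridge0 : set (R * R) :=
  [set x | U x /\ exists y y', [/\ closest x y, closest x y' & y <> y']].

Definition K_normal (c : R -> R * R) (t : R) : R * R :=
  grad (gauge (polar K)) (nu c t).

(* "kap is the K-curvature of c at t", for M the set of flat normals of K. It is
   a relation because the K-curvature is undefined where nu is a positive
   multiple of an element of M and c is not a line segment. *)
Definition K_curvature (M : set (R * R)) (c : R -> R * R) (t kap : R) : Prop :=
  let flat := exists2 mu, M mu & same_direction (nu c t) mu in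
  (~ flat /\
     kap = dot (hess (gauge (polar K)) (nu c t) (vel (nu c) t))
               (perp (nu c t)) / enorm (nu c t) ^+ 2) \/
  [/\ flat, is_line_segment c & kap = 0].

(* At a corner y the arc i is any of the two arcs meeting there. Parallelism to
   the inward K-normal has to be taken with the same sense: since K need not be
   symmetric, x - y may be a negative multiple of one of the two K-normals at a
   reentrant corner y although d_K is smooth near x. *)
Definition critical (M : set (R * R)) (x y : R * R) : Prop :=
  exists i t kap,
    [/\ t \in `[0, 1], y = S i t,
        reentrant_corner y -> same_direction (x - y) (K_normal (S i) t),
        K_curvature M (S i) t kap
      & kap * dK x = 1].

End Domains.

(* Main.v *)
(* For t in R let n(t) be the outward normal of K at k(t) with <n(t), k(t)> = 1. Then
   gamma(v) = max_t <n(t), v>, and gamma(l k(t) + h) <= l + <n(t), h> + C |h|^2, so that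
   d_K has a quadratic upper bound at every point. If d_K is C^{1,1} near x, it is
   differentiable there, which forces a unique closest point y and makes y remain
   closest along the ray from y through x slightly beyond x. Comparing y with
   nearby boundary points to second order gives d_K kappa_K(y) <= 1 along that ray,
   hence kappa_K(y) d_K(x) < 1.
   Conversely, let y be the only closest point to x, with the strict inequality for
   the arcs at y tangent to the ball x - d_K(x) K. For z near x with closest point q
   and z - q = d_K(z) k(t), the interior of the larger ball q + l (k(t) - K),
   l = d_K(z) + eps, still contains no boundary point q': the functional n(t'), with
   t' - t proportional to the parameter distance from q to q', separates q' from it,
   with a second order margin given by 1 - kappa_K d_K > 0. Where the curvature of K
   vanishes, the Boundary Assumption and the second order condition leave only line
   segments, for which t' = t works. At a corner, y can only be closest if the
   corner is reentrant, and two tangent arcs then leave y in opposite directions.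
   The prolonged rays yield a quadratic lower bound for d_K, and two-sided quadratic
   bounds with uniform constants make the gradient Lipschitz. *)
Require Import Defs.
From HB Require Import structures.
From mathcomp Require Import all_boot all_order all_algebra all_fingroup.
From mathcomp Require Import all_classical all_reals all_analysis.
From mathcomp Require Import ring lra.

Set Implicit Arguments.
Unset Strict Implicit.
Unset Printing Implicit Defensive.

Import Order.TTheory GRing.Theory Num.Theory.
Import numFieldNormedType.Exports.
Local Open Scope classical_set_scope.
Local Open Scope ring_scope.

(** * Plane vectors and curves *)

(** Where the curvature of K vanishes gamma° need not be C^2, so everything runs through the
    parameter t of the boundary of K. The conormal n is C^1 because k is C^2, whatever the
    curvature, and A = - n.k'' >= 0 measures the curvature. The function gamma° is differentiated
    only at positive multiples of n(t) with A(t) > 0, where a curve with c' = be k' has kappa_K =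
    n.c'' / (be^2 A).

    The proportionality factor of the tilt comes from a quadratic. With t' = t - b (s' - s) the
    surplus over l is, to leading order, (s' - s)^2 / 2 times - l b^2 A + 2 b be A - n.c''. The best
    choice b = be / l gives be^2 A / l - n.c'', which for A > 0 is positive exactly when kappa_K l <
    1. The code fixes b = be / la with la = d_K(x), and the strict margin absorbs the difference
    between l and la. The constants then depend only on neighbourhoods of x, y and t0, not on z. *)

Ltac nonneg := repeat match goal with
  | _ => first [assumption | apply: ltW; assumption]
  | |- is_true (0 <= _ ^+ 2) => exact: sqr_ge0
  | |- is_true (0 <= _ * _) => apply: mulr_ge0
  | |- is_true (0 <= _ + _) => apply: addr_ge0
  | |- is_true (0 <= _ ^-1) => rewrite invr_ge0
  | |- is_true (0 <= `|_|) => exact: normr_ge0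
  | |- is_true (0 < _ * _) => apply: mulr_gt0
  | |- is_true (0 < _ ^-1) => rewrite invr_gt0
  | |- is_true (0 < `|_| + 1) => apply: ltr_wpDl
  | _ => done
  end.


Section PlaneVectors.
Context {R : realType}.
Implicit Types (u v w m : R * R) (a : R).

Lemma dotC u v : dot u v = dot v u.
Proof. by rewrite /dot; ring. Qed.

Lemma dotDl u v w : dot (u + v) w = dot u w + dot v w.
Proof. by rewrite /dot /=; ring. Qed.

Lemma dotDr u v w : dot u (v + w) = dot u v + dot u w.
Proof. by rewrite /dot /=; ring. Qed.

Lemma dotNl u v : dot (- u) v = - dot u v.
Proof. by rewrite /dot /=; ring. Qed.

Lemma dotNr u v : dot u (- v) = - dot u v.
Proof. by rewrite /dot /=; ring. Qed.

Lemma dotBl u v w : dot (u - v) w = dot u w - dot v w.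
Proof. by rewrite dotDl dotNl. Qed.

Lemma dotBr u v w : dot u (v - w) = dot u v - dot u w.
Proof. by rewrite dotDr dotNr. Qed.

Lemma dotZl a u v : dot (a *: u) v = a * dot u v.
Proof. by rewrite /dot /= /GRing.scale /=; ring. Qed.

Lemma dotZr a u v : dot u (a *: v) = a * dot u v.
Proof. by rewrite /dot /= /GRing.scale /=; ring. Qed.

Lemma dot0v u : dot 0 u = 0.
Proof. by rewrite /dot /=; ring. Qed.

Lemma dotv0 u : dot u 0 = 0.
Proof. by rewrite /dot /=; ring. Qed.

Lemma dot_perp u : dot u (perp u) = 0.
Proof. by rewrite /dot /=; ring. Qed.

Lemma dot_perp_perp u v : dot (perp u) (perp v) = dot u v.
Proof. by rewrite /dot /=; ring. Qed.

Lemma perpK u : perp (perp u) = - u.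
Proof. by case: u. Qed.

Lemma dot_perpC u v : dot u (perp v) = - dot (perp u) v.
Proof. by rewrite /dot /=; ring. Qed.

Definition dot_lin := (dotDl, dotDr, dotNl, dotNr, dotZl, dotZr).

Lemma pairE u v : u.1 = v.1 -> u.2 = v.2 -> u = v.
Proof. by case: u v => [a b] [c d] /= -> ->. Qed.

Lemma dot_ge0 u : 0 <= dot u u.
Proof. by rewrite /dot; nra. Qed.

Lemma dot_eq0 u : (dot u u == 0) = (u == 0).
Proof.
case: u => a b; rewrite /dot /= -!expr2 paddr_eq0 ?sqr_ge0 //.
by rewrite !sqrf_eq0.
Qed.

Lemma dot_gt0 u : u != 0 -> 0 < dot u u.
Proof. by move=> u0; rewrite lt_def dot_ge0 dot_eq0 u0. Qed.

Lemma perp_eq0 u : (perp u == 0) = (u == 0).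
Proof. by rewrite -dot_eq0 dot_perp_perp dot_eq0. Qed.

Lemma enorm_gt0 u : u != 0 -> 0 < enorm u.
Proof. by move=> u0; rewrite sqrtr_gt0 dot_gt0. Qed.

Lemma enorm_sqr u : enorm u ^+ 2 = dot u u.
Proof. by rewrite sqr_sqrtr ?dot_ge0. Qed.

Lemma perp_decomp v w : v != 0 ->
  w = (dot v w / dot v v) *: v + (dot (perp v) w / dot v v) *: perp v.
Proof.
move=> v0; have /gt_eqF/negbT d0 := dot_gt0 v0.
by case: v w v0 d0 => [a b] [c d] _; rewrite /dot /= => d0;
  apply: pairE => /=; rewrite /GRing.scale /=; field.
Qed.

Lemma orth_parallel u v w : u != 0 -> dot u v = 0 -> dot u w = 0 -> v != 0 ->
  w = (dot v w / dot v v) *: v.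
Proof.
move=> u0 uv uw v0; rewrite {1}(perp_decomp w v0).
suff -> : dot (perp v) w = 0 by rewrite mul0r scale0r addr0.
have := perp_decomp v u0; rewrite uv mul0r scale0r add0r.
have := perp_decomp w u0; rewrite uw mul0r scale0r add0r => -> ->.
by rewrite /dot /= /GRing.scale /=; ring.
Qed.

(** Cramer's rule. For [u = k t] and [v = vel k t] the vector paired with [w] in the first
    coefficient is the conormal of K at [k t]. *)
Lemma frame_decomp u v w : dot (perp v) u != 0 ->
  w = dot ((dot (perp v) u)^-1 *: perp v) w *: u
      + (- dot (perp u) w / dot (perp v) u) *: v.
Proof.
case: u v w => [a b] [c e] [f g]; rewrite /dot /perp /GRing.scale /= => D0.
by apply: pairE; rewrite /= /GRing.scale /=; field.
Qed.

Lemma pnorm_le v a : (`|v| <= a) = (`|v.1| <= a) && (`|v.2| <= a).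
Proof. by rewrite /Num.norm /= ge_max. Qed.

Lemma norm_fst v : `|v.1| <= `|v|.
Proof. by have := lexx `|v|; rewrite pnorm_le => /andP[]. Qed.

Lemma norm_snd v : `|v.2| <= `|v|.
Proof. by have := lexx `|v|; rewrite pnorm_le => /andP[]. Qed.

(** The norm is the sup norm of the product, whence the factor 2 in place of the Cauchy-Schwarz
    constant. *)
Lemma dot_le u v : `|dot u v| <= 2 * `|u| * `|v|.
Proof.
rewrite /dot (le_trans (ler_normD _ _))// !normrM.
have -> : 2 * `|u| * `|v| = `|u| * `|v| + `|u| * `|v| by ring.
by apply: lerD; apply: ler_pM; rewrite ?norm_fst ?norm_snd.
Qed.

End PlaneVectors.

Section PlaneCurves.
Context {R : realType}.
Implicit Types (c : R -> R * R) (t : R) (m : R * R).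

(** Unlike an equation for [vel], which is built on the total function [derive1], this relation
    includes differentiability, and it accepts closed forms such as [conormal'] as velocities. *)
Definition has_vel c c1 t : Prop :=
  is_derive t 1 (fun s => (c s).1) (c1 t).1 /\
  is_derive t 1 (fun s => (c s).2) (c1 t).2.

Definition C2_ball (t0 d : R) c c1 c2 : Prop :=
  forall t, `|t - t0| < d ->
    [/\ has_vel c c1 t, has_vel c1 c2 t & {for t, continuous c2}].

Lemma C2_ball_le t0 d d' c c1 c2 : d' <= d ->
  C2_ball t0 d c c1 c2 -> C2_ball t0 d' c c1 c2.
Proof. by move=> dd H t ht; apply: H; apply: lt_le_trans dd. Qed.

Lemma has_vel_dot m c c1 t : has_vel c c1 t ->
  is_derive t 1 (fun s => dot m (c s)) (dot m (c1 t)).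
Proof.
move=> [H1 H2]; rewrite /dot.
have := is_deriveD (is_deriveZ m.1 H1) (is_deriveZ m.2 H2).
by rewrite /GRing.scale /=.
Qed.

Lemma has_vel_velE c c1 t : has_vel c c1 t -> vel c t = c1 t.
Proof.
by case=> H1 H2; apply: pairE; rewrite /vel /= derive1E; apply: derive_val.
Qed.

Lemma pair_continuous (T : topologicalType) (f : T -> R * R) (t : T) :
  {for t, continuous (fun s => (f s).1)} ->
  {for t, continuous (fun s => (f s).2)} -> {for t, continuous f}.
Proof.
move=> H1 H2.
have -> : f = fun s => ((f s).1, (f s).2) by apply/funext => s; case: (f s).
move: H1 H2; rewrite /continuous_at => H1 H2; exact: (cvg_pair H1 H2).
Qed.

Lemma is_derive_continuous (f : R -> R) t df :
  is_derive t 1 f df -> {for t, continuous f}.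
Proof. by move=> H; apply/differentiable_continuous/derivable1_diffP. Qed.

Lemma has_vel_continuous c c1 t : has_vel c c1 t -> {for t, continuous c}.
Proof.
by case=> H1 H2; apply: pair_continuous; apply: is_derive_continuous; eassumption.
Qed.

Lemma near_dist (V : pseudoMetricNormedZmodType R) (t0 : V) (d : R) : 0 < d ->
  \forall t \near t0, `|t - t0| < d.
Proof.
by move=> d0; apply/nbhs_ballP; exists d => // t; rewrite -ball_normE /= distrC.
Qed.

Lemma near_distP (V : pseudoMetricNormedZmodType R) (t0 : V) (P : V -> Prop) :
  (\forall t \near t0, P t) -> exists2 d : R, 0 < d & forall t : V, `|t - t0| < d -> P t.
Proof.
move=> /nbhs_ballP[d d0 h]; exists d => // t td; apply: h.
by rewrite -ball_normE /= distrC.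
Qed.

Lemma continuous_dist (V : pseudoMetricNormedZmodType R) (f : R -> V) (t0 : R) : {for t0, continuous f} ->
  forall e, 0 < e -> exists2 d, 0 < d &
    forall t, `|t - t0| < d -> `|f t - f t0| < e.
Proof.
move=> /cvgrPdist_lt H e e0; have /nbhs_ballP[d /= d0 Hd] := H _ e0.
by exists d => // t td; rewrite distrC; apply: Hd; rewrite -ball_normE /= distrC.
Qed.

Lemma itv_oo_cc (a b x : R) : x \in `]a, b[ -> x \in `[a, b].
Proof. by rewrite !in_itv /= => /andP[/ltW ? /ltW ?]; apply/andP; split. Qed.

Lemma MVT_ball (f df : R -> R) (t0 d s s' : R) :
  (forall t, `|t - t0| < d -> is_derive t 1 f (df t)) ->
  `|s - t0| < d -> `|s' - t0| < d ->
  exists2 xi, `|xi - t0| < d & f s' - f s = df xi * (s' - s).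
Proof.
move=> H; wlog ss' : s s' / s <= s' => [wl|] hs hs'.
  have [ss'|/ltW ss'] := leP s s'; first exact: wl.
  have [xi hxi e] := wl _ _ ss' hs' hs; exists xi => //.
  by rewrite -opprB e -mulrN opprB.
have I t : t \in `[s, s'] -> `|t - t0| < d.
  by rewrite in_itv /= => /andP[a b]; move: hs hs'; rewrite !ltr_norml; lra.
have [||xi xis e] := @MVT_segment R f df s s' ss'.
- move=> t ts; apply: H; apply: I; apply: itv_oo_cc ts.
- apply: derivable_within_continuous => t ts.
  exact: (@ex_derive _ _ _ _ _ _ _ (H t (I t ts))).
by exists xi => //; apply: I.
Qed.

(** A plane curve has no mean value theorem, so one functional [m] is fixed first and [xi] depends
    on it. Estimates below therefore carry several unrelated intermediate points. *)
Lemma MVT_dot m c c1 (t0 d s s' : R) :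
  (forall t, `|t - t0| < d -> has_vel c c1 t) ->
  `|s - t0| < d -> `|s' - t0| < d ->
  exists2 xi, `|xi - t0| < d & dot m (c s') = dot m (c s) + dot m (c1 xi) * (s' - s).
Proof.
move=> H hs hs'.
have Hd t : `|t - t0| < d -> is_derive t 1 (fun t => dot m (c t)) (dot m (c1 t)).
  by move=> ht; exact: has_vel_dot (H t ht).
have [xi hxi e] := MVT_ball Hd hs hs'.
by exists xi => //; rewrite -e addrC subrK.
Qed.

Lemma taylor2 (f df ddf : R -> R) (t0 d s s' : R) :
  (forall t, `|t - t0| < d -> is_derive t 1 f (df t)) ->
  (forall t, `|t - t0| < d -> is_derive t 1 df (ddf t)) ->
  `|s - t0| < d -> `|s' - t0| < d ->
  exists2 xi, `|xi - t0| < d &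
    f s' = f s + df s * (s' - s) + 2^-1 * ddf xi * (s' - s) ^+ 2.
Proof.
move=> H1 H2 hs hs'.
have [->|ss'] := eqVneq s' s.
  by exists s => //; rewrite subrr expr2 !mulr0 !addr0.
have d0 : s' - s != 0 by rewrite subr_eq0.
(* [K] makes the end values of [p] agree. [p u] is the expansion at the moving base point [u], and
   its derivative telescopes to the product [dp u]. *)
pose K := (f s' - f s - df s * (s' - s)) / (s' - s) ^+ 2.
pose p u := f u + df u * (s' - u) + K * (s' - u) ^+ 2.
pose dp u := (ddf u - 2 * K) * (s' - u).
have Hp u : `|u - t0| < d -> is_derive u 1 p (dp u).
  move=> hu; have h1 := H1 u hu; have h2 := H2 u hu.
  have h3 : is_derive u 1 (fun u => s' - u) (- 1).
    have := is_deriveB (is_derive_cst s' u 1) (is_derive_id u 1).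
    by rewrite sub0r.
  have h4 := is_deriveM h2 h3.
  have h5 := is_deriveZ K (is_deriveX 2 h3).
  have := is_deriveD (is_deriveD h1 h4) h5.
  rewrite /p /dp /GRing.scale /= => h.
  apply: is_derive_eq; rewrite /GRing.scale /=; ring.
have pE : p s = p s'.
  by rewrite /p /K; field.
(* The zero must differ from s', since [dp] vanishes there whatever the value of [ddf]. *)
have [xi [hxi xs e]] : exists xi, [/\ `|xi - t0| < d, xi != s' & dp xi = 0].
  have sub a b u : `|a - t0| < d -> `|b - t0| < d -> u \in `[a, b] -> `|u - t0| < d.
    by rewrite in_itv /= => ha hb /andP[? ?]; move: ha hb; rewrite !ltr_norml; lra.
  have rolle a b : `|a - t0| < d -> `|b - t0| < d -> a < b -> p a = p b ->
    exists xi, [/\ `|xi - t0| < d, a < xi < b & dp xi = 0].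
    move=> ha hb ab pab.
    have [|||xi xab He] := @Rolle R p a b ab.
    - move=> u uab; apply: (@ex_derive _ _ _ _ _ _ _ (Hp u _)); apply: sub ha hb _.
      exact: itv_oo_cc uab.
    - apply: derivable_within_continuous => u uab.
      exact: (@ex_derive _ _ _ _ _ _ _ (Hp u (sub _ _ _ ha hb uab))).
    - by [].
    have hx : `|xi - t0| < d.
      exact: sub ha hb (itv_oo_cc xab).
    exists xi; split => //.
    by have [_ <-] := Hp _ hx; have [_ <-] := He.
  have [lt_ss|gt_ss|eq_ss] := ltgtP s s'; last by rewrite eq_ss eqxx in ss'.
    have [xi [h1 h2 h3]] := rolle _ _ hs hs' lt_ss pE.
    by exists xi; split => //; rewrite lt_eqF//; case/andP: h2.
  have [xi [h1 h2 h3]] := rolle _ _ hs' hs gt_ss (esym pE).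
  by exists xi; split => //; rewrite gt_eqF//; case/andP: h2.
exists xi => //.
move/eqP: e; rewrite mulf_eq0 [s' - xi == 0]subr_eq0 [s' == xi]eq_sym (negbTE xs) orbF subr_eq0 => /eqP ->.
by rewrite /K; field.
Qed.

Lemma taylor2_dot m c c1 c2 (t0 d s s' : R) : C2_ball t0 d c c1 c2 ->
  `|s - t0| < d -> `|s' - t0| < d ->
  exists2 xi, `|xi - t0| < d &
    dot m (c s') = dot m (c s) + dot m (c1 s) * (s' - s)
                   + 2^-1 * dot m (c2 xi) * (s' - s) ^+ 2.
Proof.
move=> H hs hs'.
apply: (@taylor2 (fun t => dot m (c t)) (fun t => dot m (c1 t))
  (fun t => dot m (c2 t)) t0 d s s') => // t /H[? ? _]; exact: has_vel_dot.
Qed.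

(** In the sup norm the coordinates can be treated separately, each with its own intermediate point,
    without loss in the constant [e]. *)
Lemma MVT_vec c c1 (t0 d s s' e : R) (a : R * R) :
  (forall t, `|t - t0| < d -> has_vel c c1 t) ->
  (forall t, `|t - t0| < d -> `|c1 t - a| <= e) ->
  `|s - t0| < d -> `|s' - t0| < d ->
  `|c s' - c s - (s' - s) *: a| <= e * `|s' - s|.
Proof.
move=> H HM hs hs'.
have [x1 hx1 e1] := MVT_dot (1, 0) H hs hs'.
have [x2 hx2 e2] := MVT_dot (0, 1) H hs hs'.
have d1 u : dot (1, 0) u = u.1 by rewrite /dot /=; ring.
have d2 u : dot (0, 1) u = u.2 by rewrite /dot /=; ring.
have -> : c s' - c s - (s' - s) *: a
    = (s' - s) *: ((c1 x1).1 - a.1, (c1 x2).2 - a.2).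
  move: e1 e2; rewrite !d1 !d2 => e1 e2.
  by apply: pairE; rewrite /= /GRing.scale /= ?e1 ?e2; ring.
rewrite normrZ mulrC; apply: ler_wpM2r => //.
by rewrite pnorm_le /= (le_trans (norm_fst (_ - a)) (HM _ hx1))
  (le_trans (norm_snd (_ - a)) (HM _ hx2)).
Qed.

Lemma taylor2_vec c c1 c2 (t0 d s s' M : R) : C2_ball t0 d c c1 c2 ->
  (forall t, `|t - t0| < d -> `|c2 t| <= M) ->
  `|s - t0| < d -> `|s' - t0| < d ->
  exists2 w, `|w| <= M &
    c s' = c s + (s' - s) *: c1 s + (2^-1 * (s' - s) ^+ 2) *: w.
Proof.
move=> H HM hs hs'.
have [x1 hx1 e1] := taylor2_dot (1, 0) H hs hs'.
have [x2 hx2 e2] := taylor2_dot (0, 1) H hs hs'.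
have d1 u : dot (1, 0) u = u.1 by rewrite /dot /=; ring.
have d2 u : dot (0, 1) u = u.2 by rewrite /dot /=; ring.
exists ((c2 x1).1, (c2 x2).2).
  by rewrite pnorm_le /= (le_trans (norm_fst _) (HM _ hx1)) (le_trans (norm_snd _) (HM _ hx2)).
move: e1 e2; rewrite !d1 !d2 => e1 e2.
by apply: pairE; rewrite /= /GRing.scale /= ?e1 ?e2; ring.
Qed.

Lemma continuous_perp c t : {for t, continuous c} -> {for t, continuous (fun s => perp (c s))}.
Proof.
move=> cf; apply: pair_continuous => /=.
  by apply: (@cvgN _ R); apply: (cvg_comp _ _ cf); exact: cvg_snd.
by apply: (cvg_comp _ _ cf); exact: cvg_fst.
Qed.

Lemma continuous_bounded (c : R -> R * R) t : {for t, continuous c} ->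
  exists2 d, 0 < d & forall s, `|s - t| < d -> `|c s| <= `|c t| + 1.
Proof.
move=> /continuous_dist /(_ _ ltr01)[d d0 h]; exists d => // s /h hs.
rewrite -[c s](subrK (c t)) addrC (le_trans (ler_normD _ _))// lerD2l.
exact: ltW.
Qed.

(** The radius serves arbitrary vectors near [u0] and [v0], not only values along curves; the corner
    argument applies it to secant directions. *)
Lemma vec_dot_near (u0 v0 : R * R) (e : R) : 0 < e ->
  exists2 d, 0 < d & forall u v, `|u - u0| < d -> `|v - v0| < d ->
    `|dot u v - dot u0 v0| < e.
Proof.
move=> e0; pose M := `|u0| + `|v0| + 1.
have M0 : 0 < M by rewrite ltr_wpDl ?addr_ge0.
pose d := Num.min 1 (e / (4 * M)).
have d0 : 0 < d by rewrite lt_min ltr01 divr_gt0 ?mulr_gt0.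
have d1 : d <= 1 by rewrite ge_min lexx.
have dM : d * (4 * M) <= e by rewrite -ler_pdivlMr ?mulr_gt0// ge_min lexx orbT.
exists d => // u v hu hv.
have -> : dot u v - dot u0 v0 = dot (u - u0) (v - v0) + dot (u - u0) v0 + dot u0 (v - v0).
  by rewrite !dot_lin; ring.
apply: le_lt_trans (ler_normD _ _) _; apply: le_lt_trans (lerD (ler_normD _ _) (lexx _)) _.
apply: le_lt_trans (lerD (lerD (dot_le _ _) (dot_le _ _)) (dot_le _ _)) _.
have n1 := normr_ge0 (u - u0); have n2 := normr_ge0 (v - v0).
have n3 := normr_ge0 u0; have n4 := normr_ge0 v0.
have p1 : `|u - u0| * `|v - v0| < d * 1.
  by apply: ltr_pM => //; exact: lt_le_trans d1.
have p2 : `|u - u0| * `|v0| <= d * `|v0| by apply: ler_wpM2r => //; exact: ltW.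
have p3 : `|u0| * `|v - v0| <= d * `|u0| by rewrite mulrC; apply: ler_wpM2r => //; exact: ltW.
apply: lt_le_trans dM; rewrite /M -!mulrA.
have -> : d * (4 * (`|u0| + `|v0| + 1)) = 4 * (d * `|u0|) + 4 * (d * `|v0|) + 4 * d by ring.
have q1 : 0 <= d * `|u0| by rewrite mulr_ge0// ltW.
have q2 : 0 <= d * `|v0| by rewrite mulr_ge0// ltW.
rewrite mulr1 in p1.
by move: p1 p2 p3 q1 q2 d0; clear; lra.
Qed.

Lemma dot_near (u v : R -> R * R) (s0 t0 : R) :
  {for s0, continuous u} -> {for t0, continuous v} ->
  forall e, 0 < e -> exists2 d, 0 < d &
    forall s t, `|s - s0| < d -> `|t - t0| < d ->
      `|dot (u s) (v t) - dot (u s0) (v t0)| < e.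
Proof.
move=> cu cv e e0; have [d d0 H] := vec_dot_near (u s0) (v t0) e0.
have [d1 d10 h1] := continuous_dist cu d0.
have [d2 d20 h2] := continuous_dist cv d0.
exists (Num.min d1 d2); first by rewrite lt_min d10.
by move=> s t; rewrite !lt_min => /andP[sd _] /andP[_ td]; apply: H; [exact: h1|exact: h2].
Qed.

End PlaneCurves.

(** * Regularity classes *)

Section PowerSeries.
Context {R : realType}.
Implicit Types (c : R^nat) (x z w : R).

Lemma bernoulli_inequality (u : R) n : 0 <= u -> 1 + n%:R * u <= (1 + u) ^+ n.
Proof.
move=> u0; elim: n => [|n IH]; first by rewrite mul0r addr0 expr0.
rewrite exprS -natr1; have n0 : 0 <= n%:R :> R by [].
have : (1 + u) * (1 + n%:R * u) <= (1 + u) * (1 + u) ^+ n.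
  by apply: ler_wpM2l => //; lra.
by apply: le_trans; nra.
Qed.

(** Two radii w1 < z1 fit between |w| and |x|. The powers of z1 / w1 outgrow the factor n + 1, so
    the differentiated series at w1 is dominated by a convergent one at z1. *)
Lemma is_cvg_pseries_diffs c x w : cvgn (pseries c x) -> `|w| < `|x| ->
  cvgn (pseries (pseries_diffs c) w).
Proof.
move=> Cx wx.
pose z1 := (`|x| + `|w|) / 2; pose w1 := (z1 + `|w|) / 2.
have w0 := normr_ge0 w.
have z1x : `|z1| < `|x| by rewrite ger0_norm /z1; lra.
have w1z : w1 < z1 by rewrite /w1 /z1; lra.
have w10 : 0 < w1 by rewrite /w1 /z1; lra.
have z10 : 0 < z1 by apply: lt_trans w1z.
have ww1 : `|w| < `|w1| by rewrite [ltRHS]ger0_norm /w1 /z1; lra.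
apply: is_cvg_pseries_inside ww1.
pose u := z1 / w1 - 1.
have u0 : 0 < u by rewrite subr_gt0 ltr_pdivlMr // mul1r.
(* As z1 = w1 (1 + u), the domination rests on (1 + 1/u) (1 + u)^n >= (1 + 1/u) (1 + n u) >= n + 1,
   by Bernoulli. *)
pose M := (1 + u^-1) / z1.
apply: normed_cvg; rewrite /normed_series_of /=.
have Cv : cvgn (series (fun i => M * (`|c i.+1| * z1 ^+ i.+1))).
  apply: is_cvg_seriesZ.
  have := is_cvg_pseries_inside_norm Cx z1x => /cvg_ex[l hl].
  apply/cvg_ex; exists (l - `|c 0%N|).
  have -> : series (fun i => `|c i.+1| * z1 ^+ i.+1) =
      (fun n => pseries (fun i => `|c i|) z1 n.+1 - `|c 0%N|).
    apply/funext => n; rewrite /pseries /series /= big_nat_recl //= expr0 mulr1.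
    by rewrite addrC addKr.
  by apply: cvgB; [rewrite (cvg_shiftS (pseries (fun i => `|c i|) z1)) | exact: cvg_cst].
apply: series_le_cvg Cv => [n|n|n]; first exact: normr_ge0.
  by rewrite !mulr_ge0 ?exprn_ge0 ?invr_ge0 ?addr_ge0 ?invr_ge0 // ltW.
rewrite /pseries_diffs !normrM normrX (ger0_norm (ltW w10)) ger0_norm // mulrAC.
rewrite [leLHS]mulrC /M [leRHS]mulrCA; apply: ler_wpM2l => //.
rewrite exprS mulrA divfK ?gt_eqF//.
have -> : z1 = w1 * (1 + u) by rewrite /u subrKC mulrC divfK ?gt_eqF.
rewrite [X in _ <= _ * X]exprMn [leRHS]mulrCA [leLHS]mulrC.
apply: ler_wpM2l; first by rewrite exprn_ge0 ?ltW.
have B := bernoulli_inequality n (ltW u0).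
have u1 : 0 < 1 + u^-1 by rewrite addr_gt0 ?invr_gt0.
apply: le_trans (ler_wpM2l (ltW u1) B).
have e : u^-1 * u = 1 by rewrite mulVf ?gt_eqF.
have -> : (1 + u^-1) * (1 + n%:R * u) = 1 + n%:R * u + u^-1 + n%:R * (u^-1 * u) by ring.
rewrite e mulr1 -natr1; have : 0 <= n%:R * u by apply: mulr_ge0 => //; apply: ltW.
have : 0 < u^-1 by rewrite invr_gt0.
lra.
Qed.

(** Termwise differentiation asks for convergence of the twice differentiated series, and each
    differentiation halves the radius: x, x / 2, x / 4. *)
Lemma is_derive_pseries c x : 0 < x -> cvgn (pseries c x) ->
  forall z, `|z| < x / 4 ->
  is_derive z 1 (fun z => limn (pseries c z)) (limn (pseries (pseries_diffs c) z)).
Proof.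
move=> x0 Cx z zx; have n0 := normr_ge0 z.
have h1 : cvgn (pseries (pseries_diffs c) (x / 2)).
  by apply: is_cvg_pseries_diffs Cx _; rewrite !ger0_norm; lra.
apply: (@pseries_snd_diffs _ _ (x / 4)).
- by apply: is_cvg_pseries_inside Cx _; rewrite !ger0_norm; lra.
- by apply: is_cvg_pseries_inside h1 _; rewrite !ger0_norm; lra.
- by apply: is_cvg_pseries_diffs h1 _; rewrite !ger0_norm; lra.
- by rewrite [ltRHS]ger0_norm //; lra.
Qed.

End PowerSeries.

Section RegularityClasses.
Context {R : realType}.
Implicit Types (V : set R) (f : R -> R).

Definition C2_at f (t : R) :=
  [/\ is_derive t 1 f (derive1 f t), is_derive t 1 (derive1 f) (derive1 (derive1 f) t)
    & {for t, continuous (derive1 (derive1 f))}].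

Lemma Cn_on_C2 V f t : Cn_on 2 V f -> V t -> C2_at f t.
Proof.
move=> H Vt; split.
- have [_ /(_ isT) h] := H 0%N t isT Vt.
  by rewrite derive1E; apply: DeriveDef.
- have [_ /(_ isT) h] := H 1%N t isT Vt.
  by rewrite [derive1 (derive1 f) t]derive1E; apply: DeriveDef.
- by have [h _] := H 2 t isT Vt.
Qed.

(** The expansion at the single point [t] represents [f] on a whole ball, so the derivatives of [f]
    there are the sums [P n] of the differentiated series. *)
Lemma analytic_C2 V f t : analytic_on V f -> V t -> C2_at f t.
Proof.
move=> H /H[a /nbhs_ballP[e /= e0 he]].
have conv h : `|h| < e -> pseries a h @ \oo --> f (t + h).
  by move=> hh; apply: he; rewrite -ball_normE /= sub0r normrN.
pose P n (h : R) : R := limn (pseries (iter n (@pseries_diffs R) a) h).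
have cvgP n : exists2 d, 0 < d & cvgn (pseries (iter n (@pseries_diffs R) a) d).
  elim: n => [|n [d d0 Cd]].
    exists (e / 2); first lra.
    by apply/cvg_ex; exists (f (t + e / 2)); apply: conv; rewrite ger0_norm; lra.
  exists (d / 2); first lra.
  by apply: is_cvg_pseries_diffs Cd _; rewrite !ger0_norm; lra.
have dP n : exists2 d : R, 0 < d & forall h : R, `|h| < d -> is_derive h 1 (P n : R -> R) (P n.+1 h : R).
  have [d d0 Cd] := cvgP n; exists (d / 4); first lra.
  exact: is_derive_pseries d0 Cd.
have [d0 d00 D0] := dP 0%N; have [d1 d10 D1] := dP 1%N; have [d2 d20 D2] := dP 2%N.
pose d := Num.min e (Num.min d0 (Num.min d1 d2)).
have dgt0 : 0 < d by rewrite !lt_min e0 d00 d10 d20.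
have shift (g : R -> R) n : (forall s, `|s - t| < d -> g s = P n (s - t)) -> (n <= 2)%N ->
    forall s, `|s - t| < d -> is_derive s 1 g (P n.+1 (s - t)).
  move=> gE n2 s sd.
  have Dn : is_derive (s - t) 1 (P n) (P n.+1 (s - t)).
    move: sd; rewrite /d !lt_min => /and4P[_ s0 s1 s2].
    by case: n n2 {gE} => [|[|[|]]]// _; [exact: D0|exact: D1|exact: D2].
  have ht : is_derive s 1 (fun s => s - t) 1.
    have := is_deriveB (is_derive_id s (1 : R)) (is_derive_cst t s (1 : R)).
    by rewrite subr0.
  have := @is_derive1_comp _ (P n) (fun s => s - t) s _ _ Dn ht.
  rewrite mulr1; apply: near_eq_is_derive.
  have r0 : 0 < d - `|s - t| by rewrite subr_gt0.
  apply: filterS (near_dist s r0) => u us; rewrite /= gE //.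
  by rewrite -[u - t](subrKA s); have := ler_normD (u - s) (s - t); lra.
have f0 s : `|s - t| < d -> f s = P 0%N (s - t).
  rewrite /d lt_min => /andP[se _]; have := conv _ se.
  by rewrite subrKC => /cvg_lim <-.
have f1 s : `|s - t| < d -> derive1 f s = P 1%N (s - t).
  by move=> sd; rewrite derive1E; apply: derive_val; apply: (shift f 0%N).
have f2 s : `|s - t| < d -> derive1 (derive1 f) s = P 2 (s - t).
  by move=> sd; rewrite derive1E; apply: derive_val; apply: (shift _ 1%N).
have tt : `|t - t| < d by rewrite subrr normr0.
split.
- by rewrite f1//; apply: (shift f 0%N).
- by rewrite f2//; apply: (shift _ 1%N).
(* Continuity of the second derivative is read off from the existence of the third. *)
- by apply: is_derive_continuous; apply: (shift _ 2).
Qed.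

Lemma of_class_C2 (r : regularity R) V f t :
  admissible r -> of_class r V f -> V t -> C2_at f t.
Proof.
case: r => [k alpha|[]|[]] /=; first 1 last.
- by move=> H; apply: Cn_on_C2 (H 2).
- exact: analytic_C2.
move=> [k2 _] [H _]; apply: Cn_on_C2 => m s m2 Vs.
have [h1 h2] := H m s (leq_trans m2 k2) Vs.
by split => // mlt; apply: h2; apply: leq_trans k2.
Qed.

Lemma curve_of_class_C2 (r : regularity R) V c (t0 d : R) : admissible r ->
  curve_of_class r V c -> (forall t, `|t - t0| < d -> V t) ->
  C2_ball t0 d c (vel c) (vel (vel c)).
Proof.
move=> ar [H1 H2] HV t /HV Vt.
have [a1 a2 a3] := of_class_C2 ar H1 Vt.
have [b1 b2 b3] := of_class_C2 ar H2 Vt.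
split.
- exact: (conj a1 b1).
- exact: (conj a2 b2).
- apply: pair_continuous.
    exact: a3.
  exact: b3.
Qed.

End RegularityClasses.

(** * The conormal of K *)

Section Conormal.
Context {R : realType} (r : regularity R) (K : set (R * R)) (k : R -> R * R).
Hypotheses (ar : admissible r) (gb : gauge_body r K k).
Implicit Types (t s : R) (v z : R * R).

Lemma gb_C2 t0 d : C2_ball t0 d k (vel k) (vel (vel k)).
Proof. exact: curve_of_class_C2 ar (gb_class gb) _. Qed.

Lemma gb_closed : closed K.
Proof. by apply: compact_closed (gb_compact gb); exact: norm_hausdorff. Qed.

Lemma gb_mem t : K (k t).
Proof.
have : boundary K (k t) by rewrite -(gb_boundary gb); exists t.
by move=> [/gb_closed].
Qed.

Lemma gb_comb (a b : R) z z' : 0 <= a -> 0 <= b -> a + b = 1 -> K z -> K z' ->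
  K (a *: z + b *: z').
Proof.
move=> a0 b0 ab Kz Kz'.
have [e|a0'] := eqVneq a 0.
  have -> : b = 1 by lra.
  by rewrite e scale0r add0r scale1r.
have [e|b0'] := eqVneq b 0.
  have -> : a = 1 by lra.
  by rewrite e scale0r addr0 scale1r.
have {}a0 : 0 < a by rewrite lt_def a0'.
have {}b0 : 0 < b by rewrite lt_def b0'.
have a1 : a < 1 by lra.
have /convex_setW H := gb_convex gb.
have b_ : b = 1 - a by lra.
have := H z z' _ _ (Itv01 (ltW a0) (ltW a1)) a0 a1.
rewrite !inE => /(_ Kz Kz').
by rewrite /conv /= b_ /unstable.onem.
Qed.

Lemma gb_ball : exists2 rho : R, 0 < rho & forall z, `|z| < rho -> K z.
Proof.
have /near_distP[d d0 h] := gb_origin gb; exists d => // z zd.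
by apply: h; rewrite subr0.
Qed.

Lemma gb_bounded : exists2 M : R, 0 < M & forall z, K z -> `|z| <= M.
Proof.
have [M [Mr h]] := compact_bounded (gb_compact gb).
exists (`|M| + 1); first by rewrite ltr_wpDl.
by move=> z Kz; apply: (h _ _ z Kz); rewrite (le_lt_trans (ler_norm _)) ?ltrDl.
Qed.

Lemma gb_nu_neq0 t : nu k t != 0.
Proof. by rewrite perp_eq0; apply/eqP; exact: gb_regular gb t. Qed.

Lemma right_nbhs0 (P : R -> Prop) : (\forall s \near (0 : R)^'+, P s) ->
  exists2 d : R, 0 < d & forall s, 0 < s -> s < d -> P s.
Proof.
move=> /nbhs_ballP[d d0 h]; exists d => // s s0 sd; apply: h => //.
by rewrite /ball /= sub0r normrN gtr0_norm.
Qed.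

(** [nu_into] excludes only short steps along the outward normal. By convexity a long step ending in
    K would bring all shorter ones into K. *)
Lemma gb_no_outer_normal t (c : R) : 0 < c -> ~ K (k t - c *: nu k t).
Proof.
move=> c0 Kc; have [d d0 H] := right_nbhs0 (gb_inward gb t).
pose s := Num.min (d / 2) c.
have s0 : 0 < s by rewrite lt_min c0 divr_gt0.
have sd : s < d by rewrite gt_min; apply/orP; left; lra.
have sc : s <= c by rewrite ge_min lexx orbT.
have [_ []] := H s s0 sd.
have -> : k t - s *: nu k t = (1 - s / c) *: k t + (s / c) *: (k t - c *: nu k t).
  rewrite scalerBr scalerA divfK ?gt_eqF// scalerBl scale1r.
  by rewrite addrA subrK.
apply: gb_comb (gb_mem t) Kc; last by rewrite subrK.
- by rewrite subr_ge0 ler_pdivrMr// mul1r.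
- by rewrite divr_ge0 ?ltW.
Qed.

Lemma continuous_vel t : {for t, continuous (vel k)}.
Proof.
have [|_ h _] := @gb_C2 t 1 t; first by rewrite subrr normr0.
exact: has_vel_continuous h.
Qed.

(** Convexity makes the local side condition global. If z lay beyond the tangent line, the chord
    from z to a point k (t + s) on the other tangential side would meet the outer normal at k t: the
    tangential offset of k (t + s) is of order s, its normal offset only o(s). *)
Lemma gb_support t z : K z -> 0 <= dot (nu k t) (z - k t).
Proof.
move=> Kz; rewrite leNgt; apply/negP => be0.
set T := vel k t; set be := dot _ _ in be0.
have T0 : T != 0 by apply/eqP; exact: gb_regular gb t.
have q0 := dot_gt0 T0; set q := dot T T in q0.
pose al := dot T (z - k t).
have outer P : K P -> dot T (P - k t) = 0 -> dot (nu k t) (P - k t) < 0 -> False.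
  move=> KP h1 h2.
  apply: (@gb_no_outer_normal t (- (dot (nu k t) (P - k t)) / q)).
    by rewrite divr_gt0 ?oppr_gt0.
  suff -> : k t - (- (dot (nu k t) (P - k t)) / q) *: nu k t = P by [].
  rewrite mulNr scaleNr opprK -[RHS](subrK (k t)) addrC [in RHS](perp_decomp (P - k t) T0).
  by rewrite h1 mul0r scale0r add0r.
have [al0|al0] := eqVneq al 0; first exact: outer Kz al0 be0.
have cc (v : R * R) : {for t, continuous (fun _ : R => v)} by exact: cvg_cst.
have [d1 d10 h1] := dot_near (cc T) (@continuous_vel t) (divr_gt0 q0 (ltr0n R 2)).
(* This bound on the normal velocity [w] gives |al w| <= - be q / 4, while u > q / 2 gives u be < be
   q / 2. *)
have eta0 : 0 < - be * q / (4 * `|al|).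
  by rewrite divr_gt0 ?mulr_gt0 ?oppr_gt0 ?normr_gt0.
have [d2 d20 h2] := dot_near (cc (nu k t)) (@continuous_vel t) eta0.
pose d := Num.min d1 d2.
have d0 : 0 < d by rewrite lt_min d10.
pose s := - Num.sg al * (d / 2).
have sg1 : `|Num.sg al| = 1 by rewrite normr_sg al0.
have sd : `|s| < d by rewrite /s normrM normrN sg1 mul1r gtr0_norm; lra.
have sal : s * al < 0.
  rewrite /s !mulNr oppr_lt0 mulrAC -normrEsg.
  by rewrite mulr_gt0 ?normr_gt0//; lra.
have in_d : `|(t + s) - t| < d by rewrite addrAC subrr add0r.
have in_d0 : `|t - t| < d by rewrite subrr normr0.
have hv u : `|u - t| < d -> has_vel k (vel k) u by move=> /gb_C2[].
have [x1 hx1 e1] := MVT_dot T hv in_d0 in_d.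
have [x2 hx2 e2] := MVT_dot (nu k t) hv in_d0 in_d.
have {}h1 : q / 2 < dot T (vel k x1).
  have := h1 t x1; rewrite subrr normr0 => /(_ d10).
  move: hx1; rewrite lt_min => /andP[-> _] /(_ isT); rewrite -/q ltr_norml; lra.
have {}h2 : `|dot (nu k t) (vel k x2)| < - be * q / (4 * `|al|).
  have := h2 t x2; rewrite subrr normr0 => /(_ d20).
  move: hx2; rewrite lt_min => /andP[_ ->] /(_ isT).
  by rewrite [dot (nu k t) (vel k t)]dotC dot_perp subr0.
set u := dot T _ in h1 e1; set w := dot (nu k t) (vel k x2) in h2 e2.
have s0 : s != 0 by apply/eqP => s0; move: sal; rewrite s0 mul0r ltxx.
have u0 : 0 < u by lra.
(* The weights s u / D and - al / D add up to 1 and cancel the tangential component; they are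
   positive because [s] has the sign opposite to [al]. *)
pose D := s * u - al.
have D0 : D != 0.
  by apply/eqP => De; have : s * D = 0 by [rewrite De mulr0]; rewrite /D; nra.
have sD : 0 < s / D.
  have -> : s / D = s * D / D ^+ 2 by field.
  rewrite divr_gt0 ?exprn_even_gt0//= /D mulrBr.
  have : 0 < s * (s * u) by rewrite mulrA mulr_gt0// -expr2 exprn_even_gt0.
  by lra.
have alD : 0 < - al / D.
  have -> : - al / D = (s * - al / s ^+ 2) * (s / D) by field; rewrite s0 D0.
  rewrite mulr_gt0// divr_gt0 ?exprn_even_gt0//=; lra.
have ab1 : s / D * u + - al / D = 1 by rewrite /D; field; rewrite -/D.
have Pk : (s / D * u) *: z + (- al / D) *: k (t + s) - k t =
    (s / D * u) *: (z - k t) + (- al / D) *: (k (t + s) - k t).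
  rewrite -{1}[k t]scale1r -ab1. by apply: pairE; rewrite /= /GRing.scale /=; ring.
apply: (outer ((s / D * u) *: z + (- al / D) *: k (t + s))).
- apply: gb_comb Kz (gb_mem _); [by rewrite mulr_ge0 ?ltW|by rewrite ltW|exact: ab1].
- rewrite Pk.
  rewrite dotDr !dotZr -/al [dot T (k (t + s) - k t)]dotBr e1.
  by field.
- rewrite Pk.
  rewrite dotDr !dotZr -/be [dot (nu k t) (k (t + s) - k t)]dotBr e2.
  have -> : s / D * u * be + - al / D * (dot (nu k t) (k t) + w * (t + s - t) - dot (nu k t) (k t))
     = s / D * (u * be - al * w) by field.
  rewrite pmulr_rlt0// -subr_gt0 sub0r opprB.
  have /ltr_normlP[w1 w2] := h2.
  have : `|al * w| <= - be * q / 4.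
    rewrite normrM; have -> : - be * q / 4 = `|al| * (- be * q / (4 * `|al|)).
      by field; rewrite normr_eq0.
    by apply: ler_wpM2l => //; apply: ltW.
  rewrite ler_norml => /andP[]; nra.
Qed.

(** Support at 0 would give only a weak inequality, so it is applied at a small negative multiple of
    [nu k t], inside a ball about 0 contained in K. *)
Lemma gb_nu_pos t : dot (nu k t) (k t) < 0.
Proof.
have [rho rho0 H] := gb_ball.
have n0 := gb_nu_neq0 t; set m := nu k t in n0 *.
have nm : 0 < `|m| by rewrite normr_gt0.
have := @gb_support t (- (rho / (2 * `|m|)) *: m).
rewrite dotBr -/m dotZr => h.
suff : dot m (k t) <= - (rho / (2 * `|m|)) * dot m m.
  move=> /le_lt_trans; apply; rewrite mulNr oppr_lt0 mulr_gt0 ?dot_gt0//.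
  by rewrite divr_gt0// mulr_gt0.
rewrite -subr_ge0; apply: h; apply: H.
rewrite normrZ normrN gtr0_norm ?divr_gt0 ?mulr_gt0//.
have -> : rho / (2 * `|m|) * `|m| = rho / 2 by field; rewrite gt_eqF.
lra.
Qed.

End Conormal.

(* nu points into K, so dot (nu k t) (k t) < 0 and the conormal points outward. *)
Definition conormal {R : realType} (k : R -> R * R) (t : R) : R * R :=
  (dot (nu k t) (k t))^-1 *: nu k t.

(** The quotient rule for [conormal]: since [nu k t] is orthogonal to [vel k t], only the derivative
    of [nu k] contributes to that of the denominator. *)
Definition conormal' {R : realType} (k : R -> R * R) (t : R) : R * R :=
  (dot (nu k t) (k t))^-1 *: (perp (vel (vel k) t)
    - dot (perp (vel (vel k) t)) (k t) *: conormal k t).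

(** The coordinates of [conormal], with velocity (a, b), position (c, d) and [q] their
    determinant. *)
Lemma is_derive_det {R : realType} (a b c d : R -> R) (t a' b' c' d' : R) :
  is_derive t 1 a a' -> is_derive t 1 b b' -> is_derive t 1 c c' -> is_derive t 1 d d' ->
  - b t * c t + a t * d t != 0 ->
  let q s := - b s * c s + a s * d s in
  let q' := - b' * c t - b t * c' + a' * d t + a t * d' in
  is_derive t 1 (fun s => (q s)^-1 * - b s) ((q t)^-1 * - b' + q' * (- (q t)^-1 ^+ 2) * - b t) /\
  is_derive t 1 (fun s => (q s)^-1 * a s) ((q t)^-1 * a' + q' * (- (q t)^-1 ^+ 2) * a t).
Proof.
move=> Da Db Dc Dd q0 q q'.
have Dnb : is_derive t 1 (fun s => - b s) (- b') by exact: is_deriveN Db.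
have Dq : is_derive t 1 q q'.
  have := is_deriveD (is_deriveM Dnb Dc) (is_deriveM Da Dd).
  move=> h; apply: (@is_derive_eq _ _ _ _ _ _ _ _ h).
  by rewrite /q' /GRing.scale /=; ring.
have DV := @is_deriveV _ q _ _ _ q0 Dq.
split.
  have h := is_deriveM DV Dnb; apply: (@is_derive_eq _ _ _ _ _ _ _ _ h).
  by rewrite /GRing.scale /= -exprVn; ring.
have h := is_deriveM DV Da; apply: (@is_derive_eq _ _ _ _ _ _ _ _ h).
by rewrite /GRing.scale /= -exprVn; ring.
Qed.

Section ConormalTheory.
Context {R : realType} (r : regularity R) (K : set (R * R)) (k : R -> R * R).
Hypotheses (ar : admissible r) (gb : gauge_body r K k).
Implicit Types (t s : R) (v z : R * R).

Local Notation n := (conormal k).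
Local Notation n' := (conormal' k).

Let q_neq0 t : dot (nu k t) (k t) != 0.
Proof. by rewrite lt_eqF// (gb_nu_pos ar gb). Qed.

Lemma gb_vel t : has_vel k (vel k) t.
Proof. by have [|] := gb_C2 ar gb (t0 := t) (d := 1) (t := t); rewrite ?subrr ?normr0. Qed.

Lemma gb_acc t : has_vel (vel k) (vel (vel k)) t.
Proof. by have [|] := gb_C2 ar gb (t0 := t) (d := 1) (t := t); rewrite ?subrr ?normr0. Qed.

Lemma gb_acc_continuous t : {for t, continuous (vel (vel k))}.
Proof. by have [|] := gb_C2 ar gb (t0 := t) (d := 1) (t := t); rewrite ?subrr ?normr0. Qed.

Lemma conormal_k t : dot (n t) (k t) = 1.
Proof. by rewrite dotZl mulVf. Qed.

Lemma conormal_vel t : dot (n t) (vel k t) = 0.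
Proof. by rewrite dotZl /nu [X in _ * X]dotC dot_perp mulr0. Qed.

Lemma conormal_neq0 t : n t != 0.
Proof. by apply/eqP => e; have := conormal_k t; rewrite e dot0v => /esym/eqP; rewrite oner_eq0. Qed.

Lemma conormal_le1 t z : K z -> dot (n t) z <= 1.
Proof.
move=> Kz; have := gb_support ar gb t Kz; have q0 := gb_nu_pos ar gb t.
rewrite dotBr dotZl => h.
by rewrite ler_ndivrMl// mulr1; lra.
Qed.

Lemma conormal_nu t : nu k t = dot (nu k t) (k t) *: n t.
Proof. by rewrite /n scalerA divff ?scale1r. Qed.

Lemma conormal_has_vel t : has_vel n n' t.
Proof.
have [v1 v2] := gb_vel t; have [a1 a2] := gb_acc t.
have [h1 h2] := is_derive_det a1 a2 v1 v2 (q_neq0 t).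
split; [apply: is_derive_eq h1 _ | apply: is_derive_eq h2 _];
  rewrite /conormal' /conormal /nu; move: (vel k t) (vel (vel k) t) (k t) => V A P;
  rewrite /dot /perp /GRing.scale /= /GRing.scale /=; ring.
Qed.

Lemma conormal_continuous t : {for t, continuous n}.
Proof. exact: has_vel_continuous (conormal_has_vel t). Qed.

Lemma gb_k_continuous t : {for t, continuous k}.
Proof. exact: has_vel_continuous (gb_vel t). Qed.

Lemma gb_vel_continuous t : {for t, continuous (vel k)}.
Proof. exact: has_vel_continuous (gb_acc t). Qed.

Lemma conormal'_continuous t : {for t, continuous n'}.
Proof.
have fstc (f : R -> R * R) : {for t, continuous f} -> {for t, continuous (fun s => (f s).1)}.
  by move=> cf; apply: (cvg_comp _ _ cf); exact: cvg_fst.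
have sndc (f : R -> R * R) : {for t, continuous f} -> {for t, continuous (fun s => (f s).2)}.
  by move=> cf; apply: (cvg_comp _ _ cf); exact: cvg_snd.
have perpc (f : R -> R * R) : {for t, continuous f} -> {for t, continuous (fun s => perp (f s))}.
  move=> cf; apply: pair_continuous => /=; last exact: fstc.
  by apply: (@cvgN _ R); exact: sndc.
have dotc (f g : R -> R * R) : {for t, continuous f} -> {for t, continuous g} ->
    {for t, continuous (fun s => dot (f s) (g s))}.
  by move=> cf cg; apply: (@cvgD _ R); apply: (@cvgM R);
    do ?[exact: fstc|exact: sndc].
have nuc : {for t, continuous (nu k)} by apply: perpc; exact: gb_vel_continuous.
have ac : {for t, continuous (fun s => perp (vel (vel k) s))}.
  by apply: perpc; exact: gb_acc_continuous.
apply: (@cvgZ _ (R * R)%type); last first.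
  apply: (@cvgB _ (R * R)%type) => //; apply: (@cvgZ _ (R * R)%type).
    by apply: dotc => //; exact: gb_k_continuous.
  exact: conormal_continuous.
apply: (@cvgV R); first exact: q_neq0.
by apply: dotc => //; exact: gb_k_continuous.
Qed.

Lemma conormal'_k t : dot (n' t) (k t) = 0.
Proof. by rewrite /conormal' dotZl dotBl dotZl conormal_k mulr1 subrr mulr0. Qed.

(** The derivative of n.k' = 0. The right side is the quantity called [A] from here on, which is the
    curvature of K up to a positive factor. *)
Lemma conormal'_vel t : dot (n' t) (vel k t) = - dot (n t) (vel (vel k) t).
Proof.
rewrite /conormal' dotZl dotBl dotZl conormal_vel mulr0 subr0.
rewrite /conormal dotZl -mulrN /nu; congr (_ * _).
by move: (vel (vel k) t) (vel k t) => A V; rewrite /dot /perp /=; ring.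
Qed.

End ConormalTheory.

(** * The gauge *)

Section GaugeTheory.
Context {R : realType} (r : regularity R) (K : set (R * R)) (k : R -> R * R).
Hypotheses (ar : admissible r) (gb : gauge_body r K k).
Implicit Types (t s l : R) (v w z : R * R).

Local Notation n := (conormal k).
Local Notation gam := (gauge K).

Let G v := [set l : R | 0 < l /\ exists2 z, K z & v = l *: z].

Let G_lb v : has_lbound (G v).
Proof. by exists 0 => l [/ltW]. Qed.

Lemma gb_mem0 : K 0.
Proof. by have [rho rho0 H] := gb_ball gb; apply: H; rewrite normr0. Qed.

Lemma gauge_le l z : 0 < l -> K z -> gam (l *: z) <= l.
Proof. by move=> l0 Kz; apply: (ge_inf (G_lb (l *: z))); split => //; exists z. Qed.

Let G_ne v : v != 0 -> nonempty (G v).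
Proof.
move=> v0; have [rho rho0 H] := gb_ball gb.
have nv : 0 < `|v| by rewrite normr_gt0.
have l0 : 0 < 2 * `|v| / rho by rewrite divr_gt0 ?mulr_gt0.
exists (2 * `|v| / rho); split => //; exists ((2 * `|v| / rho)^-1 *: v).
  apply: H; rewrite normrZ gtr0_norm ?invr_gt0//.
  have -> : (2 * `|v| / rho)^-1 * `|v| = rho / 2 by field; rewrite ?gt_eqF// gt_eqF.
  lra.
by rewrite scalerA divff ?gt_eqF// scale1r.
Qed.

(** The admissible dilations are closed upwards because K is star-shaped about 0, and their infimum
    is attained because K is closed. At the infimum the scaled point is not interior, since a point
    of K further out would give a smaller dilation. *)
Lemma gauge_attained v : v != 0 -> 0 < gam v /\ exists t, v = gam v *: k t.
Proof.
move=> v0; have nv : 0 < `|v| by rewrite normr_gt0.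
have [M M0 HM] := gb_bounded gb.
have g0 : 0 < gam v.
  have m0 : 0 < `|v| / M by rewrite divr_gt0.
  apply: lt_le_trans m0 _; apply: lb_le_inf; first exact: G_ne.
  move=> l [l0 [z Kz ->]]; rewrite normrZ gtr0_norm// ler_pdivrMr//.
  by rewrite ler_pM2l// HM.
split=> //; set l0 := gam v in g0 *.
pose p := l0^-1 *: v.
have vp : v = l0 *: p by rewrite scalerA divff ?gt_eqF// scale1r.
have Kl l : l0 < l -> K (l^-1 *: v).
  move=> l0l; have [||l' [l'0 [z Kz vz]] l'l] := @inf_adherent _ (G v) (l - l0).
  - by rewrite subr_gt0.
  - by split; [exact: G_ne|exact: G_lb].
  have {}l'l : l' < l by move: l'l; rewrite addrC -/(gam v) subrK.
  have ll : 0 < l by apply: lt_trans l'l.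
  have -> : l^-1 *: v = (l' / l) *: z + (1 - l' / l) *: 0.
    by rewrite scaler0 addr0 vz scalerA mulrC.
  apply: (gb_comb gb) Kz gb_mem0; last by rewrite addrC subrK.
  - by rewrite divr_ge0 ?ltW.
  - by rewrite subr_ge0 ler_pdivrMr ?mul1r ?ltW.
have p0 : 0 < `|p| by rewrite normr_gt0 scaler_eq0 negb_or invr_eq0 gt_eqF.
have Kp : K p.
  apply/not_notP => nKp.
  have : open (~` K) by apply: closed_openC; exact: gb_closed gb.
  rewrite openE => /(_ p nKp) /near_distP[e e0 He].
  pose d := e / (2 * `|p|).
  have d0 : 0 < d by rewrite divr_gt0 ?mulr_gt0.
  apply: (He ((l0 * (1 + d))^-1 *: v)); last first.
    by apply: Kl; rewrite mulrDr mulr1 ltrDl mulr_gt0.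
  have -> : (l0 * (1 + d))^-1 *: v - p = - (d / (1 + d)) *: p.
    rewrite {1}vp scalerA -{2}[p]scale1r -scalerBl; congr (_ *: _).
    by field; rewrite !gt_eqF// addr_gt0.
  rewrite normrZ normrN ger0_norm; last by rewrite divr_ge0 ?addr_ge0 ?ltW.
  apply: (@le_lt_trans _ _ (d * `|p|)).
    by apply: ler_wpM2r => //; rewrite ler_pdivrMr ?addr_gt0//; nra.
  have -> : d * `|p| = e / 2 by rewrite /d; field; rewrite gt_eqF.
  lra.
have : boundary K p.
  split; first exact: subset_closure.
  move=> /near_distP[e e0 He].
  pose d := e / (2 * `|p|).
  have d0 : 0 < d by rewrite divr_gt0 ?mulr_gt0.
  have Kd : K ((1 + d) *: p).
    apply: He; rewrite scalerDl scale1r addrAC subrr add0r normrZ gtr0_norm//.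
    have -> : d * `|p| = e / 2 by rewrite /d; field; rewrite gt_eqF.
    lra.
  have d1 : 0 < 1 + d by rewrite addr_gt0.
  have := gauge_le (divr_gt0 g0 d1) Kd.
  rewrite scalerA divfK ?gt_eqF// -vp -/l0 leNgt => /negP; apply.
  by rewrite ltr_pdivrMr// mulrDr mulr1 ltrDl mulr_gt0.
by rewrite -(gb_boundary gb) => -[t _ kt]; exists t; rewrite kt.
Qed.

Lemma gauge0 : gam 0 = 0.
Proof.
apply/eqP; rewrite eq_le; apply/andP; split.
  apply/ler_addgt0Pl => e e0; rewrite addr0.
  by rewrite -{1}[0](scaler0 _ e); apply: gauge_le => //; exact: gb_mem0.
apply: lb_le_inf; last by move=> l [/ltW].
by exists 1; split => //; exists 0; [exact: gb_mem0|rewrite scaler0].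
Qed.

Lemma gauge_ge0 v : 0 <= gam v.
Proof.
by have [->|/gauge_attained[/ltW]//] := eqVneq v 0; rewrite gauge0.
Qed.

Lemma gauge_ex v : exists2 t, v = gam v *: k t & K (k t).
Proof.
have [->|/gauge_attained[_ [t vt]]] := eqVneq v 0.
  by exists 0; rewrite ?gauge0 ?scale0r//; exact: gb_mem gb _.
by exists t => //; exact: gb_mem gb _.
Qed.

Lemma conormal_le_gauge t v : dot (n t) v <= gam v.
Proof.
have [s vs Ks] := gauge_ex v; rewrite {1}vs dotZr ler_piMr ?gauge_ge0//.
exact: (conormal_le1 ar gb).
Qed.

Lemma gauge_k t l : 0 <= l -> gam (l *: k t) = l.
Proof.
move=> l0; apply/eqP; rewrite eq_le; apply/andP; split.
  have [->|l0'] := eqVneq l 0; first by rewrite scale0r gauge0.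
  by apply: gauge_le; [rewrite lt_def l0'|exact: gb_mem gb _].
by apply: le_trans (conormal_le_gauge t _); rewrite dotZr (conormal_k ar gb) mulr1.
Qed.

Lemma gaugeZ l v : 0 <= l -> gam (l *: v) = l * gam v.
Proof.
move=> l0; have [t vt _] := gauge_ex v.
by rewrite {1}vt scalerA gauge_k// mulr_ge0 ?gauge_ge0.
Qed.

Lemma gaugeD v w : gam (v + w) <= gam v + gam w.
Proof.
have [t e _] := gauge_ex (v + w).
have -> : gam (v + w) = dot (n t) (v + w).
  by rewrite {2}e dotZr (conormal_k ar gb) mulr1.
by rewrite dotDr lerD ?conormal_le_gauge.
Qed.

Lemma gauge_bound : exists2 M : R, 0 < M & forall v, gam v <= M * `|v|.
Proof.
have [rho rho0 H] := gb_ball gb; exists (2 / rho); first by rewrite divr_gt0.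
move=> v; have [->|v0] := eqVneq v 0; first by rewrite gauge0 normr0 mulr0.
have nv : 0 < `|v| by rewrite normr_gt0.
have l0 : 0 < 2 / rho * `|v| by rewrite mulr_gt0 ?divr_gt0.
have {1}-> : v = (2 / rho * `|v|) *: ((2 / rho * `|v|)^-1 *: v).
  by rewrite scalerA divff ?gt_eqF// scale1r.
apply: gauge_le => //; apply: H; rewrite normrZ gtr0_norm ?invr_gt0//.
have -> : (2 / rho * `|v|)^-1 * `|v| = rho / 2 by field; rewrite ?gt_eqF// gt_eqF.
lra.
Qed.

Lemma gauge_lip M : (forall v, gam v <= M * `|v|) ->
  forall v w, `|gam v - gam w| <= M * `|v - w|.
Proof.
move=> HM v w; have h1 := gaugeD (v - w) w; have h2 := gaugeD (w - v) v.
rewrite subrK in h1; rewrite subrK in h2.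
have := HM (v - w); have := HM (w - v); rewrite (distrC w v) ler_norml; lra.
Qed.

Lemma gauge_continuous : continuous gam.
Proof.
move=> v; have [M M0 HM] := gauge_bound.
apply/cvgrPdist_lt => e e0.
have d0 : 0 < e / M by rewrite divr_gt0.
apply: filterS (near_dist v d0) => w wd; rewrite distrC.
by apply: le_lt_trans (gauge_lip HM _ _) _; rewrite mulrC -ltr_pdivlMr.
Qed.

(** The segment from k t to z lies on the face n t = 1, and moving from it along [n t] leaves K, so
    it lies in the boundary. Every use of strict convexity passes through this lemma. *)
Lemma conormal_eq1 t z : K z -> dot (n t) z = 1 -> z = k t.
Proof.
move=> Kz nz; apply/eqP; rewrite eq_sym; apply/negPn/negP => /eqP kz.
apply: (gb_strict gb kz) => _ [s /= +] <-; rewrite in_itv /= => /andP[s0 s1].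
have Kp : K ((1 - s) *: k t + s *: z).
  by apply: (gb_comb gb) (gb_mem gb t) Kz => //; [rewrite subr_ge0|rewrite subrK].
split; first exact: subset_closure.
move=> /near_distP[e e0 He].
have n0 := conormal_neq0 ar gb t.
have nn : 0 < `|n t| by rewrite normr_gt0.
pose c := e / (2 * `|n t|).
have c0 : 0 < c by rewrite divr_gt0 ?mulr_gt0.
have /(conormal_le1 ar gb t) : K (((1 - s) *: k t + s *: z) + c *: n t).
  apply: He; rewrite addrAC subrr add0r normrZ gtr0_norm//.
  have -> : c * `|n t| = e / 2 by rewrite /c; field; rewrite gt_eqF.
  lra.
have E m : dot m (((1 - s) *: k t + s *: z) + c *: m) =
  (1 - s) * dot m (k t) + s * dot m z + c * dot m m by rewrite !dot_lin.
rewrite E nz (conormal_k ar gb) !mulr1 subrK gerDl leNgt => /negP; apply.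
by rewrite mulr_gt0 ?dot_gt0.
Qed.

Lemma conormal_eq_gauge t v : dot (n t) v = gam v -> v = gam v *: k t.
Proof.
have [->|v0] := eqVneq v 0; first by rewrite gauge0 scale0r.
have [g0 [s vs]] := gauge_attained v0.
rewrite {1}vs dotZr => e; suff <- : k s = k t by [].
apply: conormal_eq1; first exact: gb_mem gb s.
by apply: (mulfI (lt0r_neq0 g0)); rewrite e mulr1.
Qed.

Lemma k_inj_gauge t s l l' : 0 < l -> 0 < l' -> l *: k t = l' *: k s -> k t = k s.
Proof.
move=> l0 l'0 e; have el : l = l' by rewrite -(gauge_k t (ltW l0)) e gauge_k ?ltW.
by move: e; rewrite el => /(scalerI (lt0r_neq0 l'0)).
Qed.

End GaugeTheory.

Section GaugeSmoothness.
Context {R : realType} (r : regularity R) (K : set (R * R)) (k : R -> R * R).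
Hypotheses (ar : admissible r) (gb : gauge_body r K k).
Implicit Types (t s l : R) (v w h z : R * R).

Local Notation n := (conormal k).
Local Notation gam := (gauge K).

Let cst_continuous (v : R * R) t : {for t, continuous (fun _ : R => v)}.
Proof. exact: cvg_cst. Qed.

(* With h = p k + q k', the point l k + h differs by O(|h|^2) from
   (l + p) k(t + q / (l + p)). *)
Lemma gauge_upper t0 l0 : 0 < l0 ->
  exists C d, [/\ 0 < C, 0 < d & forall t l h, `|t - t0| < d -> l0 <= l -> `|h| < d ->
    gam (l *: k t + h) <= l + dot (n t) h + C * `|h| ^+ 2].
Proof.
move=> l00.
have [M M0 HM] := gauge_bound gb.
have [d1 d10 B1] := continuous_bounded (gb_k_continuous ar gb (t := t0)).
have [d2 d20 B2] := continuous_bounded (conormal_continuous ar gb (t := t0)).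
have [d3 d30 B3] := continuous_bounded (gb_acc_continuous ar gb (t := t0)).
set W := `|vel (vel k) t0| + 1 in B3.
have W0 : 0 <= W by rewrite /W addr_ge0.
have q0 := gb_nu_pos ar gb t0; set q := dot _ _ in q0.
have e0 : 0 < - q / 2 by rewrite divr_gt0 ?oppr_gt0.
have [d4 d40 B4] := dot_near (continuous_perp (gb_vel_continuous ar gb (t := t0)))
  (gb_k_continuous ar gb (t := t0)) e0.
(* [N] bounds both coordinates of [h] in the frame [k t], [vel k t]; for the second one the
   determinant is kept below q / 2 < 0. *)
pose N := 2 * (`|n t0| + 1) + 2 * (`|k t0| + 1) * (2 / - q).
have N1 : 0 < 2 * (`|n t0| + 1) by rewrite mulr_gt0 ?ltr_wpDl.
have N2 : 0 < 2 * (`|k t0| + 1) * (2 / - q).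
  by rewrite !mulr_gt0 ?ltr_wpDl ?invr_gt0 ?oppr_gt0.
have N0 : 0 < N by rewrite addr_gt0.
pose dm := Num.min d1 (Num.min d2 (Num.min d3 d4)).
have dm0 : 0 < dm by rewrite !lt_min d10 d20 d30 d40.
(* The second bound gives N |h| < l0 / 2, hence l + p >= l0 / 2; the third keeps the shift [tau]
   below dm / 2. *)
pose d := Num.min (dm / 2) (Num.min (l0 / (2 * N)) (dm * l0 / (4 * N))).
have d0 : 0 < d by rewrite !lt_min !divr_gt0 ?mulr_gt0.
exists (M * N ^+ 2 * W / l0 + 1), d; split => //.
  by apply: ltr_wpDl => //; nonneg.
move=> t l h; rewrite /d !lt_min => /and3P[td _ _] l0l /and3P[_ h1 h2].
have tdm : `|t - t0| < dm by apply: lt_trans td _; clear -dm0; lra.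
have : `|t - t0| < dm by [].
rewrite !lt_min => /and4P[t1 t2 t3 t4].
pose p := dot (n t) h.
have qt : dot (nu k t) (k t) < q / 2.
  have := B4 t t t4 t4; rewrite -/(nu k t) -/(nu k t0) -/q ltr_norml.
  by clear -q0; lra.
pose qq := - dot (perp (k t)) h / dot (nu k t) (k t).
have qt0 : dot (nu k t) (k t) != 0 by rewrite lt_eqF//; clear -q0 qt; lra.
have hE : h = p *: k t + qq *: vel k t by exact: frame_decomp qt0.
have hn := normr_ge0 h.
have pN : `|p| <= N * `|h|.
  apply: le_trans (dot_le _ _) _; apply: ler_wpM2r => //.
  apply: (@le_trans _ _ (2 * (`|n t0| + 1))); first by rewrite ler_pM2l// B2.
  by rewrite lerDl ltW.
have qN : `|qq| <= N * `|h|.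
  rewrite /qq normrM normrN normfV.
  have D1 : - q / 2 <= `|dot (nu k t) (k t)| by rewrite ler0_norm; clear -q0 qt; lra.
  apply: (@le_trans _ _ (2 * (`|k t0| + 1) * `|h| * (2 / - q))).
    apply: ler_pM => //; rewrite ?invr_ge0//.
      apply: le_trans (dot_le _ _) _; apply: ler_wpM2r => //; rewrite ler_pM2l//.
      by apply: le_trans (B1 _ t1); rewrite pnorm_le /= normrN norm_snd norm_fst.
    have -> : 2 / - q = (- q / 2)^-1 by rewrite invf_div.
    by rewrite lef_pV2 // ?posrE; clear -D1 q0; lra.
  by rewrite mulrAC; apply: ler_wpM2r => //; rewrite lerDr ltW.
have lp : l0 / 2 <= l + p.
  have : N * `|h| < l0 / 2.
    have -> : l0 / 2 = N * (l0 / (2 * N)) by field; rewrite gt_eqF.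
    by rewrite ltr_pM2l.
  by move: pN l0l; rewrite ler_norml; clear -l00; lra.
have lp0 : 0 < l + p by clear -lp l00; lra.
(* As (l + p) tau = qq, the first order Taylor term at [t] absorbs qq k'(t), and qq^2 / (2 (l + p))
   times a bounded vector remains. *)
pose tau := qq / (l + p).
have taud : `|tau| < dm / 2.
  rewrite /tau normrM normfV (gtr0_norm lp0) ltr_pdivrMr//.
  apply: le_lt_trans qN _.
  apply: (@lt_le_trans _ _ (dm / 2 * (l0 / 2))).
    have -> : dm / 2 * (l0 / 2) = N * (dm * l0 / (4 * N)) by field; rewrite gt_eqF.
    by rewrite ltr_pM2l.
  by apply: ler_wpM2l => //; clear -dm0; lra.
have t'd : `|t + tau - t0| < dm.
  by rewrite addrAC (le_lt_trans (ler_normD _ _))//; clear -td taud; lra.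
have BW u : `|u - t0| < dm -> `|vel (vel k) u| <= W.
  by rewrite !lt_min => /and4P[_ _ u3 _]; exact: B3.
have [w wW kE] := taylor2_vec (gb_C2 ar gb (t0 := t0) (d := dm)) BW tdm t'd.
have -> : l *: k t + h =
    (l + p) *: k (t + tau) + (- (2^-1 * (qq ^+ 2 / (l + p)))) *: w.
  have -> : l *: k t + h = (l + p) *: k t + qq *: vel k t.
    by rewrite {1}hE addrA -scalerDl.
  rewrite kE.
  have -> : t + tau - t = tau by ring.
  apply: pairE; rewrite /= /GRing.scale /= /tau; field; rewrite gt_eqF//.
apply: le_trans (gaugeD ar gb _ _) _.
rewrite (gauge_k ar gb) ?(ltW lp0)// -addrA -/p addrA lerD2l.
apply: le_trans (HM _) _; rewrite normrZ normrN.
rewrite ger0_norm; last nonneg.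
have q2 : qq ^+ 2 <= N ^+ 2 * `|h| ^+ 2.
  by rewrite -exprMn -real_normK ?num_real// lerXn2r ?nnegrE// mulr_ge0// ltW.
have ilp : (l + p)^-1 <= 2 / l0.
  have -> : 2 / l0 = (l0 / 2)^-1 by rewrite invf_div.
  by rewrite lef_pV2 // ?posrE; clear -lp lp0 l00; lra.
apply: (@le_trans _ _ (M * (2^-1 * (N ^+ 2 * `|h| ^+ 2 * (2 / l0)) * W))).
  apply: ler_wpM2l; first exact: ltW.
  apply: ler_pM => //; first nonneg.
  apply: ler_wpM2l; first by rewrite invr_ge0.
  by apply: ler_pM => //; nonneg.
have -> : M * (2^-1 * (N ^+ 2 * `|h| ^+ 2 * (2 / l0)) * W) =
    M * N ^+ 2 * W / l0 * `|h| ^+ 2 by field; rewrite gt_eqF.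
by rewrite mulrDl mul1r lerDl sqr_ge0.
Qed.

(** [gauge_ex] gives a parameter without locating it, and [k] is periodic. The intermediate value
    theorem instead finds a zero near t0 of the determinant of [k s] and [v], which changes sign
    between t0 - a and t0 + a. *)
Lemma param_near t0 l d : 0 < l -> 0 < d ->
  exists2 e : R, 0 < e & forall v, `|v - l *: k t0| < e ->
    exists2 t, `|t - t0| < d & v = gam v *: k t.
Proof.
move=> l0 d0.
have q0 := gb_nu_pos ar gb t0; set q := dot _ _ in q0.
have e0 : 0 < - q / 2 by rewrite divr_gt0 ?oppr_gt0.
have [d1 d10 B1] := dot_near (continuous_perp (gb_vel_continuous ar gb (t := t0)))
  (@cst_continuous (k t0) t0) e0.
have [d2 d20 B2] := continuous_bounded (gb_k_continuous ar gb (t := t0)).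
have [d3 d30 B3] := dot_near (conormal_continuous ar gb (t := t0))
  (@cst_continuous (k t0) t0) (divr_gt0 ltr01 (ltr0n R 2)).
have [d4 d40 B4] := continuous_bounded (conormal_continuous ar gb (t := t0)).
pose dm := Num.min d (Num.min d1 (Num.min d2 (Num.min d3 d4))).
have dm0 : 0 < dm by rewrite !lt_min d0 d10 d20 d30 d40.
pose a := dm / 2.
have a0 : 0 < a by rewrite divr_gt0.
have adm : a < dm by rewrite /a; clear -dm0; lra.
pose Mk := `|k t0| + 1; pose Mn := `|n t0| + 1.
have Mk0 : 0 < Mk by rewrite ltr_wpDl.
have Mn0 : 0 < Mn by rewrite ltr_wpDl.
pose e := Num.min (l * a * (- q / 2) / (2 * Mk)) (l / (4 * Mn)).
have ee0 : 0 < e by rewrite lt_min !divr_gt0 ?mulr_gt0 ?divr_gt0 ?oppr_gt0.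
exists e => // v; rewrite lt_min => /andP[v1 v2].
pose f s := dot (perp (k s)) v.
have fE s : `|s - t0| < dm -> `|f s - l * dot (perp (k s)) (k t0)| < l * a * (- q / 2).
  move=> sd; rewrite /f -dotZr -dotBr.
  apply: le_lt_trans (dot_le _ _) _.
  apply: (@le_lt_trans _ _ (2 * Mk * `|v - l *: k t0|)).
    apply: ler_wpM2r => //; rewrite ler_pM2l//.
    have s2 : `|s - t0| < d2 by move: sd; rewrite !lt_min => /and5P[].
    by apply: le_trans (B2 _ s2); rewrite pnorm_le /= normrN norm_snd norm_fst.
  by rewrite mulrC -ltr_pdivlMr// mulr_gt0.
have in0 : `|t0 - t0| < dm by rewrite subrr normr0.
have hvp u : `|u - t0| < dm -> has_vel k (vel k) u by move=> _; exact: gb_vel ar gb u.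
(* The derivative in s of the determinant of [k s] and [k t0] is dot (nu k s) (k t0), which stays
   below q / 2 < 0 near t0. *)
have gE s : `|s - t0| < dm -> exists2 c, c < q / 2 &
    dot (perp (k s)) (k t0) = c * (s - t0).
  move=> sd; have [x xd ex] := MVT_dot (- perp (k t0)) hvp in0 sd.
  exists (dot (perp (vel k x)) (k t0)).
    have x1 : `|x - t0| < d1 by move: xd; rewrite !lt_min => /and5P[].
    have := B1 x t0 x1; rewrite subrr normr0 => /(_ d10); rewrite -/q ltr_norml.
    by clear -q0; lra.
  have e1 u : dot (perp u) (k t0) = dot (- perp (k t0)) u.
    by rewrite /dot /=; ring.
  by rewrite e1 ex e1 /dot /=; ring.
have ea : t0 + a - t0 = a by ring.
have eb : t0 - a - t0 = - a by ring.
have fneg : f (t0 + a) < 0.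
  have sd : `|t0 + a - t0| < dm by rewrite ea gtr0_norm.
  have [c cq ec] := gE _ sd; have := fE _ sd; rewrite ec ea ltr_norml.
  have : l * a * c < l * a * (q / 2) by rewrite ltr_pM2l// mulr_gt0.
  by clear; lra.
have fpos : 0 < f (t0 - a).
  have sd : `|t0 - a - t0| < dm by rewrite eb normrN gtr0_norm.
  have [c cq ec] := gE _ sd; have := fE _ sd; rewrite ec eb ltr_norml.
  have : l * a * c < l * a * (q / 2) by rewrite ltr_pM2l// mulr_gt0.
  by clear; lra.
have fv (u : R) : is_derive u 1 f (dot (perp v) (- vel k u)).
  have := has_vel_dot (- perp v) (gb_vel ar gb u).
  rewrite dotNl -dotNr; have -> // : (fun s => dot (- perp v) (k s)) = f.
  by apply/funext => s; rewrite /f /dot /=; ring.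
have [|||t] := @IVT R f (t0 - a) (t0 + a) 0.
- lra.
- by apply: derivable_within_continuous => u _; exact: (@ex_derive _ _ _ _ _ _ _ (fv u)).
- by rewrite ge_min le_max (ltW fneg) (ltW fpos) orbT.
rewrite in_itv /= => /andP[ta tb] ft.
have tdm : `|t - t0| < dm by rewrite ltr_norml; clear -ta tb adm; lra.
exists t; first by move: tdm; rewrite lt_min => /andP[].
have kt0 : k t != 0.
  by apply/eqP => k0; have := conormal_k ar gb t; rewrite k0 dotv0 => /esym/eqP; rewrite oner_eq0.
have vE := perp_decomp v kt0; rewrite -/(f t) ft mul0r scale0r addr0 in vE.
set c := _ / _ in vE.
(* A zero of the determinant gives only parallelism; pairing with [n t] excludes the opposite
   ray. *)
have c0 : 0 < c.
  have -> : c = dot (n t) v by rewrite vE dotZr (conormal_k ar gb) mulr1.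
  have -> : v = l *: k t0 + (v - l *: k t0) by rewrite addrC subrK.
  rewrite dotDr dotZr.
  have t3 : `|t - t0| < d3 by move: tdm; rewrite !lt_min => /and5P[].
  have t4 : `|t - t0| < d4 by move: tdm; rewrite !lt_min => /and5P[].
  have := B3 t t0 t3; rewrite subrr normr0 => /(_ d30); rewrite (conormal_k ar gb) => b3.
  have hl : l / 2 < l * dot (n t) (k t0).
    by rewrite ltr_pM2l//; move: b3; rewrite ltr_norml; clear -l0; lra.
  have := dot_le (n t) (v - l *: k t0).
  have : 2 * `|n t| * `|v - l *: k t0| <= 2 * Mn * (l / (4 * Mn)).
    by apply: ler_pM => //; [rewrite ler_pM2l// B4|apply: ltW].
  have -> : 2 * Mn * (l / (4 * Mn)) = l / 2 by field; rewrite gt_eqF.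
  by rewrite ler_norml; move: hl; clear -l0; lra.
by rewrite {2}vE (gauge_k ar gb) // ltW.
Qed.

(** By [conormal_le1] the function s -> dot (n t) (k s) is maximal at s = t, and its second
    derivative there cannot be positive. *)
Lemma conormal_acc_le0 t : dot (n t) (vel (vel k) t) <= 0.
Proof.
rewrite leNgt; apply/negP => c0.
have [d d0 B] := dot_near (@cst_continuous (n t) t) (gb_acc_continuous ar gb (t := t)) c0.
have i0 : `|t - t| < d by rewrite subrr normr0.
have i1 : `|t + d / 2 - t| < d by rewrite addrAC subrr add0r gtr0_norm; lra.
have [x xd e] := taylor2_dot (n t) (gb_C2 ar gb (t0 := t) (d := d)) i0 i1.
have P1 : 0 < dot (n t) (vel (vel k) x).
  have := B t x i0 xd; rewrite ltr_norml => /andP[h _].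
  by move: h; rewrite ltrBrDr addNr.
have P2 : 0 < (t + d / 2 - t) ^+ 2.
  by rewrite addrAC subrr add0r; apply: exprn_gt0; apply: divr_gt0.
have i2 : 0 < 2^-1 :> R by rewrite invr_gt0.
have P3 := mulr_gt0 (mulr_gt0 i2 P1) P2.
have := conormal_le1 ar gb t (gb_mem gb (t + d / 2)).
by rewrite e (conormal_k ar gb) conormal_vel mul0r addr0 gerDl leNgt P3.
Qed.

End GaugeSmoothness.

(** * The support function *)

Section SupportFunction.
Context {R : realType} (r : regularity R) (K : set (R * R)) (k : R -> R * R).
Hypotheses (ar : admissible r) (gb : gauge_body r K k).
Implicit Types (t s l : R) (v w h z : R * R).

Local Notation n := (conormal k).
Local Notation n' := (conormal' k).
Local Notation gp := (gauge (polar K)).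

Lemma dirder_eps (f : R * R -> R) (a v : R * R) (L : R) :
  (forall e : R, 0 < e -> exists2 d : R, 0 < d & forall h : R, `|h| < d ->
     `|f (a + h *: v) - f a - h * L| <= e * `|h|) ->
  'D_v f a = L.
Proof.
move=> H; apply: cvg_lim => //.
apply/cvgrPdist_le => e e0; have [d d0 Hd] := H e e0.
apply/nbhs_ballP; exists d => //= h; rewrite -ball_normE /= sub0r normrN => hd h0.
have -> : L - h^-1 *: (f (h *: v + a) - f a) =
    - (h^-1 * (f (a + h *: v) - f a - h * L)).
  by rewrite [h *: v + a]addrC /GRing.scale /=; field.
rewrite normrN normrM normfV ler_pdivrMl ?normr_gt0// [leRHS]mulrC.
exact: Hd.
Qed.

Lemma near_neg (x y : R) : `|x - y| < - y -> 0 < - x.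
Proof. by rewrite ltr_norml => /andP[_]; rewrite ltrBlDr addNr oppr_gt0. Qed.

Let cst_continuous (v : R * R) t : {for t, continuous (fun _ : R => v)}.
Proof. exact: cvg_cst. Qed.

Let G w := [set l : R | 0 < l /\ exists2 z, polar K z & w = l *: z].

Lemma gp_le w c : 0 < c -> (forall z, K z -> dot w z <= c) -> gp w <= c.
Proof.
move=> c0 H; apply: ge_inf; first by exists 0 => l [/ltW].
split => //; exists (c^-1 *: w); last by rewrite scalerA divff ?gt_eqF// scale1r.
by move=> y Ky; rewrite dotZl mulrC ler_pdivrMr// mul1r; exact: H.
Qed.

Lemma gp_ub : exists2 M, 0 < M & forall w z, K z -> dot w z <= M * `|w|.
Proof.
have [M M0 HM] := gb_bounded gb; exists (2 * M); first exact: mulr_gt0.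
move=> w z Kz; apply: le_trans (ler_norm _) _; apply: le_trans (dot_le _ _) _.
have -> : 2 * M * `|w| = 2 * `|w| * M by ring.
by apply: ler_wpM2l; [rewrite mulr_ge0|exact: HM].
Qed.

Lemma gp_ge w z : K z -> dot w z <= gp w.
Proof.
move=> Kz; apply: lb_le_inf; last first.
  by move=> l [l0 [y py ->]]; rewrite dotZl; apply: ler_piMr; [exact: ltW|exact: py].
have [M M0 HM] := gp_ub.
have c0 : 0 < M * `|w| + 1 by rewrite ltr_wpDl// mulr_ge0// ltW.
exists (M * `|w| + 1); split => //; exists ((M * `|w| + 1)^-1 *: w).
  move=> y Ky; rewrite dotZl mulrC ler_pdivrMr// mul1r.
  by apply: le_trans (HM _ _ Ky) _; rewrite lerDl.
by rewrite scalerA divff ?gt_eqF// scale1r.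
Qed.

Lemma gp_ge0 w : 0 <= gp w.
Proof. by have := gp_ge w (gb_mem0 gb); rewrite dotv0. Qed.

Lemma gp_conormal t c : 0 < c -> gp (c *: n t) = c.
Proof.
move=> c0; apply/eqP; rewrite eq_le; apply/andP; split.
  apply: gp_le => // z Kz; rewrite dotZl; apply: ler_piMr; first exact: ltW.
  exact: (conormal_le1 ar gb).
apply: le_trans (gp_ge _ (gb_mem gb t)).
by rewrite dotZl (conormal_k ar gb) mulr1.
Qed.

Lemma gp_add M w h : (forall w z, K z -> dot w z <= M * `|w|) -> 0 < M ->
  gp (w + h) <= gp w + M * `|h|.
Proof.
move=> HM M0; apply/ler_addgt0Pl => e e0; apply: gp_le.
  by rewrite ltr_pwDl// addr_ge0 ?gp_ge0// mulr_ge0// ltW.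
move=> z Kz; rewrite dotDl; have := gp_ge w Kz; have := HM h z Kz.
by clear -e0; lra.
Qed.

Lemma k_neq0 t : k t != 0.
Proof.
by apply/eqP => e; have := conormal_k ar gb t; rewrite e dotv0 => /esym/eqP; rewrite oner_eq0.
Qed.

(** The vectors [n t0], [n' t0] are dual to [k t0], [vel k t0] up to the factor [A] in the last
    pairing; positive curvature makes them a basis. *)
Lemma conormal_frame t0 v (A := - dot (n t0) (vel (vel k) t0)) : 0 < A ->
  v = dot (k t0) v *: n t0 + (dot (vel k t0) v / A) *: n' t0.
Proof.
move=> A0.
have n'k1 : dot (n' t0) (vel k t0) = A by exact: conormal'_vel.
have n'0 : n' t0 != 0.
  by apply/eqP => e; move: A0; rewrite -n'k1 e dot0v ltxx.
set p := dot (k t0) v.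
have h1 : dot (k t0) (v - p *: n t0) = 0.
  by rewrite dotBr [dot _ (p *: _)]dotZr [dot _ (n t0)]dotC (conormal_k ar gb) mulr1 subrr.
have h2 : dot (k t0) (n' t0) = 0 by rewrite dotC (conormal'_k ar gb).
have e := orth_parallel (k_neq0 t0) h2 h1 n'0; set q := _ / _ in e.
have eq : v = p *: n t0 + q *: n' t0 by rewrite -e addrC subrK.
have -> : dot (vel k t0) v = q * A.
  rewrite eq dotDr [dot _ (p *: _)]dotZr [dot _ (n t0)]dotC conormal_vel mulr0 add0r.
  by rewrite [dot _ (q *: _)]dotZr [dot _ (n' t0)]dotC n'k1.
by rewrite mulfK ?gt_eqF// -eq.
Qed.

(** Pairing with [k t0] bounds the support function from below by c + h p. For the upper bound, c
    n(t0) + h v equals (c + h p) n(t0 + tau) up to o(h), and at a positive multiple of a conormal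
    the support function is the multiplier. *)
Lemma gp_dirder t0 c v : 0 < - dot (n t0) (vel (vel k) t0) -> 0 < c -> 'D_v gp (c *: n t0) = dot v (k t0).
Proof.
set A := - dot _ _ => A0 c0; apply: dirder_eps => e e0.
have [M M0 HM] := gp_ub.
pose p := dot (k t0) v; pose q := dot (vel k t0) v / A.
pose e1 := e / (M * (`|q| + 1)).
have q1 : 0 < `|q| + 1 by rewrite ltr_wpDl.
have e10 : 0 < e1 by rewrite divr_gt0 ?mulr_gt0.
have [d1 d10 B1] := continuous_dist (conormal'_continuous ar gb (t := t0)) e10.
pose d := Num.min (c / (2 * (`|p| + 1))) (d1 * c / (2 * (`|q| + 1))).
have p1 : 0 < `|p| + 1 by rewrite ltr_wpDl.
exists d; first by rewrite lt_min !divr_gt0 ?mulr_gt0.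
move=> h; rewrite lt_min => /andP[h1 h2].
rewrite gp_conormal//.
have lo : c + h * dot v (k t0) <= gp (c *: n t0 + h *: v).
  have := gp_ge (c *: n t0 + h *: v) (gb_mem gb t0).
  by rewrite dotDl [dot (c *: _) _]dotZl (conormal_k ar gb) mulr1 dotZl.
have hp : `|h * p| < c / 2.
  rewrite normrM; apply: (@le_lt_trans _ _ (`|h| * (`|p| + 1))).
    by apply: ler_wpM2l => //; rewrite lerDl.
  rewrite -ltr_pdivlMr//; apply: lt_le_trans h1 _.
  by rewrite le_eqVlt; apply/orP; left; apply/eqP; field; rewrite gt_eqF.
have cp : c / 2 < c + h * p by move: hp; rewrite ltr_norml; clear -c0; lra.
have cp0 : 0 < c + h * p by clear -cp c0; lra.
(* (c + h p) tau = h q matches the component along [n' t0]. *)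
pose tau := h * q / (c + h * p).
have taud : `|tau| < d1.
  rewrite /tau normrM normfV (gtr0_norm cp0) ltr_pdivrMr//.
  apply: (@lt_trans _ _ (d1 * (c / 2))); last by rewrite ltr_pM2l.
  rewrite normrM; apply: (@le_lt_trans _ _ (`|h| * (`|q| + 1))).
    by apply: ler_wpM2l => //; rewrite lerDl.
  rewrite -ltr_pdivlMr//; apply: lt_le_trans h2 _.
  by rewrite le_eqVlt; apply/orP; left; apply/eqP; field; rewrite gt_eqF.
have i0 : `|t0 - t0| < d1 by rewrite subrr normr0.
have i1 : `|t0 + tau - t0| < d1 by rewrite addrAC subrr add0r.
have nE : `|n (t0 + tau) - n t0 - tau *: n' t0| <= e1 * `|tau|.
  have := @MVT_vec _ n n' t0 d1 t0 (t0 + tau) e1 (n' t0)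
    (fun u _ => conormal_has_vel ar gb u) (fun u hu => ltW (B1 u hu)) i0 i1.
  by rewrite [t0 + tau - t0]addrAC subrr add0r.
set E := n (t0 + tau) - n t0 - tau *: n' t0 in nE.
have eq : c *: n t0 + h *: v = (c + h * p) *: n (t0 + tau) + (- (c + h * p)) *: E.
  rewrite {1}(conormal_frame v A0) -/p -/q /E.
  move: (n t0) (n (t0 + tau)) (n' t0) => a b b'.
  by apply: pairE; rewrite /= /GRing.scale /= /tau; field; rewrite gt_eqF.
have up : gp (c *: n t0 + h *: v) <= c + h * p + e * `|h|.
  rewrite eq; apply: le_trans (gp_add _ _ HM M0) _.
  rewrite gp_conormal// lerD2l normrZ normrN gtr0_norm//.
  apply: (@le_trans _ _ (M * ((c + h * p) * (e1 * `|tau|)))).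
    by rewrite !ler_pM2l.
  have -> : `|tau| = `|h| * `|q| / (c + h * p).
    by rewrite /tau normrM normfV (gtr0_norm cp0) [`|h * q|]normrM.
  have -> : M * ((c + h * p) * (e1 * (`|h| * `|q| / (c + h * p)))) = e * `|h| * (`|q| / (`|q| + 1)).
    by rewrite /e1; field; rewrite !gt_eqF.
  rewrite ler_piMr//; first by rewrite mulr_ge0// ltW.
  by rewrite ler_pdivrMr// mul1r lerDl.
rewrite dotC -/p in lo *; rewrite ler_norml.
have : 0 <= e * `|h| by rewrite mulr_ge0// ltW.
by clear -lo up; lra.
Qed.

Lemma grad_gp t0 c : 0 < - dot (n t0) (vel (vel k) t0) -> 0 < c -> grad gp (c *: n t0) = k t0.
Proof.
by move=> A0 c0; apply: pairE; rewrite /grad /= gp_dirder// /dot /=; ring.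
Qed.

Lemma orth_conormal w t : dot w (vel k t) = 0 -> w = dot w (k t) *: n t.
Proof.
move=> h; have v0 : vel k t != 0 by apply/eqP; exact: gb_regular gb t.
have := orth_parallel (u := vel k t) (v := n t) (w := w) v0.
rewrite dotC conormal_vel dotC h => /(_ erefl erefl (conormal_neq0 ar gb t)) e.
rewrite {2}e [dot (_ *: n t) _]dotZl (conormal_k ar gb) mulr1; exact: e.
Qed.

(* The gradient at c n(t0) + h v is the contact point k(t) of that normal, and the
   intermediate value theorem gives t = t0 + h <v, k'(t0)> / (c A) + o(h). *)
Lemma hess_gp t0 c v : 0 < - dot (n t0) (vel (vel k) t0) -> 0 < c ->
  hess gp (c *: n t0) v =
  (dot v (vel k t0) / (c * - dot (n t0) (vel (vel k) t0))) *: vel k t0.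
Proof.
set A := - dot _ _ => A0 c0.
pose m := dot v (vel k t0); pose B := c * A.
have B0 : 0 < B by exact: mulr_gt0.
pose w0 := c *: n t0.
have w0k2 : dot w0 (vel (vel k) t0) = - B.
  by rewrite /w0 [dot (c *: _) _]dotZl /B /A mulrN opprK.
have w0k1 : dot w0 (vel k t0) = 0.
  by rewrite /w0 [dot (c *: _) _]dotZl conormal_vel mulr0.
have key (e : R) : 0 < e -> exists2 d : R, 0 < d & forall h : R, `|h| < d ->
    exists2 t : R, `|t - t0 - h * (m / B)| <= e * `|h| & grad gp (w0 + h *: v) = k t.
  move=> e0.
  pose L := `|m / B| + e.
  have L0 : 0 < L by rewrite ltr_wpDl.
  (* With this [eta] the linearization error is e B |h| / 2, half the size of the linear part at the
     points [s1] and [s2] below. *)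
  pose eta := e * B / (2 * (L + 1)).
  have L1 : 0 < L + 1 by rewrite addr_gt0.
  have eta0 : 0 < eta by rewrite divr_gt0 ?mulr_gt0.
  have kc2 := gb_acc_continuous ar gb (t := t0); have kc1 := gb_vel_continuous ar gb (t := t0).
  have kc := gb_k_continuous ar gb (t := t0); have nc := conormal_continuous ar gb (t := t0).
  have [d1 d10 B1] := dot_near (@cst_continuous w0 t0) kc2 eta0.
  have [d2 d20 B2] := dot_near (@cst_continuous v t0) kc1 eta0.
  have [d3 d30 B3] := dot_near (@cst_continuous w0 t0) kc (divr_gt0 c0 (ltr0n R 4)).
  have [d4 d40 B4] := continuous_bounded kc.
  have [d5 d50 B5] := dot_near nc kc2 A0.
  pose dm := Num.min d1 (Num.min d2 (Num.min d3 (Num.min d4 d5))).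
  have dm0 : 0 < dm by rewrite !lt_min d10 d20 d30 d40 d50.
  have inm u : `|u - t0| < dm -> [/\ `|u - t0| < d1, `|u - t0| < d2, `|u - t0| < d3,
      `|u - t0| < d4 & `|u - t0| < d5].
    by rewrite !lt_min => /and5P[].
  pose D := c / (4 * (2 * `|v| * (`|k t0| + 1) + 1)).
  have D1 : 0 < 2 * `|v| * (`|k t0| + 1) + 1 by rewrite ltr_wpDl// !mulr_ge0// addr_ge0.
  have D0 : 0 < D by rewrite divr_gt0 ?mulr_gt0.
  exists (Num.min (dm / L) D); first by rewrite lt_min divr_gt0.
  move=> h; rewrite lt_min => /andP[h1 h2].
  have hL : L * `|h| < dm by rewrite mulrC -ltr_pdivlMr.
  have h_0 := normr_ge0 h.
  have mh : `|h * (m / B)| + e * `|h| = L * `|h| by rewrite normrM /L; ring.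
  pose f (t : R) := dot (w0 + h *: v) (vel k t).
  have fE s : `|s| <= L * `|h| -> `|f (t0 + s) - (- B * s + h * m)| <= eta * (L + 1) * `|h|.
    move=> sL.
    have i0 : `|t0 - t0| < dm by rewrite subrr normr0.
    have sE : t0 + s - t0 = s by ring.
    have i1 : `|t0 + s - t0| < dm by rewrite sE; apply: le_lt_trans hL.
    have Hv u : `|u - t0| < dm -> has_vel (vel k) (vel (vel k)) u by move=> _; exact: gb_acc ar gb u.
    have [x xd ex] := MVT_dot w0 Hv i0 i1.
    have [x1 _ _ _ _] := inm _ xd; have [_ s2 _ _ _] := inm _ i1.
    have z1 : `|t0 - t0| < d1 by rewrite subrr normr0.
    have z2 : `|t0 - t0| < d2 by rewrite subrr normr0.
    have b1 : `|dot w0 (vel (vel k) x) - - B| <= eta.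
      by rewrite -w0k2; exact: ltW (B1 t0 x z1 x1).
    have b2 : `|dot v (vel k (t0 + s)) - m| <= eta := ltW (B2 t0 _ z2 s2).
    have -> : f (t0 + s) - (- B * s + h * m) =
      s * (dot w0 (vel (vel k) x) - - B) + h * (dot v (vel k (t0 + s)) - m).
      by rewrite /f dotDl [dot (h *: _) _]dotZl ex w0k1 sE; ring.
    apply: le_trans (ler_normD _ _) _; rewrite !normrM.
    have -> : eta * (L + 1) * `|h| = (L * `|h|) * eta + `|h| * eta by ring.
    by apply: lerD; apply: ler_pM.
  have etaL : eta * (L + 1) * `|h| = e * B * `|h| / 2.
    by rewrite /eta; field; rewrite gt_eqF.
  (* The linear part - B s + h m vanishes at h m / B; at distance e |h| to either side [f] has
     opposite signs. *)
  pose s1 := h * (m / B) - e * `|h|; pose s2 := h * (m / B) + e * `|h|.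
  have eh : 0 <= e * `|h| by rewrite mulr_ge0// ltW.
  have s1L : `|s1| <= L * `|h|.
    by rewrite -mh; apply: le_trans (ler_normB _ _) _; rewrite [X in _ + X]ger0_norm.
  have s2L : `|s2| <= L * `|h|.
    by rewrite -mh; apply: le_trans (ler_normD _ _) _; rewrite [X in _ + X]ger0_norm.
  have f1 : 0 <= f (t0 + s1).
    have := fE _ s1L; rewrite etaL.
    have -> : - B * s1 + h * m = e * B * `|h| by rewrite /s1; field; rewrite gt_eqF.
    have : 0 <= e * B * `|h| by nonneg.
    by rewrite ler_norml; clear -e0; lra.
  have f2 : f (t0 + s2) <= 0.
    have := fE _ s2L; rewrite etaL.
    have -> : - B * s2 + h * m = - (e * B * `|h|) by rewrite /s2; field; rewrite gt_eqF.
    have : 0 <= e * B * `|h| by nonneg.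
    by rewrite ler_norml; clear -e0; lra.
  have fv (u : R) : is_derive u 1 f (dot (w0 + h *: v) (vel (vel k) u)).
    exact: has_vel_dot (gb_acc ar gb u).
  have [|||t] := @IVT R f (t0 + s1) (t0 + s2) 0.
  - by rewrite lerD2l /s1 /s2; clear -eh; lra.
  - by apply: derivable_within_continuous => u _; exact: (@ex_derive _ _ _ _ _ _ _ (fv u)).
  - by rewrite ge_min le_max f1 f2 orbT.
  rewrite in_itv /= => /andP[ta tb] ft.
  have tE : `|t - t0 - h * (m / B)| <= e * `|h|.
    by rewrite ler_norml; move: ta tb; rewrite /s1 /s2; clear -e0; lra.
  exists t => //.
  have tdm : `|t - t0| < dm.
    rewrite -[t - t0](subrK (h * (m / B))).
    apply: le_lt_trans (ler_normD _ _) _; apply: le_lt_trans hL; rewrite -mh.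
    by rewrite addrC lerD2l.
  have [_ _ t3 t4 t5] := inm _ tdm.
  have At := near_neg (B5 t t t5 t5).
  (* At a zero of [f] the vector w0 + h v is orthogonal to k'(t), hence a multiple of [n t];
     [grad_gp] needs the multiple to be positive. *)
  suff cpos : 0 < dot (w0 + h *: v) (k t).
    by rewrite (orth_conormal ft); exact: grad_gp At cpos.
  rewrite dotDl; have := B3 t0 t; rewrite subrr normr0 => /(_ d30 t3).
    rewrite {2}/w0 [dot (c *: _) (k t0)]dotZl (conormal_k ar gb) mulr1 => b3.
    have : `|dot (h *: v) (k t)| <= c / 4.
      rewrite dotZl normrM; apply: (@le_trans _ _ (D * (2 * `|v| * (`|k t0| + 1)))).
        apply: ler_pM => //; first exact: ltW.
        by apply: le_trans (dot_le _ _) _; apply: ler_wpM2l; rewrite ?mulr_ge0// B4.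
      have -> : c / 4 = D * (2 * `|v| * (`|k t0| + 1) + 1) by rewrite /D; field; rewrite gt_eqF.
      by rewrite ler_pM2l// lerDl.
    by rewrite ler_norml; move: b3; rewrite ltr_norml; clear -c0; lra.
have comp (e : R) : 0 < e -> exists2 d : R, 0 < d & forall h : R, `|h| < d ->
    `|grad gp (w0 + h *: v) - grad gp w0 - h *: ((m / B) *: vel k t0)| <= e * `|h|.
  move=> e0.
  pose L := `|m / B| + 1; have L0 : 0 < L by rewrite ltr_wpDl.
  pose e1 := e / (2 * L); have e10 : 0 < e1 by rewrite divr_gt0 ?mulr_gt0.
  pose V := `|vel k t0| + 1; have V0 : 0 < V by rewrite ltr_wpDl.
  pose e2 := Num.min 1 (e / (2 * V)).
  have e20 : 0 < e2 by rewrite lt_min ltr01 divr_gt0 ?mulr_gt0.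
  have [d1 d10 B1] := continuous_dist (gb_vel_continuous ar gb (t := t0)) e10.
  have [d2 d20 Hk] := key _ e20.
  exists (Num.min d2 (d1 / L)); first by rewrite lt_min d20 divr_gt0.
  move=> h; rewrite lt_min => /andP[h1 h2].
  have [t tE ->] := Hk h h1.
  rewrite /w0 grad_gp//.
  have h_0 := normr_ge0 h.
  have tL : `|t - t0| <= L * `|h|.
    rewrite -[t - t0](subrK (h * (m / B))).
    apply: le_trans (ler_normD _ _) _; rewrite [`|h * _|]normrM.
    have -> : L * `|h| = `|h| + `|h| * `|m / B| by rewrite /L; ring.
    by rewrite lerD2r; apply: le_trans tE _; rewrite ler_piMl// ge_min lexx.
  have td1 : `|t - t0| < d1 by apply: le_lt_trans tL _; rewrite mulrC -ltr_pdivlMr.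
  have i0 : `|t0 - t0| < d1 by rewrite subrr normr0.
  have M := @MVT_vec _ k (vel k) t0 d1 t0 t e1 (vel k t0) _ _ i0 td1.
  have {}M := M (fun u _ => gb_vel ar gb u) (fun u hu => ltW (B1 u hu)).
  have -> : k t - k t0 - h *: ((m / B) *: vel k t0) =
     (k t - k t0 - (t - t0) *: vel k t0) + (t - t0 - h * (m / B)) *: vel k t0.
    move: (vel k t0) (k t) (k t0) => v1 a b.
    by apply: pairE; rewrite /= /GRing.scale /= /GRing.scale /=; ring.
  apply: le_trans (ler_normD _ _) _; rewrite normrZ.
  have -> : e * `|h| = e1 * (L * `|h|) + e / (2 * V) * `|h| * V.
    by rewrite /e1; field; rewrite !gt_eqF.
  apply: lerD.
    by apply: le_trans M _; rewrite ler_pM2l.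
  apply: ler_pM => //; last by rewrite lerDl.
  by apply: le_trans tE _; apply: ler_wpM2r => //; rewrite ge_min lexx orbT.
have eq : (dot v (vel k t0) / (c * A)) *: vel k t0 = (m / B) *: vel k t0 by [].
rewrite eq; apply: pairE; apply: dirder_eps => e e0; have [d d0 H] := comp e e0;
  exists d => // h hd; have := H h hd; rewrite pnorm_le /= => /andP[] // _.
Qed.

End SupportFunction.

(** * The distance function *)

Section Crossing.
Context {R : realType}.

(** The crossing is at the infimum of the parameters outside U. As U is open, that point is itself
    outside U and differs from x, and the points just before it lie in U. *)
Lemma segment_crossing (U : set (R * R)) (x z : R * R) : open U -> U x -> ~ U z ->
  exists s : R, 0 <= s <= 1 /\ boundary U (x + s *: (z - x)).
Proof.
move=> Uo Ux nUz.
pose p (s : R) := x + s *: (z - x).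
pose E := [set s : R | 0 <= s <= 1 /\ ~ U (p s)].
have E1 : E 1 by split; rewrite ?ler01 ?lexx// /p scale1r addrC subrK.
have Elb : has_lbound E by exists 0 => s [/andP[]].
have Einf : has_inf E by split => //; exists 1.
have p1 : 0 < `|z - x| + 1 by rewrite ltr_wpDl.
have near_p s e : 0 < e -> exists2 d, 0 < d & forall s', `|s' - s| < d -> `|p s' - p s| < e.
  move=> e0; exists (e / (`|z - x| + 1)); first by rewrite divr_gt0.
  move=> s' hs; rewrite /p opprD addrACA subrr add0r -scalerBl normrZ.
  apply: (@le_lt_trans _ _ (`|s' - s| * (`|z - x| + 1))); last by rewrite -ltr_pdivlMr.
  by apply: ler_wpM2l => //; rewrite lerDl.
have s01 : 0 <= inf E <= 1.
  apply/andP; split; last exact: ge_inf.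
  by apply: lb_le_inf => [|s [/andP[]]//]; exists 1.
have nUs : ~ U (p (inf E)).
  move=> Up; move: Uo; rewrite openE => /(_ _ Up) /near_distP[e e0 He].
  have [d d0 Hd] := near_p (inf E) e e0.
  have [s [s1 s2] s3] := inf_adherent d0 Einf.
  have is_ : inf E <= s by exact: (ge_inf Elb (conj s1 s2)).
  apply: s2; apply: He; apply: Hd; move: is_.
  by rewrite ltr_norml; clear -s3 d0; lra.
have below s : 0 <= s -> s < inf E -> U (p s).
  move=> s0 si; apply/not_notP => nU.
  have : inf E <= s.
    by apply: ge_inf => //; split => //; rewrite s0/=; case/andP: s01 => _; exact: le_trans (ltW si).
  by rewrite leNgt si.
have i0 : 0 < inf E.
  rewrite lt_def; case/andP: s01 => -> _; rewrite andbT; apply/eqP => e.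
  by apply: nUs; rewrite e /p scale0r addr0.
exists (inf E); split => //; split; last first.
  by move=> /interior_subset.
move=> B /near_distP[e e0 He].
have [d d0 Hd] := near_p (inf E) e e0.
pose s := Num.max 0 (inf E - d / 2).
have s0 : 0 <= s by rewrite le_max lexx.
have si : s < inf E by rewrite gt_max i0 /= gtrBl divr_gt0.
exists (p s); split; first exact: below.
apply: He; apply: Hd.
have : inf E - d / 2 <= s by rewrite le_max lexx orbT.
by rewrite ltr_norml; clear -si d0; lra.
Qed.

Lemma compact_pos_lb (T : topologicalType) (f : T -> R) (A : set T) :
  compact A -> {within A, continuous f} -> (forall t, A t -> 0 < f t) ->
  exists2 m : R, 0 < m & forall t, A t -> m <= f t.
Proof.
move=> cA cf f0; have [->|/set0P A0] := eqVneq A set0.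
  by exists 1 => // t.
have [|c cin Hc] := @compact_EVT_max T R (fun t => - f t) A A0 cA.
  by move=> t; apply: (@cvgN _ R); exact: cf.
exists (f c); first by apply: f0; exact: set_mem.
by move=> t At; rewrite -lerN2; apply: Hc; exact: mem_set.
Qed.

End Crossing.

Section DistanceFunction.
Context {R : realType} (r : regularity R) (K : set (R * R)) (k : R -> R * R).
Hypotheses (ar : admissible r) (gb : gauge_body r K k).
Variable U : set (R * R).
Hypotheses (Uo : open U) (Bc : compact (boundary U)) (Bn : boundary U !=set0).
Implicit Types (x y z w : R * R).

Local Notation gam := (gauge K).
Local Notation f := (dK U K).

Lemma dK_le x y : boundary U y -> f x <= gam (x - y).
Proof.
move=> By; apply: ge_inf; last by exists y.
by exists 0 => _ [z _ <-]; exact: gauge_ge0 gb _.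
Qed.

Lemma within_gauge_sub x (A : set (R * R)) : {within A, continuous (fun y => gam (x - y))}.
Proof.
apply: continuous_subspaceT => y.
apply: (@continuous_comp _ _ _ (fun y => x - y) gam); last exact: gauge_continuous ar gb _.
by apply: (@cvgB _ (R * R)%type); [exact: cvg_cst|exact: cvg_id].
Qed.

Lemma closest_ex x : exists y, closest U K x y.
Proof.
have [|c cin Hc] := @compact_EVT_max _ R (fun y => - gam (x - y)) _ Bn Bc.
  by move=> y; apply: (@cvgN _ R); exact: within_gauge_sub.
have Bcc : boundary U c by exact: set_mem.
exists c; split => //; apply/eqP; rewrite eq_le dK_le//=.
apply: lb_le_inf; first by case: Bn => b Bb; exists (gam (x - b)); exists b.
by move=> _ [y By <-]; rewrite -lerN2; apply: Hc; exact: mem_set.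
Qed.

Lemma dK_ge x l : (forall y, boundary U y -> l <= gam (x - y)) -> l <= f x.
Proof. by move=> H; have [y [By ->]] := closest_ex x; exact: H. Qed.

Lemma dK_triangle z w : f z <= gam (z - w) + f w.
Proof.
have [y [By ->]] := closest_ex w; apply: le_trans (dK_le _ By) _.
by rewrite -[z - y](subrKA w); exact: gaugeD ar gb _ _.
Qed.

Lemma dK_lip M : (forall v, gam v <= M * `|v|) ->
  forall z w, `|f z - f w| <= M * `|z - w|.
Proof.
move=> HM z w; have h1 := dK_triangle z w; have h2 := dK_triangle w z.
by have := HM (z - w); have := HM (w - z); rewrite (distrC w z) ler_norml; lra.
Qed.

(** Otherwise the segment from x to z would meet the boundary, by homogeneity at gauge distance less
    than [f x]. *)
Lemma dK_ball x z : U x -> gam (x - z) < f x -> U z.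
Proof.
move=> Ux h; apply/not_notP => nUz.
have [s [/andP[s0 s1] Bq]] := segment_crossing Uo Ux nUz.
have := dK_le x Bq; rewrite leNgt => /negP; apply; apply: le_lt_trans h.
have -> : x - (x + s *: (z - x)) = s *: (x - z).
  by rewrite opprD addrA subrr add0r -scalerN opprB.
by rewrite (gaugeZ ar gb)// ler_piMl// (gauge_ge0 gb).
Qed.

Lemma dK_gt0 x : U x -> 0 < f x.
Proof.
move=> Ux; have [y [By ->]] := closest_ex x.
have [] // := @gauge_attained _ r K k gb (x - y).
apply/eqP => /eqP; rewrite subr_eq0 => /eqP e; case: By => _; apply; rewrite -e.
by move: Uo; rewrite openE; exact.
Qed.

(** Uniqueness of the closest point is made quantitative by compactness of the boundary away from y.
    This reduces later comparisons to boundary points near y. *)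
Lemma closest_gap x y e : closest U K x y -> ~ ridge0 U K x -> U x -> 0 < e ->
  exists2 m : R, 0 < m & forall q, boundary U q -> e <= `|q - y| -> f x + m <= gam (x - q).
Proof.
move=> cxy nr Ux e0.
pose A := boundary U `&` [set q | e <= `|q - y|].
have cA : compact A.
  apply: (@subclosed_compact _ _ (boundary U)) => //; last by move=> q [].
  apply: closedI.
    apply: compact_closed Bc; exact: norm_hausdorff.
  have -> : [set q | e <= `|q - y|] = (fun q => `|q - y|) @^-1` [set t | e <= t] by [].
  apply: preimage_closed; last exact: closed_ge.
  move=> q _; have c1 : (fun q => q - y) p @[p --> q] --> q - y.
    by apply: (@cvgB _ (R * R)%type); [exact: cvg_id|exact: cvg_cst].
  exact: (cvg_norm c1).
have [||m m0 Hm] := @compact_pos_lb R (R * R)%type (fun q : R * R => gam (x - q) - f x) A cA.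
- move=> q; apply: (@cvgB _ R); last exact: cvg_cst.
  exact: within_gauge_sub.
- move=> q [Bq eq]; rewrite subr_gt0 lt_def dK_le// andbT.
  apply/eqP => E; apply: nr; split => //; exists y, q; split => //.
  by move=> yq; move: eq; rewrite -yq /= subrr normr0 leNgt e0.
exists m => // q Bq eq; have := Hm q (conj Bq eq); lra.
Qed.

Lemma differentiable_dir (g : R * R -> R) x v e : differentiable g x -> 0 < e ->
  exists2 d : R, 0 < d & forall s : R, `|s| < d ->
    `|g (x + s *: v) - g x - s * 'd g x v| <= e * `|s|.
Proof.
move=> dg e0; have dv : derivable g x v by exact: diff_derivable.
have /cvgrPdist_le /(_ e e0) /nbhs_ballP[d d0 Hd] : h^-1 *: (g (h *: v + x) - g x) @[h --> 0^'] --> 'D_v g x.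
  exact: dv.
exists d => // s sd; have [->|s0] := eqVneq s 0.
  by rewrite scale0r addr0 subrr mul0r subrr normr0 mulr0.
have := Hd s; rewrite /ball /= sub0r normrN => /(_ sd s0).
rewrite deriveE// -(ler_pM2r (_ : 0 < `|s|)) ?normr_gt0// -normrM.
have -> // : ('d g x v - s^-1 *: (g (s *: v + x) - g x)) * s =
  - (g (x + s *: v) - g x - s * 'd g x v).
  by rewrite [s *: v + x]addrC /GRing.scale /=; field.
by rewrite normrN.
Qed.

(** The triangle inequality bounds every slope by the gauge. On the segment towards y the distance
    falls at full rate, because y remains a competitor, so the bound is attained at x - y. *)
Lemma differentiable_closest x y : differentiable f x -> closest U K x y ->
  'd f x (x - y) = gam (x - y) /\ forall v, 'd f x v <= gam v.
Proof.
move=> df [By e].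
have le v : 'd f x v <= gam v.
  apply/ler_addgt0Pl => e' e'0; have [d d0 H] := differentiable_dir v df e'0.
  have s0 : 0 < d / 2 by rewrite divr_gt0.
  have sd : d / 2 < d by rewrite ltr_pdivrMr// ltr_pMr// ltr1n.
  have h1 : f (x + (d / 2) *: v) <= d / 2 * gam v + f x.
    have := dK_triangle (x + (d / 2) *: v) x.
    have -> : x + (d / 2) *: v - x = (d / 2) *: v by rewrite addrAC subrr add0r.
    by rewrite (gaugeZ ar gb _ (ltW s0)).
  have := H (d / 2); rewrite gtr0_norm// => /(_ sd).
  rewrite ler_norml => /andP[h2 h3]; rewrite -(ler_pM2l s0) mulrDr.
  by clear -h1 h2 h3 Uo Bc Bn gb ar; lra.
split => //; apply/eqP; rewrite eq_le le /=.
apply/ler_addgt0Pl => e' e'0; have [d d0 H] := differentiable_dir (x - y) df e'0.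
(* The step is at most 1 so as not to pass y. *)
pose s := Num.min 1 (d / 2).
have s0 : 0 < s by rewrite lt_min ltr01 divr_gt0.
have s1 : s <= 1 by rewrite ge_min lexx.
have sd : s < d by rewrite gt_min; apply/orP; right; rewrite ltr_pdivrMr// ltr_pMr// ltr1n.
have := H (- s); rewrite normrN gtr0_norm// => /(_ sd).
have : f (x + - s *: (x - y)) <= (1 - s) * gam (x - y).
  apply: le_trans (dK_le _ By) _.
  have -> : x + - s *: (x - y) - y = (1 - s) *: (x - y).
    by rewrite scalerBl scale1r scaleNr addrAC.
  by rewrite (gaugeZ ar gb)// subr_ge0.
rewrite -e => h1; rewrite ler_norml => /andP[h2 h3]; rewrite -(ler_pM2l s0).
by rewrite mulrDr; clear -h1 h2 h3 Uo Bc Bn gb ar; lra.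
Qed.

(** By linearity of the differential the midpoint of x - y and x - y' has gauge at least [f x]. The
    conormal attaining that gauge then takes the value [f x] on both vectors, and strict convexity
    identifies them. *)
Lemma differentiable_unique x y y' : differentiable f x ->
  closest U K x y -> closest U K x y' -> y = y'.
Proof.
move=> df c c'; have [p1 le] := differentiable_closest df c.
have [p2 _] := differentiable_closest df c'.
have [[By e] [By' e']] := (c, c').
pose w := 2^-1 *: ((x - y) + (x - y')).
have pw : 'd f x w = f x by rewrite linearZ linearD /= p1 p2 -e -e' /GRing.scale /=; field.
have [t wt _] := gauge_ex gb w.
have gw : f x <= gam w by rewrite -pw.
have n1 := conormal_le_gauge ar gb t (x - y).
have n2 := conormal_le_gauge ar gb t (x - y').
have nw : gam w = dot (conormal k t) w by rewrite {2}wt dotZr (conormal_k ar gb) mulr1.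
have nwE m : dot m w = 2^-1 * (dot m (x - y) + dot m (x - y')) by rewrite dotZr dotDr.
rewrite nwE in nw; rewrite -e in n1; rewrite -e' in n2.
have e1 : dot (conormal k t) (x - y) = gam (x - y).
  by rewrite -e; apply/eqP; rewrite eq_le n1 /=; move: nw gw n2; set a := dot _ _; set b := dot _ _; set c0 := gam _; lra.
have e2 : dot (conormal k t) (x - y') = gam (x - y').
  by rewrite -e'; apply/eqP; rewrite eq_le n2 /=; move: nw gw n1; set a := dot _ _; set b := dot _ _; set c0 := gam _; lra.
have := conormal_eq_gauge ar gb e1; rewrite -e => E1.
have := conormal_eq_gauge ar gb e2; rewrite -e' -E1 => /addrI /oppr_inj //.
Qed.

End DistanceFunction.

(** * Quadratic expansions and Lipschitz gradients *)

Lemma dot_is_linear (R : realType) (p : R * R) : linear (dot p).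
Proof. by move=> a u v; rewrite dotDr dotZr. Qed.

HB.instance Definition _ (R : realType) (p : R * R) :=
  GRing.isLinear.Build R (R * R)%type R _ (dot p) (@dot_is_linear R p).

Lemma expansion_differentiable (R : realType) (g : R * R -> R) (z p : R * R) (C d : R) :
  0 < d -> 0 <= C ->
  (forall h, `|h| < d -> `|g (z + h) - g z - dot p h| <= C * `|h| ^+ 2) ->
  differentiable g z /\ grad g z = p.
Proof.
move=> d0 C0 H.
have small e : 0 < e -> exists2 d' : R, 0 < d' & forall h, `|h| < d' ->
    `|g (z + h) - g z - dot p h| <= e * `|h|.
  move=> e0; have C1 : 0 < C + 1 by rewrite ltr_wpDl.
  exists (Num.min d (e / (C + 1))); first by rewrite lt_min d0 divr_gt0.
  move=> h; rewrite lt_min => /andP[h1 h2]; apply: le_trans (H h h1) _.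
  rewrite expr2 mulrA; apply: ler_wpM2r => //.
  move: h2; rewrite ltr_pdivlMr// => /ltW; apply: le_trans.
  by rewrite mulrC; apply: ler_wpM2l => //; rewrite lerDl.
have cd : continuous (dot p).
  move=> u; apply/cvgrPdist_lt => e e0.
  have c0 : 0 < e / (2 * `|p| + 1) by rewrite divr_gt0// ltr_wpDl// mulr_ge0.
  apply: filterS (near_dist u c0) => v vu.
  rewrite -dotBr; apply: le_lt_trans (dot_le _ _) _; rewrite distrC.
  apply: (@le_lt_trans _ _ ((2 * `|p| + 1) * `|v - u|)).
    by apply: ler_wpM2r => //; rewrite lerDl.
  by rewrite mulrC -ltr_pdivlMr// ltr_wpDl// mulr_ge0.
have E : (g : R * R -> (R : normedModType R)) \o shift z = cst (g z) + (dot p : R * R -> (R : normedModType R)) +o_ (0 : R * R) id.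
  apply/eqaddoP => _/posnumP[e].
  have [d' d'0 Hd] := small e%:num [gt0 of e%:num].
  apply: filterS (near_dist (0 : R * R) d'0) => h; rewrite subr0 => hd.
  have -> : (g \o shift z - (cst (g z) + dot p)) h = g (z + h) - g z - dot p h.
    by rewrite !fctE /= opprD addrA [h + z]addrC.
  exact: Hd.
have D : 'd g z = dot p :> (R * R -> R) by exact: diff_unique cd E.
split; first by apply/diff_locallyP; rewrite D.
apply: pairE; rewrite /grad /=; apply: dirder_eps => e e0.
all: have [d' d'0 Hd] := small e e0; exists d' => // h hd.
  have := Hd (h *: (1, 0)); rewrite normrZ.
  have -> : `|(1, 0) : R * R| = 1.
    have -> : `|(1, 0) : R * R| = Num.max `|1 : R| `|0 : R| by [].
    by rewrite normr1 normr0; apply: max_l.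
  by rewrite mulr1 dotZr /dot /= mulr1 mulr0 addr0; apply.
have := Hd (h *: (0, 1)); rewrite normrZ.
have -> : `|(0, 1) : R * R| = 1.
  have -> : `|(0, 1) : R * R| = Num.max `|0 : R| `|1 : R| by [].
  by rewrite normr1 normr0; apply: max_r.
by rewrite mulr1 dotZr /dot /= mulr1 mulr0 add0r; apply.
Qed.

(** To be read with u = g(z + h), v = g z, w = g z', a = p.h, b = p'.h, c = p'.(z - z'). The
    constant is 6 = 1 + 4 + 1, as the second expansion reaches to distance 2 D. *)
Lemma second_difference_bound {R : realType} (a b c u v w C D q1 q2 q3 : R) :
 `|u - v - a| <= q1 -> `|u - w - (b + c)| <= q2 -> `|v - w - c| <= q3 ->
 q1 <= C * D ^+ 2 -> q2 <= C * (2 * D) ^+ 2 -> q3 = C * D ^+ 2 -> `|a - b| <= 6 * C * D * D.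
Proof.
  rewrite !ler_norml => /andP[a1 a2] /andP[b1 b2] /andP[c1 c2] h1 h2 h3.
  have e1 : 6 * C * D * D = 6 * (C * D ^+ 2) by ring.
  have e2 : C * (2 * D) ^+ 2 = 4 * (C * D ^+ 2) by ring.
  rewrite e1; rewrite e2 in h2; move: (C * D ^+ 2) h1 h2 h3 => X h1 h2 h3.
  apply/andP; split; lra.
Qed.

(* Second order expansions with uniform constant give a Lipschitz gradient:
   compare the expansions at z and z' at the points z + h with |h| = |z - z'|. *)
Lemma C11_criterion (R : realType) (g : R * R -> R) (x : R * R) (C d : R) :
  0 < d -> 0 <= C ->
  (forall z, `|z - x| < d -> exists p, forall h, `|h| < d ->
     `|g (z + h) - g z - dot p h| <= C * `|h| ^+ 2) ->
  exists V, [/\ open V, V x & C11_on V g].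
Proof.
move=> d0 C0 H.
(* For z, z' in this ball D < d / 2, so h + (z - z'), of norm at most 2 D, stays in the range of the
   expansions. *)
exists (ball x (d / 4)); split; first exact: ball_open.
  by apply: ballxx; rewrite divr_gt0.
have inV z : ball x (d / 4) z -> `|z - x| < d / 4.
  by rewrite -ball_normE /= distrC.
have d4 : d / 4 < d by rewrite ltr_pdivrMr// ltr_pMr// ltr1n.
have P z : ball x (d / 4) z -> exists p, [/\ differentiable g z, grad g z = p &
    forall h, `|h| < d -> `|g (z + h) - g z - dot p h| <= C * `|h| ^+ 2].
  move=> /inV zd; have [p Hp] := H z (lt_trans zd d4); exists p.
  by have [] := expansion_differentiable d0 C0 Hp.
split=> [z /P[p []//]|].
have Vx : ball x (d / 4) x by apply: ballxx; rewrite divr_gt0.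
have PF : ProperFilter (globally (ball x (d / 4) `*` ball x (d / 4))).
  exact: (@globally_properfilter _ _ (x, x)).
apply: (@klipschitzW _ _ _ (6 * C) (grad g) _ PF) => -[z z'] /= [Vz Vz'].
have [p [_ -> Hp]] := P z Vz; have [p' [_ -> Hp']] := P z' Vz'.
have {Vz} := inV _ Vz; have {Vz'} := inV _ Vz' => hz' hz.
pose D := `|z - z'|.
have D0 : 0 <= D by exact: normr_ge0.
have Dd : D < d / 2.
  rewrite /D -[z - z'](subrKA x); apply: le_lt_trans (ler_normD _ _) _.
  by rewrite (distrC x); clear -hz hz'; lra.
(* The final estimate is divided by D. For D = 0 the two slopes agree because both are the gradient
   at z. *)
have [D_eq0|Dn0] := eqVneq D 0.
  have zz : z = z' by apply/eqP; rewrite -subr_eq0 -normr_eq0 -/D D_eq0.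
  have pp : p = p'.
    have [_ e1] := expansion_differentiable d0 C0 Hp.
    have [_ e2] := expansion_differentiable d0 C0 Hp'.
    by rewrite -e1 -e2 zz.
  by rewrite pp subrr normr0 mulr_ge0// mulr_ge0.
have Dp : 0 < D by rewrite lt_def Dn0.
have key h : `|h| <= D -> `|dot (p - p') h| <= 6 * C * D * D.
  move=> hD.
  have hd : `|h| < d by clear -hD Dd d0; lra.
  have e1 := Hp h hd.
  have zd : `|z - z'| < d by rewrite -/D; clear -Dd d0; lra.
  have e3 := Hp' (z - z') zd.
  have h2D : `|h + (z - z')| <= 2 * D.
    by apply: le_trans (ler_normD _ _) _; rewrite -/D; clear -hD; lra.
  have hzd : `|h + (z - z')| < d by clear -h2D Dd; lra.
  have e2 := Hp' _ hzd.
  have z1 : z' + (h + (z - z')) = z + h by rewrite addrCA subrKC addrC.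
  have z2 : z' + (z - z') = z by rewrite subrKC.
  rewrite z1 dotDr in e2; rewrite z2 in e3.
  have q1 : C * `|h| ^+ 2 <= C * D ^+ 2.
    by apply: ler_wpM2l => //; rewrite lerXn2r ?nnegrE.
  have q2 : C * `|h + (z - z')| ^+ 2 <= C * (2 * D) ^+ 2.
    by apply: ler_wpM2l => //; rewrite lerXn2r ?nnegrE// mulr_ge0.
  have q3 : C * `|z - z'| ^+ 2 = C * D ^+ 2 by [].
  rewrite dotBl.
  exact: second_difference_bound e1 e2 e3 q1 q2 q3.
(* The vectors (D, 0) and (0, D) have sup norm D and isolate the coordinates of p - p'. *)
rewrite pnorm_le /= -/D; apply/andP; split.
  have := key (D, 0); rewrite pnorm_le /= normr0 ger0_norm// lexx D0 => /(_ isT).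
  rewrite {1}/dot /= mulr0 addr0 normrM [`|D|]ger0_norm//.
  by rewrite ler_pM2r.
have := key (0, D); rewrite pnorm_le /= normr0 ger0_norm// lexx D0 => /(_ isT).
rewrite {1}/dot /= mulr0 add0r normrM [`|D|]ger0_norm//.
by rewrite ler_pM2r.
Qed.

(** * Rays through points of differentiability *)

Lemma gauge_le1_mem (R : realType) (r : regularity R) (K : set (R * R)) (k : R -> R * R)
  (v : R * R) : gauge_body r K k -> gauge K v <= 1 -> K v.
Proof.
move=> gb g1; have [t -> Kt] := gauge_ex gb v.
have -> : gauge K v *: k t = gauge K v *: k t + (1 - gauge K v) *: 0.
  by rewrite scaler0 addr0.
apply: (gb_comb gb) Kt (gb_mem0 gb); last by rewrite addrC subrK.
  exact: gauge_ge0 gb v.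
by rewrite subr_ge0.
Qed.

(* If f is differentiable near x, its slope in the gauge is 1 at every nearby
   point, so the maximum of f over x + s K is f x + s; by strict convexity it is
   attained on the ray from y through x. *)
Lemma differentiable_ray (R : realType) (r : regularity R) (K U : set (R * R))
    (k : R -> R * R) (x y : R * R) (t0 d : R) :
  admissible r -> gauge_body r K k -> open U -> compact (boundary U) ->
  boundary U !=set0 -> U x -> closest U K x y -> x - y = dK U K x *: k t0 ->
  0 < d -> (forall z, `|z - x| < d -> differentiable (dK U K) z) ->
  exists s : R, [/\ 0 < s, closest U K (x + s *: k t0) y
    & dK U K (x + s *: k t0) = dK U K x + s].
Proof.
move=> ar gb Uo Bc Bn Ux cxy xyE d0 df.
have fx0 : 0 < dK U K x by apply: (dK_gt0 ar gb Uo Bc Bn).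
have [Mb Mb0 HMb] := gb_bounded gb.
have [M M0 HM] := gauge_bound gb.
pose s := d / (2 * Mb).
have s0 : 0 < s by rewrite divr_gt0// mulr_gt0.
have fc : continuous (dK U K).
  move=> u; apply/cvgrPdist_lt => e e0.
  have c0 : 0 < e / M by rewrite divr_gt0.
  apply: filterS (near_dist u c0) => w wu; rewrite distrC.
  apply: le_lt_trans (dK_lip ar gb Bc Bn HM _ _) _.
  by rewrite mulrC -ltr_pdivlMr.
have fsc : continuous (fun z : R * R => dK U K (x + s *: z)).
  move=> z; apply: (@continuous_comp _ _ _ (fun z : R * R => x + s *: z) (dK U K)); last exact: fc.
  apply: (@cvgD _ (R * R)%type); first exact: cvg_cst.
  by apply: (@cvgZl_tmp _ (R * R)%type); exact: cvg_id.
have K0 : K !=set0 by exists 0; exact: gb_mem0 gb.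
have inball z : K z -> `|x + s *: z - x| < d.
  move=> Kz; rewrite addrAC subrr add0r normrZ gtr0_norm//.
  apply: (@le_lt_trans _ _ (s * Mb)); first by apply: ler_wpM2l; [exact: ltW|exact: HMb].
  have -> : s * Mb = d / 2 by rewrite /s; field; rewrite gt_eqF.
  by rewrite ltr_pdivrMr// ltr_pMr// ltr1n.
have [zs zsK Hzs] := compact_EVT_max K0 (gb_compact gb) (continuous_subspaceT fsc).
(* A penalty of slope 1 - eta forces the maximizer of [F] to gauge 1: at smaller gauge, moving away
   from the closest point raises the distance with slope 1, and the penalty by less. *)
have big eta : 0 < eta -> eta < 1 -> dK U K x + (1 - eta) * s <= dK U K (x + s *: zs).
  move=> eta0 eta1.
  have ces : 0 < (1 - eta) * s by rewrite mulr_gt0// subr_gt0.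
  pose F (z : R * R) := dK U K (x + s *: z) - (1 - eta) * s * gauge K z.
  have Fc : continuous F.
    move=> z; apply: (@cvgB _ R); first exact: fsc.
    by apply: (@cvgMl_tmp R); exact: gauge_continuous gb z.
  have [zb zbK Hzb] := compact_EVT_max K0 (gb_compact gb) (continuous_subspaceT Fc).
  have Kzb : K zb by exact: set_mem.
  have F0 : dK U K x <= F zb.
    have := Hzb 0 (mem_set (gb_mem0 gb)).
    by rewrite {1}/F scaler0 addr0 (gauge0 gb) mulr0 subr0.
  have g1 : 1 <= gauge K zb.
    rewrite leNgt; apply/negP => g1.
    set w := x + s *: zb.
    have fw0 : 0 < dK U K w.
      apply: lt_le_trans fx0 _; apply: le_trans F0 _; rewrite /F -/w gerBl.
      exact: mulr_ge0 (ltW ces) (gauge_ge0 gb zb).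
    have [q cq] := closest_ex ar gb Bc Bn w.
    have [wq _] := differentiable_closest ar gb Bc Bn (df w (inball _ Kzb)) cq.
    have gE : gauge K (w - q) = dK U K w by case: cq => _ ->.
    rewrite gE in wq; set g := dK U K w in fw0 wq gE.
    have e0 : 0 < eta * g / 2 by rewrite divr_gt0// mulr_gt0.
    have [d1 d10 H1] := differentiable_dir (w - q) (df w (inball _ Kzb)) e0.
    pose ep := Num.min (d1 / 2) (s * (1 - gauge K zb) / g).
    have ep0 : 0 < ep by rewrite lt_min !divr_gt0// mulr_gt0// subr_gt0.
    have epd : ep < d1 by rewrite gt_min; apply/orP; left; rewrite ltr_pdivrMr// ltr_pMr// ltr1n.
    pose z' := zb + (ep / s) *: (w - q).
    have gz' : gauge K z' <= gauge K zb + ep * g / s.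
      apply: le_trans (gaugeD ar gb _ _) _.
      rewrite lerD2l (gaugeZ ar gb); last by rewrite divr_ge0// ltW.
      by rewrite gE mulrAC.
    have Kz' : K z'.
      apply: (gauge_le1_mem gb); apply: le_trans gz' _.
      have : ep * g / s <= 1 - gauge K zb.
        rewrite ler_pdivrMr// -ler_pdivlMr// mulrC.
        by rewrite [leRHS]mulrC ge_min [(1 - _) * s]mulrC lexx orbT.
      by rewrite -lerBrDl.
    have := Hzb _ (mem_set Kz').
    have wz : x + s *: z' = w + ep *: (w - q).
      rewrite /z' scalerDr scalerA addrA -/w; congr (_ + _ *: _).
      by field; rewrite gt_eqF.
    have := H1 ep; rewrite gtr0_norm// wq => /(_ epd).
    rewrite /F wz -/w -/g ler_norml => /andP[h1 _] h2.
    have h3 : (1 - eta) * s * gauge K z' <= (1 - eta) * s * (gauge K zb + ep * g / s).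
      by rewrite ler_pM2l.
    have h4 : (1 - eta) * s * (gauge K zb + ep * g / s) =
       (1 - eta) * s * gauge K zb + (1 - eta) * (ep * g) by field; rewrite gt_eqF.
    rewrite h4 in h3.
    have h5 : 0 < eta * (ep * g) by rewrite !mulr_gt0.
    move: h1 h2 h3 h5; rewrite -/g; clear.
    move: (dK _ _ _) (gauge K z') (gauge K zb) => a b c.
    set X := (1 - eta) * s * b; set Y := (1 - eta) * s * c.
    have -> : (1 - eta) * (ep * g) = ep * g - eta * (ep * g) by ring.
    have -> : eta * g / 2 * ep = eta * (ep * g) / 2 by field.
    by lra.
  apply: (le_trans _ (Hzs zb zbK)).
  have h : (1 - eta) * s * 1 <= (1 - eta) * s * gauge K zb.
    by rewrite ler_pM2l.
  by move: F0 h; rewrite /F; clear; rewrite mulr1; lra.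
have Kzs : K zs by exact: set_mem.
have up : dK U K x + s <= dK U K (x + s *: zs).
  rewrite leNgt; apply/negP => lt.
  pose g := (dK U K x + s - dK U K (x + s *: zs)) / s.
  have g0 : 0 < g by rewrite divr_gt0// subr_gt0.
  pose eta := Num.min (g / 2) 2^-1.
  have eta0 : 0 < eta by rewrite lt_min; apply/andP; split; [exact: divr_gt0|rewrite invr_gt0].
  have eta1 : eta < 1 by rewrite gt_min; apply/orP; right; rewrite invf_lt1 ?ltr1n.
  have := big eta eta0 eta1.
  have : eta <= g / 2 by rewrite ge_min lexx.
  have gs : g * s = dK U K x + s - dK U K (x + s *: zs) by rewrite /g divfK ?gt_eqF.
  move=> /(ler_wpM2r (ltW s0)) h1 h2.
  have gs0 : 0 < g * s by rewrite mulr_gt0.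
  by move: h1 h2 gs gs0; clear; lra.
have gzs : gauge K zs <= 1.
  by have := gauge_le (ltr01 : 0 < 1 :> R) Kzs; rewrite scale1r.
have gxy : gauge K (x - y) = dK U K x by case: cxy => _ ->.
have zsy : x + s *: zs - y = (x - y) + s *: zs by rewrite addrAC.
have By : boundary U y by case: cxy.
have le1 : dK U K (x + s *: zs) <= gauge K (x + s *: zs - y) by exact: (dK_le gb).
have le2 : gauge K (x + s *: zs - y) <= dK U K x + s.
  rewrite zsy; apply: le_trans (gaugeD ar gb _ _) _; rewrite gxy lerD2l.
  by rewrite (gaugeZ ar gb _ (ltW s0)); apply: ler_piMr (ltW s0) gzs.
have eq1 : gauge K (x + s *: zs - y) = dK U K x + s.
  by apply/eqP; rewrite eq_le le2 (le_trans up le1).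
(* The conormal at [t1] takes the value dK x + s on (x - y) + s zs, while its parts are at most dK x
   and s. Both are therefore attained, and x - y lies on the ray of [k t1]. *)
have [t1 vt1 _] := gauge_ex gb (x + s *: zs - y).
have n1 : dot (conormal k t1) (x + s *: zs - y) = dK U K x + s.
  by rewrite vt1 dotZr (conormal_k ar gb) mulr1 eq1.
have n2 := conormal_le_gauge ar gb t1 (x - y).
have n3 := conormal_le1 ar gb t1 Kzs.
have n4 : dot (conormal k t1) (x - y) = gauge K (x - y).
  have sn : s * dot (conormal k t1) zs <= s * 1 by rewrite ler_pM2l.
  have en : dot (conormal k t1) (x - y) + s * dot (conormal k t1) zs = dK U K x + s.
    have E m : dot m (x - y + s *: zs) = dot m (x - y) + s * dot m zs.
      by rewrite dotDr [dot m (s *: zs)]dotZr.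
    by rewrite -n1 zsy E.
  apply/eqP; rewrite eq_le n2 /= gxy.
  by move: sn en; clear; lra.
have kk : k t0 = k t1.
  have := conormal_eq_gauge ar gb n4; rewrite gxy xyE => e.
  by apply: (k_inj_gauge ar gb fx0 fx0 e).
have zE : x + s *: k t0 = x + s *: zs.
  have := vt1; rewrite eq1 scalerDl -kk -xyE zsy => /addrI -> //.
exists s; rewrite zE; split => //; last by apply/eqP; rewrite eq_le up (le_trans le1).
by split => //; apply/eqP; rewrite eq_le le1 (le_trans le2).
Qed.

(** * Necessary conditions at a closest point *)

(** A boundary curve leaving y with positive pairing with the conormal would enter the gauge ball
    around x: by [gauge_upper] the linear gain beats the quadratic error. The factor [e] selects the
    side on which the curve lies in the boundary. *)
Lemma first_order (R : realType) (r : regularity R) (K U : set (R * R)) (k : R -> R * R)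
    (x y : R * R) (t0 s0 d e dl : R) (c c1 c2 : R -> R * R) :
  admissible r -> gauge_body r K k -> 0 < dK U K x -> closest U K x y ->
  x - y = dK U K x *: k t0 -> 0 < d -> C2_ball s0 d c c1 c2 -> c s0 = y ->
  `|e| <= 1 -> 0 < dl ->
  (forall s, 0 < s -> s < dl -> boundary U (c (s0 + e * s))) ->
  e * dot (conormal k t0) (c1 s0) <= 0.
Proof.
move=> ar gb l0 [By yE] xy d0 HC cs0 e1 dl0 HB.
rewrite leNgt; apply/negP => b0.
set n := conormal k t0 in b0; set b := dot n (c1 s0) in b0.
have en : e != 0 by apply/eqP => e0; move: b0; rewrite e0 mul0r ltxx.
have [C [dg [C0 dg0 HG]]] := gauge_upper ar gb t0 l0.
have c1c : {for s0, continuous c1}.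
  by have [|_ h _] := HC s0; [rewrite subrr normr0|exact: has_vel_continuous h].
have cc : {for s0, continuous c}.
  by have [|h _ _] := HC s0; [rewrite subrr normr0|exact: has_vel_continuous h].
have cst : {for s0, continuous (fun _ : R => n)} by exact: cvg_cst.
have eb0 : 0 < e * b / 2 by rewrite divr_gt0.
have [d1 d10 B1] := dot_near cst c1c eb0.
have [d2 d20 B2] := continuous_dist c1c ltr01.
have [d3 d30 B3] := continuous_dist cc dg0.
pose M := `|c1 s0| + 1; have M0 : 0 < M by rewrite ltr_wpDl.
(* Up to this length C (M s)^2 is at most e b s / 4, whereas the linear gain exceeds e b s / 2. *)
pose X := e * b / (4 * C * M ^+ 2).
have X0 : 0 < X by rewrite divr_gt0// !mulr_gt0// exprn_gt0.
pose m := Num.min d (Num.min d1 (Num.min d2 d3)).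
have m0 : 0 < m by rewrite !lt_min d0 d10 d20 d30.
pose s := Num.min (m / 2) (Num.min (dl / 2) X).
have s_gt0 : 0 < s by rewrite !lt_min X0 !divr_gt0.
have sm : s < m by rewrite gt_min; apply/orP; left; rewrite ltr_pdivrMr// ltr_pMr// ltr1n.
have sdl : s < dl by rewrite !gt_min; apply/orP; right; apply/orP; left; rewrite ltr_pdivrMr// ltr_pMr// ltr1n.
have sX : s <= X by rewrite !ge_min lexx !orbT.
have Bs := HB s s_gt0 sdl.
have inm u : `|u - s0| < m -> [/\ `|u - s0| < d, `|u - s0| < d1, `|u - s0| < d2 & `|u - s0| < d3].
  by rewrite !lt_min => /and4P[].
have i0 : `|s0 - s0| < m by rewrite subrr normr0.
have sE : s0 + e * s - s0 = e * s by rewrite addrAC subrr add0r.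
have es : `|e * s| <= s by rewrite normrM [`|s|]gtr0_norm// ler_piMl// ltW.
have i1 : `|s0 + e * s - s0| < m by rewrite sE; apply: le_lt_trans sm.
have Hv u : `|u - s0| < m -> has_vel c c1 u by move=> /inm[/HC[]].
have [xi xid eq1] := MVT_dot n Hv i0 i1.
rewrite sE cs0 in eq1.
pose h := y - c (s0 + e * s).
have hM : `|h| <= M * s.
  have V := @MVT_vec _ c c1 s0 m s0 (s0 + e * s) 1 (c1 s0) Hv _ i0 i1.
  have {V} := V (fun u hu => ltW (let: And4 _ _ h2 _ := inm u hu in B2 u h2)).
  rewrite sE cs0 mul1r => V.
  have -> : h = - (c (s0 + e * s) - y - (e * s) *: c1 s0) - (e * s) *: c1 s0.
    by rewrite /h; apply: pairE; rewrite /= /GRing.scale /=; ring.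
  apply: le_trans (ler_normB _ _) _; rewrite normrN normrZ /M mulrDl mul1r addrC.
  apply: lerD; first by rewrite mulrC; apply: ler_wpM2l.
  exact: le_trans V es.
have hdg : `|h| < dg.
  by have [_ _ _ h3] := inm _ i1; have := B3 _ h3; rewrite cs0 distrC.
have xc : x - c (s0 + e * s) = dK U K x *: k t0 + h by rewrite -xy /h addrA subrK.
have le1 : dK U K x <= gauge K (x - c (s0 + e * s)) by exact: (dK_le gb).
have z0 : `|t0 - t0| < dg by rewrite subrr normr0.
have := HG t0 (dK U K x) h z0 (lexx _) hdg; rewrite -xc => le2.
have nh : dot n h = - (dot n (c1 xi) * (e * s)).
  by rewrite /h dotBr eq1 opprD addrA subrr add0r.
have q1 : e * b / 2 < e * dot n (c1 xi).
  have [_ x1 _ _] := inm _ xid.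
  have := B1 s0 xi; rewrite subrr normr0 => /(_ d10 x1); rewrite -/b => q.
  have : `|e * (dot n (c1 xi) - b)| < e * b / 2.
    by rewrite normrM; apply: le_lt_trans q; rewrite ler_piMl.
  by rewrite ltr_norml mulrBr => /andP[q' _]; move: q'; clear; lra.
have q2 : C * `|h| ^+ 2 <= C * (M * s) ^+ 2.
  by rewrite ler_pM2l// lerXn2r ?nnegrE// mulr_ge0// ltW.
have q3 : C * (M * s) ^+ 2 <= e * b / 4 * s.
  have -> : C * (M * s) ^+ 2 = (C * M ^+ 2 * s) * s by ring.
  apply: ler_wpM2r; first exact: ltW.
  have -> : e * b / 4 = C * M ^+ 2 * X.
    by rewrite /X; field; rewrite !gt_eqF//.
  by rewrite ler_pM2l// mulr_gt0// exprn_gt0.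
have q4 : e * b / 2 * s < e * dot n (c1 xi) * s by rewrite ltr_pM2r.
have q5 : 0 < e * b / 4 * s by rewrite mulr_gt0// divr_gt0.
have := le_trans le1 le2; rewrite -/n nh => q6.
have q7 : dot n (c1 xi) * (e * s) = e * dot n (c1 xi) * s by ring.
rewrite q7 in q6.
by move: q2 q3 q4 q5 q6; clear; lra.
Qed.

(* The ball touching at k (t0 - (be / la) e s) instead of k t0 cancels the first
   order terms at the boundary point c (s0 + e s). *)
Lemma second_order_necessary (R : realType) (r : regularity R) (K U : set (R * R))
    (k : R -> R * R) (x y : R * R) (t0 s0 d e dl be : R) (c c1 c2 : R -> R * R) :
  admissible r -> gauge_body r K k -> 0 < dK U K x -> closest U K x y ->
  x - y = dK U K x *: k t0 -> 0 < d -> C2_ball s0 d c c1 c2 -> c s0 = y ->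
  `|e| = 1 -> 0 < dl ->
  (forall s, 0 < s -> s < dl -> boundary U (c (s0 + e * s))) ->
  c1 s0 = be *: vel k t0 ->
  dK U K x * dot (conormal k t0) (c2 s0) <=
    be ^+ 2 * - dot (conormal k t0) (vel (vel k) t0).
Proof.
move=> ar gb l0 [By yE] xy d0 HC cs0 e1 dl0 HB c1E.
rewrite leNgt; apply/negP => contra.
set n := conormal k t0 in contra; set la := dK U K x in l0 yE xy contra *.
pose a := - be / la.
have [C [dg [C0 dg0 HG]]] := gauge_upper ar gb t0 l0.
have c2c : {for s0, continuous c2} by have [|_ _ h] := HC s0; [rewrite subrr normr0|].
have kc2 := gb_acc_continuous ar gb (t := t0).
have nc := conormal_continuous ar gb (t := t0).
(* - D s^2 / 2 is the leading term of the upper bound for the gauge at c (s0 + e s), minus la; the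
   negated claim makes D positive. *)
pose D := la * a ^+ 2 * dot n (vel (vel k) t0) + dot n (c2 s0).
have D0 : 0 < D.
  have -> : D = (la * dot n (c2 s0) - be ^+ 2 * - dot n (vel (vel k) t0)) / la.
    by rewrite /D /a; field; rewrite gt_eqF.
  by rewrite divr_gt0// subr_gt0.
pose L := la * a ^+ 2 + 1.
have L0 : 0 < L by rewrite ltr_wpDl// mulr_ge0 ?sqr_ge0// ltW.
have eta0 : 0 < D / (2 * L) by rewrite divr_gt0// mulr_gt0.
have [d1 d10 B1] := dot_near nc kc2 eta0.
have [d2 d20 B2] := dot_near nc c2c eta0.
have [d3 d30 B3] := continuous_bounded kc2.
have [d4 d40 B4] := continuous_bounded c2c.
set W1 := `|_| + 1 in B3; set W2 := `|_| + 1 in B4.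
have W10 : 0 <= W1 by rewrite addr_ge0.
have W20 : 0 <= W2 by rewrite addr_ge0.
pose M := 2^-1 * (la * a ^+ 2 * W1 + W2) + 1.
have M0 : 0 < M by apply: ltr_wpDl => //; nonneg.
pose m := Num.min d (Num.min d1 (Num.min d2 (Num.min d3 (Num.min d4 dg)))).
have m0 : 0 < m by rewrite !lt_min d0 d10 d20 d30 d40 dg0.
have inm (u : R) : u < m -> [/\ u < d, u < d1, u < d2, u < d3 & u < d4 /\ u < dg].
  by rewrite !lt_min => /and5P[-> -> -> -> /andP[-> ->]].
pose X := D / (8 * C * M ^+ 2).
have CM0 : 0 < C * M ^+ 2 by apply: mulr_gt0 => //; exact: exprn_gt0.
have X0 : 0 < X.
  by apply: divr_gt0; [exact: D0|rewrite -mulrA; exact: mulr_gt0].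
have A1 : 0 < `|a| + 1 by rewrite ltr_wpDl.
pose s := Num.min (Num.min (m / (2 * (`|a| + 1))) (m / (2 * M))) (Num.min (dl / 2) (Num.min X (Num.min 1 (m / 2)))).
have s_gt0 : 0 < s by rewrite !lt_min X0 ltr01 !divr_gt0// mulr_gt0.
have half (u : R) : 0 < u -> u / 2 < u by move=> u0; rewrite ltr_pdivrMr// ltr_pMr// ltr1n.
have sm : s < m by rewrite !gt_min half// !orbT.
have sdl : s < dl by rewrite !gt_min half// !orbT.
have s1 : s <= 1 by rewrite !ge_min lexx !orbT.
have sX : s <= X by rewrite !ge_min lexx !orbT.
have sa : s * (`|a| + 1) < m.
  have : s <= m / (2 * (`|a| + 1)) by rewrite !ge_min lexx.
  rewrite ler_pdivlMr ?mulr_gt0// => h; apply: le_lt_trans (half _ m0).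
  by rewrite ler_pdivlMr// -mulrA [_ * 2]mulrC.
have sM : s * M < m.
  have : s <= m / (2 * M) by rewrite !ge_min lexx !orbT.
  rewrite ler_pdivlMr ?mulr_gt0// => h; apply: le_lt_trans (half _ m0).
  by rewrite ler_pdivlMr// -mulrA [_ * 2]mulrC.
have Bs := HB s s_gt0 sdl.
pose s' := s0 + e * s; pose th := t0 + a * (e * s).
have s'E : s' - s0 = e * s by rewrite /s' addrAC subrr add0r.
have thE : th - t0 = a * (e * s) by rewrite /th addrAC subrr add0r.
have nes : `|e * s| = s by rewrite normrM e1 mul1r gtr0_norm.
have i1 : `|s' - s0| < m by rewrite s'E nes.
have i2 : `|th - t0| < m.
  rewrite thE normrM nes; apply: le_lt_trans sa; rewrite mulrC.
  by apply: ler_wpM2l; [exact: ltW|rewrite lerDl].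
have i0 : `|s0 - s0| < m by rewrite subrr normr0.
have j0 : `|t0 - t0| < m by rewrite subrr normr0.
have HCm : C2_ball s0 m c c1 c2 by apply: C2_ball_le HC; rewrite ge_min lexx.
have b3 u : `|u - t0| < m -> `|vel (vel k) u| <= W1 by move=> /inm[_ _ _ h _]; exact: B3.
have b4 u : `|u - s0| < m -> `|c2 u| <= W2 by move=> /inm[_ _ _ _ [h _]]; exact: B4.
have [w1 w1b k_eq] := taylor2_vec (gb_C2 ar gb (t0 := t0) (d := m)) b3 j0 i2.
have [w2 w2b c_eq] := taylor2_vec HCm b4 i0 i1.
pose nt := conormal k th.
have [x1 x1b kd_eq] := taylor2_dot nt (gb_C2 ar gb (t0 := t0) (d := m)) j0 i2.
have [x2 x2b cd_eq] := taylor2_dot nt HCm i0 i1.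
rewrite thE in k_eq kd_eq; rewrite s'E cs0 c1E in c_eq cd_eq.
(* As la a = - be, the first order terms of [E] cancel and |E| <= M s^2. *)
pose E := x - la *: k th - c s'.
have la_n : la != 0 by rewrite gt_eqF.
have xE : x = la *: k t0 + y by rewrite -xy subrK.
have ea : la * a = - be by rewrite /a mulrC divfK.
have e2 : e ^+ 2 = 1 by rewrite -real_normK ?num_real// e1 expr1n.
have E_eq : E = (- (2^-1 * s ^+ 2)) *: ((la * a ^+ 2) *: w1 + w2).
  rewrite /E k_eq c_eq xE.
  have -> : (e * s) ^+ 2 = s ^+ 2 by rewrite exprMn e2 mul1r.
  have -> : (a * (e * s)) ^+ 2 = a ^+ 2 * s ^+ 2 by rewrite !exprMn e2 mul1r.
  have beE : be = - (la * a) by rewrite ea opprK.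
  rewrite beE.
  move: (vel k t0) (k t0) => v0 p0.
  by apply: pairE; rewrite /= /GRing.scale /= /GRing.scale /=; ring.
have nE : dot nt E = - (2^-1 * s ^+ 2) * (la * a ^+ 2 * dot nt (vel (vel k) x1) + dot nt (c2 x2)).
  have E' : E = la *: (k t0 - k th) + (y - c s').
    rewrite /E xE; move: (k t0) (k th) => p0 p1.
    by apply: pairE; rewrite /= /GRing.scale /=; ring.
  have lin m' : dot m' (la *: (k t0 - k th) + (y - c s')) =
     la * (dot m' (k t0) - dot m' (k th)) + (dot m' y - dot m' (c s')) by rewrite !dot_lin.
  rewrite E' lin kd_eq cd_eq [dot nt (be *: _)]dotZr.
  have -> : (e * s) ^+ 2 = s ^+ 2 by rewrite exprMn e2 mul1r.
  have -> : (a * (e * s)) ^+ 2 = a ^+ 2 * s ^+ 2 by rewrite !exprMn e2 mul1r.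
  have beE : be = - (la * a) by rewrite ea opprK.
  by rewrite beE; ring.
have EM : `|E| <= M * s ^+ 2.
  rewrite E_eq normrZ normrN ger0_norm; last by rewrite mulr_ge0 ?invr_ge0// sqr_ge0.
  have -> : M * s ^+ 2 = (2^-1 * s ^+ 2) * (la * a ^+ 2 * W1 + W2 + 2) by rewrite /M; field.
  apply: ler_wpM2l; first by rewrite mulr_ge0 ?invr_ge0// sqr_ge0.
  apply: le_trans (ler_normD _ _) _; apply: (@le_trans _ _ (la * a ^+ 2 * W1 + W2)).
    apply: lerD => //; rewrite normrZ ger0_norm; last by rewrite mulr_ge0 ?sqr_ge0// ltW.
    by apply: ler_wpM2l => //; rewrite mulr_ge0 ?sqr_ge0// ltW.
  by rewrite lerDl.
have Edg : `|E| < dg.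
  apply: le_lt_trans EM _; have [_ _ _ _ [_ h]] := inm _ sM.
  apply: le_lt_trans h; rewrite mulrC; apply: ler_wpM2r; first exact: ltW.
  by rewrite expr2 ler_piMl// ltW.
have thdg : `|th - t0| < dg by have [_ _ _ _ []] := inm _ i2.
have := HG th la E thdg (lexx _) Edg.
have -> : la *: k th + E = x - c s' by rewrite /E addrA [_ + (x - _)]addrC subrK.
have le1 : la <= gauge K (x - c s') by exact: (dK_le gb).
move=> /(le_trans le1); rewrite -/nt nE => q1.
(* The quadratic error is of order s^4; one spare factor s <= X brings it below D s^2 / 8. *)
have q2 : C * `|E| ^+ 2 <= C * M ^+ 2 * s * s ^+ 2.
  have -> : C * M ^+ 2 * s * s ^+ 2 = C * (M ^+ 2 * s * s ^+ 2) by ring.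
  rewrite ler_pM2l//; apply: (@le_trans _ _ ((M * s ^+ 2) ^+ 2)).
    by rewrite lerXn2r ?nnegrE// mulr_ge0 ?sqr_ge0// ltW.
  have -> : (M * s ^+ 2) ^+ 2 = M ^+ 2 * (s * s) * s ^+ 2 by ring.
  apply: ler_wpM2r; first exact: sqr_ge0.
  apply: ler_wpM2l; first exact: sqr_ge0.
  by rewrite ler_piMl// ltW.
have q3 : C * M ^+ 2 * s * s ^+ 2 <= D / 8 * s ^+ 2.
  apply: ler_wpM2r; first exact: sqr_ge0.
  have -> : D / 8 = C * M ^+ 2 * X by rewrite /X; field; rewrite !gt_eqF.
  by rewrite ler_pM2l.
have q4 : D / 2 <= la * a ^+ 2 * dot nt (vel (vel k) x1) + dot nt (c2 x2).
  have [_ t1 t2 _ _] := inm _ i2; have [_ y1 _ _ _] := inm _ x1b; have [_ _ y2 _ _] := inm _ x2b.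
  have b1 := B1 th x1 t1 y1; have b2 := B2 th x2 t2 y2.
  have : `|la * a ^+ 2 * (dot nt (vel (vel k) x1) - dot n (vel (vel k) t0))
     + (dot nt (c2 x2) - dot n (c2 s0))| <= D / 2.
    apply: le_trans (ler_normD _ _) _.
    have -> : D / 2 = la * a ^+ 2 * (D / (2 * L)) + D / (2 * L) by rewrite /L; field; rewrite gt_eqF.
    apply: lerD; last exact: ltW b2.
    rewrite normrM ger0_norm; last by rewrite mulr_ge0 ?sqr_ge0// ltW.
    by apply: ler_wpM2l; [rewrite mulr_ge0 ?sqr_ge0// ltW|exact: ltW b1].
  rewrite ler_norml mulrBr => /andP[h _].
  have DE : D = la * a ^+ 2 * dot n (vel (vel k) t0) + dot n (c2 s0) by [].
  clearbody D; move: h DE; clear.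
  move: (dot nt (vel (vel k) x1)) (dot n (vel (vel k) t0)) (dot nt (c2 x2)) (dot n (c2 s0)).
  by move: (la * a ^+ 2) => A u1 u2 u3 u4 h DE; rewrite DE in h *; lra.
have s2 : 0 < s ^+ 2 by rewrite exprn_gt0.
have q5 : D / 2 * s ^+ 2 <= (la * a ^+ 2 * dot nt (vel (vel k) x1) + dot nt (c2 x2)) * s ^+ 2.
  by rewrite ler_pM2r.
have q6 : 0 < D * s ^+ 2 by rewrite mulr_gt0.
move: q1 q2 q3 q5 q6; move: (la * a ^+ 2 * dot nt (vel (vel k) x1) + dot nt (c2 x2)) => Z.
have -> : - (2^-1 * s ^+ 2) * Z = - (Z * s ^+ 2) / 2 by field.
have -> : D / 8 * s ^+ 2 = (D * s ^+ 2) / 8 by field.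
have -> : D / 2 * s ^+ 2 = (D * s ^+ 2) / 2 by field.
clear; move: (D * s ^+ 2) (Z * s ^+ 2) (C * `|E| ^+ 2) => u v w; lra.
Qed.

(** * Comparison of boundary points *)

Lemma half_gap (R : realType) (q a d : R) : d = q - a -> a + d / 2 <= q - d / 2.
Proof. by move=> ->; lra. Qed.

Lemma half_gap_le (R : realType) (q a d : R) : a + d <= q -> a + d / 2 <= q - d / 2.
Proof. by move=> h; lra. Qed.

Section LegComparison.
Context {R : realType} (r : regularity R) (K : set (R * R)) (k : R -> R * R).
Hypotheses (ar : admissible r) (gb : gauge_body r K k).
Variables (t0 la : R).
Hypothesis la0 : 0 < la.
Implicit Types (c : R -> R * R) (be th l s : R).

Local Notation n := (conormal k).
Local Notation n' := (conormal' k).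
Local Notation A := (- dot (n t0) (vel (vel k) t0)).

(** At l = la, x = - Av, X = be Av the right side is exactly be^2 Av / la; the bracket after eta
    bounds the effect of perturbing the three arguments. *)
Lemma bilinear_margin (l x X be Av b eta : R) : 0 < la -> b = be / la -> 0 <= Av ->
  eta <= 1 -> `|l - la| <= eta -> `|x - - Av| <= eta -> `|X - be * Av| <= eta ->
  be ^+ 2 * Av / la - eta * (b ^+ 2 * (Av + 1) + la * b ^+ 2 + 2 * `|b|)
    <= l * b ^+ 2 * x + 2 * b * X.
Proof.
move=> la_0 bE A0 eta1 hl hx hX.
have eta0 : 0 <= eta by apply: le_trans hl.
have QE : be ^+ 2 * Av / la = la * b ^+ 2 * (- Av) + 2 * b * (be * Av).
  by rewrite bE; field; rewrite gt_eqF.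
have xb : `|x| <= Av + 1.
  have -> : x = (x - - Av) - Av by ring.
  apply: le_trans (ler_normB _ _) _; rewrite (ger0_norm A0) addrC lerD2l.
  exact: le_trans hx eta1.
have b20 := sqr_ge0 b.
have e1 : `|(l - la) * b ^+ 2 * x| <= eta * (b ^+ 2 * (Av + 1)).
  rewrite normrM [`|_ * b ^+ 2|]normrM (ger0_norm b20) -mulrA.
  apply: ler_pM => //; first by apply: mulr_ge0.
  by apply: ler_wpM2l.
have e2 : `|la * b ^+ 2 * (x - - Av)| <= la * b ^+ 2 * eta.
  rewrite normrM ger0_norm; last by apply: mulr_ge0 => //; exact: ltW.
  by apply: ler_wpM2l => //; apply: mulr_ge0 => //; exact: ltW.
have e3 : `|2 * b * (X - be * Av)| <= 2 * `|b| * eta.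
  rewrite normrM normrM ger0_norm//; apply: ler_wpM2l => //; exact: mulr_ge0.
rewrite QE.
have -> : l * b ^+ 2 * x + 2 * b * X = la * b ^+ 2 * - Av + 2 * b * (be * Av) +
  ((l - la) * b ^+ 2 * x + la * b ^+ 2 * (x - - Av) + 2 * b * (X - be * Av)) by ring.
move: e1 e2 e3; rewrite !ler_norml => /andP[e1 _] /andP[e2 _] /andP[e3 _].
rewrite lerD2l.
have -> : eta * (b ^+ 2 * (Av + 1) + la * b ^+ 2 + 2 * `|b|) =
  eta * (b ^+ 2 * (Av + 1)) + la * b ^+ 2 * eta + 2 * `|b| * eta by ring.
by rewrite !opprD; apply: lerD => //; apply: lerD.
Qed.

Let A_ge0 : 0 <= A.
Proof. by rewrite oppr_ge0; exact: conormal_acc_le0 ar gb t0. Qed.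

(** The arguments vary independently because [x1] and [x2] will come from separate mean value
    theorems. *)
Lemma curvature_margin c1 be eta : {for 0, continuous c1} -> c1 0 = be *: vel k t0 ->
  0 < eta ->
  exists2 dl, 0 < dl & forall l th' x1 x2 s, `|l - la| < dl -> `|th' - t0| < dl ->
    `|x1 - t0| < dl -> `|x2 - t0| < dl -> `|s| < dl ->
    be ^+ 2 * A / la - eta <= l * (be / la) ^+ 2 * dot (n th') (vel (vel k) x1)
      + 2 * (be / la) * dot (n' x2) (c1 s).
Proof.
move=> c1c c1E eta0; pose b := be / la.
pose L := b ^+ 2 * (A + 1) + la * b ^+ 2 + 2 * `|b| + 1.
have A1 : 0 <= A + 1 by apply: addr_ge0.
have L0 : 0 < L by apply: ltr_wpDl => //; nonneg.
pose eta1 := Num.min 1 (eta / L).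
have eta10 : 0 < eta1 by rewrite lt_min ltr01 divr_gt0.
have e1 : eta1 <= 1 by rewrite ge_min lexx.
have h : eta1 <= eta / L by rewrite ge_min lexx orbT.
clearbody eta1.
have [d1 d10 B1] := dot_near (conormal_continuous ar gb (t := t0)) (gb_acc_continuous ar gb (t := t0)) eta10.
have [d2 d20 B2] := dot_near (conormal'_continuous ar gb (t := t0)) c1c eta10.
exists (Num.min eta1 (Num.min d1 d2)); first by rewrite !lt_min eta10 d10 d20.
move=> l th' x1 x2 s; rewrite !lt_min => /and3P[l1 _ _] /and3P[_ th1 _] /and3P[_ y1 _]
  /and3P[_ _ y2] /and3P[_ _ s2].
have h1 := B1 _ _ th1 y1.
have h2 : `|dot (n' x2) (c1 s) - be * A| < eta1.
  have E : dot (n' t0) (c1 0) = be * A by rewrite c1E [LHS]dotZr conormal'_vel.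
  by rewrite -E; apply: B2 => //; rewrite subr0.
have h1' : `|dot (n th') (vel (vel k) x1) - - A| <= eta1 by rewrite opprK ltW.
have := bilinear_margin la0 (erefl b) A_ge0 e1 (ltW l1) h1' (ltW h2).
apply: le_trans; rewrite lerD2l lerN2.
apply: (@le_trans _ _ (eta1 * L)); last by rewrite -ler_pdivlMr.
by apply: ler_wpM2l; [exact: ltW|rewrite lerDl].
Qed.

(* As n(th').k(th') = 1 and n(th').k'(th') = 0, tilting the conormal by
   th' - th = - (be / la) (s' - s) costs only a second order term, and this
   tilt is the optimal one. *)
Lemma leg_same c c1 c2 d be e : 0 < d -> C2_ball 0 d c c1 c2 ->
  c1 0 = be *: vel k t0 -> la * dot (n t0) (c2 0) < be ^+ 2 * A -> 0 < e ->
  exists2 dl, 0 < dl & forall th l s s', `|th - t0| < dl -> `|l - la| < dl ->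
    `|s| < dl -> `|s'| < dl -> (s' - s) * dot (n th) (c1 s) <= 0 ->
    exists2 th', `|th' - t0| < e & l <= dot (n th') (l *: k th - (c s' - c s)).
Proof.
move=> d0 HC c1E crit e0.
have i0 : `|0 - 0 : R| < d by rewrite subrr normr0.
have c1c : {for 0, continuous c1} by have [_ h _] := HC 0 i0; exact: has_vel_continuous h.
have c2c : {for 0, continuous c2} by have [_ _ h] := HC 0 i0.
(* Half of the margin [D] pays for [curvature_margin], the other half for the variation of [c2]. *)
pose C := dot (n t0) (c2 0); pose D := be ^+ 2 * A / la - C.
have D0 : 0 < D by rewrite subr_gt0 ltr_pdivlMr// mulrC.
have D2 : 0 < D / 2 by rewrite divr_gt0.
have [d1 d10 M1] := curvature_margin c1c c1E D2.
have [d2 d20 B2] := dot_near (conormal_continuous ar gb (t := t0)) c2c D2.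
pose b := be / la.
have b1 : 0 < 2 * `|b| + 1 by rewrite ltr_wpDl// mulr_ge0.
pose m := Num.min e (Num.min d (Num.min d1 d2)).
have m0 : 0 < m by rewrite !lt_min e0 d0 d10 d20.
have inm (u : R) : u < m -> [/\ u < e, u < d, u < d1 & u < d2].
  by rewrite !lt_min => /and4P[].
pose dl := Num.min (m / 2) (m / (2 * (2 * `|b| + 1))).
have dl0 : 0 < dl by rewrite lt_min !divr_gt0// mulr_gt0.
have dlm : dl < m by rewrite gt_min; apply/orP; left; rewrite ltr_pdivrMr// ltr_pMr// ltr1n.
exists dl => // th l s s' hth hl hs hs' fo.
pose sg := s' - s; pose th' := th - b * sg.
have hsg : `|b * sg| < m / 2.
  have dlb : dl * (2 * `|b| + 1) <= m / 2.
    have : dl <= m / (2 * (2 * `|b| + 1)) by rewrite ge_min lexx orbT.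
    have -> : m / (2 * (2 * `|b| + 1)) = m / 2 / (2 * `|b| + 1) by field; rewrite gt_eqF.
    by rewrite ler_pdivlMr.
  apply: lt_le_trans dlb; rewrite normrM.
  have : `|sg| <= 2 * dl.
    by apply: le_trans (ler_normB _ _) _; move: (ltW hs) (ltW hs'); clear; lra.
  move=> h; apply: (@le_lt_trans _ _ (`|b| * (2 * dl))); first exact: ler_wpM2l.
  have -> : dl * (2 * `|b| + 1) = `|b| * (2 * dl) + dl by ring.
  by rewrite ltrDl.
have hth' : `|th' - t0| < m.
  have -> : th' - t0 = (th - t0) - b * sg by rewrite /th'; ring.
  apply: le_lt_trans (ler_normB _ _) _.
  have : dl <= m / 2 by rewrite ge_min lexx.
  by move: hth hsg; clear; lra.
have hthm := lt_trans hth dlm; have hlm := lt_trans hl dlm.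
have hsm := lt_trans hs dlm; have hsm' := lt_trans hs' dlm.
exists th'; first by have [] := inm _ hth'.
pose mm := n th'.
have [x1 x1b e1] := taylor2_dot mm (gb_C2 ar gb (t0 := t0) (d := m)) hth' hthm.
have [x2 x2b e2] := MVT_dot (c1 s) (fun u _ => conormal_has_vel ar gb u) hthm hth'.
have HCm : C2_ball 0 m c c1 c2 by apply: C2_ball_le HC; rewrite !ge_min lexx orbT.
have [x3 x3b e3] := taylor2_dot mm HCm (s := s) (s' := s')
  (eq_ind_r (fun u => `|u| < m) hsm (subr0 s)) (eq_ind_r (fun u => `|u| < m) hsm' (subr0 s')).
have G (m' : R * R) : dot m' (l *: k th - (c s' - c s)) =
    l * dot m' (k th) - (dot m' (c s') - dot m' (c s)) by rewrite !dot_lin.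
rewrite G -/mm e1 e3 (conormal_k ar gb) conormal_vel mul0r addr0.
have mE : dot mm (c1 s) = dot (n th) (c1 s) - b * sg * dot (n' x2) (c1 s).
  have tE : th' - th = - (b * sg) by rewrite /th'; ring.
  by rewrite dotC e2 [dot (c1 s) (n th)]dotC [dot (c1 s) (n' x2)]dotC tE; ring.
rewrite mE.
have [_ _ hl1 _] := inm _ hlm; have [_ _ ht1 ht2] := inm _ hth'.
have [_ _ y1 _] := inm _ x1b; have [_ _ y2 _] := inm _ x2b.
have [_ _ hs1 _] := inm _ hsm; have [_ _ _ y3] := inm _ x3b.
have q1 := M1 l th' x1 x2 s hl1 ht1 y1 y2 hs1.
have q2 : dot mm (c2 x3) <= C + D / 2.
  have := B2 th' x3 ht2 y3; rewrite -/C -/mm ltr_norml => /andP[_].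
  by rewrite ltrBlDl => /ltW.
rewrite -/b -/mm in q1.
(* This is the coefficient of sg^2 / 2 in the surplus over l; the first order surplus - sg dot (n
   th) (c1 s) is nonnegative by [fo]. *)
have q3 : 0 <= l * b ^+ 2 * dot mm (vel (vel k) x1) + 2 * b * dot (n' x2) (c1 s) - dot mm (c2 x3).
  rewrite subr_ge0; apply: le_trans q2 _; apply: le_trans q1.
  exact: (half_gap (erefl D)).
have thE : th - th' = b * sg by rewrite /th'; ring.
rewrite thE -/sg in fo *.
have := mulr_ge0 q3 (sqr_ge0 sg).
move: fo; rewrite mulrC; move: (dot (n th) (c1 s)) (dot mm (c2 x3)) (dot (n' x2) (c1 s)).
move: (dot mm (vel (vel k) x1)) (dot mm (c s)) => X0 Y X1 X2 X3 fo q.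
rewrite -subr_ge0.
have -> : l * (1 + 2^-1 * X0 * (b * sg) ^+ 2) -
   (Y + (X1 - b * sg * X3) * sg + 2^-1 * X2 * sg ^+ 2 - Y) - l =
  2^-1 * ((l * b ^+ 2 * X0 + 2 * b * X3 - X2) * sg ^+ 2) - X1 * sg by field.
by rewrite subr_ge0; apply: le_trans fo _; apply: mulr_ge0; rewrite ?invr_ge0.
Qed.

(** The leg [g] continues [c] through their common point with speed ratio rho, so g s' takes the
    place of c at parameter - rho s'. The parameter distance becomes T = s + rho s' and the tilt + b
    T. The second derivatives may jump at a corner, so each leg brings its own inequality. *)
Lemma leg_cross c c1 c2 g g1 g2 d be rho e : 0 < d -> C2_ball 0 d c c1 c2 ->
  C2_ball 0 d g g1 g2 -> c 0 = g 0 -> 0 < rho ->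
  c1 0 = be *: vel k t0 -> g1 0 = (- (rho * be)) *: vel k t0 ->
  la * dot (n t0) (c2 0) < be ^+ 2 * A ->
  la * dot (n t0) (g2 0) < (rho * be) ^+ 2 * A -> 0 < e ->
  exists2 dl, 0 < dl & forall th l s s', `|th - t0| < dl -> `|l - la| < dl ->
    0 <= s -> s < dl -> 0 <= s' -> s' < dl -> dot (n th) (c1 s) = 0 ->
    exists2 th', `|th' - t0| < e & l <= dot (n th') (l *: k th - (g s' - c s)).
Proof.
move=> d0 HC HG cg rho0 c1E g1E critc critg e0.
have i0 : `|0 - 0 : R| < d by rewrite subrr normr0.
have c1c : {for 0, continuous c1} by have [_ h _] := HC 0 i0; exact: has_vel_continuous h.
have c2c : {for 0, continuous c2} by have [_ _ h] := HC 0 i0.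
have g2c : {for 0, continuous g2} by have [_ _ h] := HG 0 i0.
pose Q := be ^+ 2 * A / la.
pose C := dot (n t0) (c2 0); pose E := dot (n t0) (g2 0).
(* Division by rho^2 brings the condition on [g] to the scale of [c]; D is the common margin. *)
pose D := Num.min (Q - C) (Q - E / rho ^+ 2).
have r2 : 0 < rho ^+ 2 by rewrite exprn_gt0.
have D0 : 0 < D.
  rewrite lt_min; apply/andP; split.
    by rewrite subr_gt0 ltr_pdivlMr// mulrC.
  rewrite subr_gt0 ltr_pdivrMr// /Q mulrAC ltr_pdivlMr// mulrC.
  by apply: lt_le_trans critg _; rewrite exprMn le_eqVlt; apply/orP; left; apply/eqP; ring.
have D2 : 0 < D / 2 by rewrite divr_gt0.
have Dr : 0 < D / 2 * rho ^+ 2 by rewrite mulr_gt0.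
have [d1 d10 M1] := curvature_margin c1c c1E D2.
have [d2 d20 B2] := dot_near (conormal_continuous ar gb (t := t0)) c2c D2.
have [d3 d30 B3] := dot_near (conormal_continuous ar gb (t := t0)) g2c Dr.
pose b := be / la.
pose L := `|b| * (1 + rho) + 1.
have L0 : 0 < L by rewrite ltr_wpDl// mulr_ge0// addr_ge0// ltW.
pose m := Num.min e (Num.min d (Num.min d1 (Num.min d2 d3))).
have m0 : 0 < m by rewrite !lt_min e0 d0 d10 d20 d30.
have inm (u : R) : u < m -> [/\ u < e, u < d, u < d1, u < d2 & u < d3].
  by rewrite !lt_min => /and5P[].
pose dl := Num.min (m / 2) (m / (2 * L)).
have dl0 : 0 < dl by rewrite lt_min !divr_gt0// mulr_gt0.
have dlm : dl < m by rewrite gt_min; apply/orP; left; rewrite ltr_pdivrMr// ltr_pMr// ltr1n.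
exists dl => // th l s s' hth hl s0 hs s'0 hs' fo.
pose T := s + rho * s'; pose th' := th + b * T.
have T0 : 0 <= T by rewrite addr_ge0// mulr_ge0// ltW.
have hT : `|b * T| < m / 2.
  have dlb : dl * L <= m / 2.
    have : dl <= m / (2 * L) by rewrite ge_min lexx orbT.
    have -> : m / (2 * L) = m / 2 / L by field; rewrite gt_eqF.
    by rewrite ler_pdivlMr.
  apply: lt_le_trans dlb; rewrite normrM (ger0_norm T0).
  have h : T <= dl * (1 + rho).
    have -> : dl * (1 + rho) = dl + rho * dl by ring.
    by apply: lerD; [exact: ltW|rewrite ler_pM2l// ltW].
  apply: (@le_lt_trans _ _ (`|b| * (dl * (1 + rho)))); first exact: ler_wpM2l.
  have -> : dl * L = `|b| * (dl * (1 + rho)) + dl by rewrite /L; ring.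
  by rewrite ltrDl.
have hth' : `|th' - t0| < m.
  have -> : th' - t0 = (th - t0) + b * T by rewrite /th'; ring.
  apply: le_lt_trans (ler_normD _ _) _.
  have : dl <= m / 2 by rewrite ge_min lexx.
  by move: hth hT; clear; lra.
have hthm := lt_trans hth dlm; have hlm := lt_trans hl dlm.
have hsm : `|s - 0| < m by rewrite subr0 ger0_norm//; exact: lt_trans hs dlm.
have hsm' : `|s' - 0| < m by rewrite subr0 ger0_norm//; exact: lt_trans hs' dlm.
have h0m : `|0 - 0 : R| < m by rewrite subrr normr0.
exists th'; first by have [] := inm _ hth'.
pose mm := n th'.
have [x0 x0b e1] := taylor2_dot mm (gb_C2 ar gb (t0 := t0) (d := m)) hth' hthm.
have HCm : C2_ball 0 m c c1 c2 by apply: C2_ball_le HC; rewrite !ge_min lexx orbT.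
have HGm : C2_ball 0 m g g1 g2 by apply: C2_ball_le HG; rewrite !ge_min lexx orbT.
have [x1 x1b e2] := taylor2_dot mm HCm hsm h0m.
have [x2 x2b e3] := taylor2_dot mm HGm h0m hsm'.
have [x3 x3b e4] := MVT_dot mm (fun u hu => (let: And3 _ h _ := HCm u hu in h)) hsm h0m.
have [x4 x4b e5] := MVT_dot (c1 s) (fun u _ => conormal_has_vel ar gb u) hthm hth'.
have G (m' : R * R) : dot m' (l *: k th - (g s' - c s)) =
    l * dot m' (k th) - (dot m' (g s') - dot m' (c s)) by rewrite !dot_lin.
rewrite G -/mm e1 (conormal_k ar gb) conormal_vel mul0r addr0.
have mE : dot mm (c1 s) = b * T * dot (n' x4) (c1 s).
  have tE : th' - th = b * T by rewrite /th'; ring.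
  by rewrite dotC e5 [dot (c1 s) (n th)]dotC fo [dot (c1 s) (n' x4)]dotC tE; ring.
have cs : dot mm (c s) = dot mm (g 0) + dot mm (c1 s) * s - 2^-1 * dot mm (c2 x1) * s ^+ 2.
  by rewrite -cg e2 !sub0r sqrrN; ring.
(* A first order condition is available only for [c], at parameter s; the slope of [g] at the common
   point is derived from it through c1 0. *)
have g1m : dot mm (g1 0) = - (rho * (dot mm (c1 s) - dot mm (c2 x3) * s)).
  have -> : dot mm (c1 s) - dot mm (c2 x3) * s = dot mm (c1 0) by rewrite e4 sub0r; ring.
  by rewrite g1E c1E ![dot mm (_ *: _)]dotZr; ring.
rewrite cs e3 g1m mE !subr0.
have [_ _ hl1 _ _] := inm _ hlm; have [_ _ ht1 ht2 ht3] := inm _ hth'.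
have [_ _ y0 _ _] := inm _ x0b; have [_ _ _ y1 _] := inm _ x1b.
have [_ _ _ _ y2] := inm _ x2b; have [_ _ _ y3 _] := inm _ x3b.
have [_ _ y4 _ _] := inm _ x4b; have [_ _ hs1 _ _] := inm _ hsm.
rewrite subr0 in hs1.
have q1 := M1 l th' x0 x4 s hl1 ht1 y0 y4 hs1.
rewrite -/b -/mm -/Q in q1.
have DC : C + D <= Q by rewrite -lerBrDl ge_min lexx.
have DE : E + D * rho ^+ 2 <= Q * rho ^+ 2.
  have : D <= Q - E / rho ^+ 2 by rewrite ge_min lexx orbT.
  rewrite -(ler_pM2r r2) mulrBl divfK ?gt_eqF// => h; rewrite addrC.
  by rewrite -lerBrDr.
have up1 x : `|x - 0| < d2 -> dot mm (c2 x) <= Q - D / 2.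
  move=> /(B2 th' x ht2); rewrite -/C -/mm ltr_norml => /andP[_]; rewrite ltrBlDl => /ltW h.
  exact: le_trans h (half_gap_le DC).
have q2 := up1 _ y1; have q3 := up1 _ y3.
have q4 : dot mm (g2 x2) <= (Q - D / 2) * rho ^+ 2.
  have := B3 th' x2 ht3 y2; rewrite -/E -/mm ltr_norml => /andP[_]; rewrite ltrBlDl => /ltW h.
  apply: le_trans h _; have := half_gap_le DE.
  by rewrite mulrBl [D / 2 * _]mulrAC.
have thE : th - th' = - (b * T) by rewrite /th'; ring.
rewrite thE.
move: q1 q2 q3 q4; move: (dot mm (vel (vel k) x0)) (dot (n' x4) (c1 s)) (dot mm (c2 x1))
  (dot mm (c2 x3)) (dot mm (g2 x2)) (dot mm (g 0)) => X0 X4 X1 X3 X2 Y q1 q2 q3 q4.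
set P := Q - D / 2 in q1 q2 q3 q4.
have p0 : P * T ^+ 2 <= (l * b ^+ 2 * X0 + 2 * b * X4) * T ^+ 2.
  by apply: ler_wpM2r q1; exact: sqr_ge0.
have p1 : X1 * s ^+ 2 <= P * s ^+ 2 by apply: ler_wpM2r => //; exact: sqr_ge0.
have p2 : X2 * s' ^+ 2 <= P * rho ^+ 2 * s' ^+ 2 by apply: ler_wpM2r => //; exact: sqr_ge0.
have p3 : X3 * (rho * s * s') <= P * (rho * s * s').
  by apply: ler_wpM2r => //; rewrite !mulr_ge0// ltW.
rewrite -subr_ge0.
(* The cross term is matched by the change of [c1] between s and 0, the two squares by the second
   derivatives of the two legs. *)
have TE : P * T ^+ 2 = P * s ^+ 2 + P * rho ^+ 2 * s' ^+ 2 + 2 * (P * (rho * s * s')).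
  by rewrite /T; ring.
have -> : l * (1 + 2^-1 * X0 * (- (b * T)) ^+ 2) -
  (Y + - (rho * (b * T * X4 - X3 * s)) * s' + 2^-1 * X2 * s' ^+ 2 -
   (Y + b * T * X4 * s - 2^-1 * X1 * s ^+ 2)) - l =
  2^-1 * ((l * b ^+ 2 * X0 + 2 * b * X4) * T ^+ 2)
  - 2^-1 * (X1 * s ^+ 2) - 2^-1 * (X2 * s' ^+ 2) - X3 * (rho * s * s').
  by rewrite /T; field.
move: p0 p1 p2 p3 TE; clear.
move: (P * T ^+ 2) (_ * T ^+ 2) (X1 * s ^+ 2) (X2 * _) (X3 * _) (P * s ^+ 2) (P * rho ^+ 2 * _) (P * (_ * _ * _)).
by move=> a1 a2 a3 a4 a5 a6 a7 a8; lra.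
Qed.

End LegComparison.

(** * Arcs and corners *)

Section ArcStructure.
Context {R : realType} (r : regularity R) (U : set (R * R)) (N : nat)
  (S : 'I_N -> R -> R * R) (nxt : {perm 'I_N}).
Hypotheses (ar : admissible r) (pd : piecewise_domain U S nxt r).
Implicit Types (i j : 'I_N) (t : R).

Lemma arc_C2 i t : t \in `[0, 1] ->
  exists2 d, 0 < d & C2_ball t d (S i) (vel (S i)) (vel (vel (S i))).
Proof.
move=> t01; have [V [Vo V01 HV]] := pd_class pd i.
have Vt : V t by apply: V01.
move: Vo; rewrite openE => /(_ t Vt) /near_distP[d d0 Hd].
exists d; [exact: d0|exact: curve_of_class_C2 ar HV Hd].
Qed.

Lemma arc_continuous i t : t \in `[0, 1] -> {for t, continuous (S i)}.
Proof.
move=> /(arc_C2 i)[d d0 H]; have [|h _ _] := H t; first by rewrite subrr normr0.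
exact: has_vel_continuous h.
Qed.

Lemma arc_within i : {within `[0, 1], continuous (S i)}.
Proof.
apply: continuous_in_subspaceT => t; rewrite inE => t01; exact: arc_continuous.
Qed.

Lemma arc_boundary i t : t \in `[0, 1] -> boundary U (S i t).
Proof. by move=> t01; rewrite (pd_boundary pd); exists i => //; exists t. Qed.

Lemma boundary_arc q : boundary U q -> exists i t, t \in `[0, 1] /\ q = S i t.
Proof. by rewrite (pd_boundary pd) => -[i _ [t t01 <-]]; exists i, t. Qed.

Lemma boundary_compact : compact (boundary U).
Proof.
have -> : boundary U = \big[setU/set0]_(i < N) (S i @` `[0, 1]).
  rewrite (pd_boundary pd) -bigcup_seq; apply/seteqP.
  by split => q [i _ h]; exists i => //=; rewrite mem_index_enum.
apply: bigsetU_compact => i _; apply: continuous_compact; first exact: arc_within.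
exact: segment_compact.
Qed.

Lemma boundary_nonempty x : U x -> boundary U !=set0.
Proof.
move=> Ux; have [M [_ HM]] := pd_bounded pd.
pose c := `|M| + 2.
have nU : ~ U (c, 0).
  move=> Uc; have := HM (`|M| + 1); rewrite (le_lt_trans (ler_norm M)) ?ltrDl// => /(_ isT _ Uc) h.
  have {}h : `|(c, 0) : R * R| <= `|M| + 1 by exact: h.
  move: h; rewrite pnorm_le /= => /andP[+ _]; rewrite ger0_norm ?addr_ge0//.
  by rewrite lerD2l; lra.
have [s [_ h]] := segment_crossing (pd_open pd) Ux nU.
by exists (x + s *: ((c, 0) - x)).
Qed.

(** On the compact set [Z] of parameters at distance at least e from every preimage of y, |S i t -
    y| has a positive minimum. If y is off the arc, Z is all of [0, 1] and the arc stays away from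
    y. *)
Lemma arc_near i y e : 0 < e -> exists2 m, 0 < m & forall t, t \in `[0, 1] ->
  `|S i t - y| < m -> exists t', [/\ t' \in `[0, 1], S i t' = y & `|t - t'| < e].
Proof.
move=> e0.
pose Z := [set t | t \in `[0, 1] /\ forall t', t' \in `[0, 1] -> S i t' = y -> e <= `|t - t'|].
have cZ : compact Z.
  apply: (@subclosed_compact _ _ (`[0%R, 1%R]%classic : set R)); last by move=> t [].
    have -> : Z = (`[0%R, 1%R]%classic : set R) `&` \bigcap_(t' in [set t' | t' \in `[0, 1] /\ S i t' = y])
        [set t | e <= `|t - t'|].
      apply/seteqP; split => t.
        by move=> [t01 h]; split => // t' [? ?]; exact: h.
      by move=> [t01 h]; split => // t' ? ?; exact: h.
    apply: closedI; first exact: interval_closed.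
    apply: closed_bigI => t' _.
    apply: (@preimage_closed _ _ (fun t => `|t - t'|) [set u | e <= u]); last exact: closed_ge.
    move=> t _; have c1 : (fun t : R => t - t') p @[p --> t] --> t - t'.
      by apply: (@cvgB _ R); [exact: cvg_id|exact: cvg_cst].
    exact: (cvg_norm c1).
  exact: segment_compact.
have [||m m0 Hm] := @compact_pos_lb R R (fun t : R => `|S i t - y|) Z cZ.
- apply: continuous_in_subspaceT => t; rewrite inE => -[t01 _].
  have c1 : (fun t => S i t - y) p @[p --> t] --> S i t - y.
    by apply: (@cvgB _ (R * R)%type); [exact: arc_continuous|exact: cvg_cst].
  exact: (cvg_norm c1).
- move=> t [t01 h]; rewrite normr_gt0 subr_eq0; apply/eqP => E.
  by have := h t t01 E; rewrite subrr normr0 leNgt e0.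
exists m => // t t01 tm; apply/not_notP => nex.
have := Hm t; rewrite leNgt tm => /(_ _)/negP; apply => //; split => // t' t'01 E.
by rewrite leNgt; apply/negP => h; apply: nex; exists t'.
Qed.

Lemma arcs_near y e : 0 < e -> exists2 m : R, 0 < m & forall q, boundary U q -> `|q - y| < m ->
  exists i t t', [/\ t \in `[0, 1], t' \in `[0, 1], S i t' = y, `|t - t'| < e & q = S i t].
Proof.
move=> e0.
(* The minimum of the radii over the arcs is replaced by a finite intersection in the filter of
   right neighbourhoods of 0. *)
have : \forall m \near (0 : R)^'+, forall i t, t \in `[0, 1] ->
  `|S i t - y| < m -> exists t', [/\ t' \in `[0, 1], S i t' = y & `|t - t'| < e].
  apply: filter_forall => i; have [m m0 H] := arc_near i y e0.
  apply/nbhs_ballP; exists m => // m'; rewrite /ball /= sub0r normrN => m'm m'0 t t01 h.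
  by apply: H => //; apply: lt_trans h _; move: m'm; rewrite gtr0_norm.
move=> /right_nbhs0[m m0 H]; exists (m / 2); first by rewrite divr_gt0.
have m2 : 0 < m / 2 by rewrite divr_gt0.
have m3 : m / 2 < m by rewrite ltr_pdivrMr// ltr_pMr// ltr1n.
move=> q /boundary_arc[i [t [t01 ->]]] /(H (m / 2) m2 m3 i t t01)[t' [? ? ?]].
by exists i, t, t'.
Qed.

Lemma arc_interior_unique i t j t' : t \in `]0, 1[ -> t' \in `[0, 1] ->
  S j t' = S i t -> j = i /\ t' = t.
Proof.
move=> ti t'01 E; have t01 := itv_oo_cc ti.
have [ji|ji] := eqVneq j i.
  split => //; move: E t'01; rewrite ji => E t'01.
  exact: (pd_injective pd (i := i)).
exfalso; move: ti; rewrite in_itv /= => /andP[t0 t1].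
have := pd_disjoint pd ji t'01 t01 E => -[[_ [h _]]|[_ [h _]]].
  by move: t0; rewrite h ltxx.
by move: t1; rewrite h ltxx.
Qed.

Lemma in01_0 : (0 : R) \in `[0, 1].
Proof. by rewrite in_itv /= lexx ler01. Qed.

Lemma in01_1 : (1 : R) \in `[0, 1].
Proof. by rewrite in_itv /= lexx ler01. Qed.

Lemma arc_corner_unique i j t : t \in `[0, 1] -> S j t = S i 1 ->
  (j = i /\ t = 1) \/ (j = nxt i /\ t = 0).
Proof.
move=> t01 E; have [ji|ji] := eqVneq j i.
  left; split => //; move: E; rewrite ji => E.
  exact: (pd_injective pd (i := i) t01 in01_1).
have := pd_disjoint pd ji t01 in01_1 E => -[[_ [h _]]|[h1 [_ h2]]].
  by exfalso; move: (oner_neq0 R); rewrite h eqxx.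
by right.
Qed.

End ArcStructure.

Lemma norm_perp (R : realType) (v : R * R) : `|perp v| = `|v|.
Proof.
have -> : `|perp v| = Num.max `|- v.2| `|v.1| by [].
by rewrite normrN maxC.
Qed.

Lemma perpB (R : realType) (u v : R * R) : perp (u - v) = perp u - perp v.
Proof. by apply: pairE; rewrite /= ?opprD. Qed.

Lemma secant (R : realType) (c c1 : R -> R * R) (t0 d s s' e : R) (a : R * R) : 0 < e ->
  (forall t, `|t - t0| < d -> has_vel c c1 t) ->
  (forall t, `|t - t0| < d -> `|c1 t - a| <= e) ->
  `|s - t0| < d -> `|s' - t0| < d ->
  exists2 T, `|T - a| <= e & c s' - c s = (s' - s) *: T.
Proof.
move=> e0 H HM hs hs'; have [->|ne] := eqVneq s' s.
  by exists a; rewrite ?subrr ?normr0 ?scale0r// ltW.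
have d0 : s' - s != 0 by rewrite subr_eq0.
exists ((s' - s)^-1 *: (c s' - c s)); last by rewrite scalerA divff// scale1r.
have := MVT_vec H HM hs hs' => M.
have -> : (s' - s)^-1 *: (c s' - c s) - a = (s' - s)^-1 *: (c s' - c s - (s' - s) *: a).
  by rewrite [RHS]scalerBr [_ *: (_ *: a)]scalerA mulVf// scale1r.
by rewrite normrZ normfV ler_pdivrMl ?normr_gt0// mulrC.
Qed.

(* A point just outside U near the end of the arc i can be moved in the
   direction w into the gauge ball around x without meeting the boundary. *)
Lemma corner_no_direction (R : realType) (r : regularity R) (K U : set (R * R))
    (k : R -> R * R) (N : nat) (S : 'I_N -> R -> R * R) (nxt : {perm 'I_N})
    (x : R * R) (t0 : R) (i : 'I_N) (w : R * R)
    (a := vel (S (nxt i)) 0) (b := - vel (S i) 1) :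
  admissible r -> gauge_body r K k -> piecewise_domain U S nxt r -> U x ->
  closest U K x (S i 1) -> x - S i 1 = dK U K x *: k t0 ->
  0 < dot (perp b) w -> 0 < dot (conormal k t0) w ->
  dot (perp a) w < 0 \/ dot (perp b) a < 0 -> False.
Proof.
move=> ar gb pd Ux cxy xy bw nw ab.
set y := S i 1 in cxy xy; set j := nxt i in a ab.
have Bc := boundary_compact ar pd; have Bn := boundary_nonempty pd Ux.
have la0 : 0 < dK U K x := dK_gt0 ar gb (pd_open pd) Bc Bn Ux.
set T := vel (S i) 1 in b bw ab.
have bE : b = - T by [].
have T0 : T != 0 by apply/eqP; exact: (pd_regular pd in01_1).
have TT := dot_gt0 T0.
have TTp : 0 < dot (perp T) (perp T) by rewrite dot_perp_perp.
pose D := dot (perp b) w.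
have pbE v : dot (perp b) v = - dot (perp T) v by rewrite bE /dot /=; ring.
have [e1 e10 H1] := vec_dot_near (perp T) (perp T) TTp.
have [e2 e20 H2] := vec_dot_near (perp T) w (divr_gt0 bw (ltr0n R 2)).
(* The alternative is an open condition, so it passes to secant directions of the two arcs near
   y. *)
have [e3 e30 H3] : exists2 e, 0 < e & forall T' a', `|T' - T| < e -> `|a' - a| < e ->
    dot (perp a') w < 0 \/ dot (perp T') a' > 0.
  case: ab => [h|h].
    have h' : 0 < - dot (perp a) w by rewrite oppr_gt0.
    have [e e0 H] := vec_dot_near (perp a) w h'.
    exists e => // T' a' hT ha; left.
    have := H (perp a') w; rewrite -perpB norm_perp subrr normr0 => /(_ ha e0).
    by rewrite ltr_norml => /andP[_]; rewrite ltrBlDr addNr.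
  have h' : 0 < dot (perp T) a by move: h; rewrite pbE oppr_lt0.
  have [e e0 H] := vec_dot_near (perp T) a h'.
  exists e => // T' a' hT ha; right.
  have := H (perp T') a'; rewrite -perpB norm_perp => /(_ hT ha).
  by rewrite ltr_norml => /andP[+ _]; rewrite ltrBrDr addNr.
pose e4 := Num.min e1 (Num.min e2 e3) / 2.
have e40 : 0 < e4 by rewrite divr_gt0// !lt_min e10 e20.
have e4min : e4 < Num.min e1 (Num.min e2 e3) by rewrite ltr_pdivrMr ?ltr_pMr ?ltr1n// !lt_min e10 e20.
have e4_ (u : R) : u <= e4 -> [/\ u < e1, u < e2 & u < e3].
  by move=> /le_lt_trans /(_ e4min); rewrite !lt_min => /and3P[].
clearbody e4.
have [di di0 Ci] := arc_C2 ar pd i in01_1.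
have [dj dj0 Cj] := arc_C2 ar pd j in01_0.
have vic : {for 1, continuous (vel (S i))}.
  by have [|_ h _] := Ci 1; [rewrite subrr normr0|exact: has_vel_continuous h].
have vjc : {for 0, continuous (vel (S j))}.
  by have [|_ h _] := Cj 0; [rewrite subrr normr0|exact: has_vel_continuous h].
have [d1 d10 V1] := continuous_dist vic e40.
have [d2 d20 V2] := continuous_dist vjc e40.
pose dl := Num.min (Num.min di dj) (Num.min (Num.min d1 d2) 1).
have dl0 : 0 < dl by rewrite !lt_min di0 dj0 d10 d20 ltr01.
have dl_ (u : R) : u < dl -> [/\ u < di, u < dj, u < d1, u < d2 & u < 1].
  by rewrite !lt_min => /andP[/andP[-> ->] /andP[/andP[-> ->] ->]].
have Hi u : `|u - 1| < dl -> has_vel (S i) (vel (S i)) u by move=> /dl_[/Ci[]].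
have Hj u : `|u - 0| < dl -> has_vel (S j) (vel (S j)) u by move=> /dl_[_ /Cj[]].
have Hi1 u : `|u - 1| < dl -> `|vel (S i) u - T| <= e4 by move=> /dl_[_ _ /V1/ltW].
have Hj1 u : `|u - 0| < dl -> `|vel (S j) u - a| <= e4 by move=> /dl_[_ _ _ /V2/ltW].
have [m m0 Hm] := arcs_near ar pd y dl0.
have [C [dg [C0 dg0 HG]]] := gauge_upper ar gb t0 la0.
have W0 : 0 < `|w| + 1 by rewrite ltr_wpDl.
pose X := dot (conormal k t0) w / (2 * C * (`|w| + 1) ^+ 2).
have X0 : 0 < X by apply: divr_gt0 => //; apply: mulr_gt0; [exact: mulr_gt0|exact: exprn_gt0].
(* [X] puts y + rho w strictly inside the gauge ball; the other bounds keep [gauge_upper] applicable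
   and the points near y. *)
pose rho := Num.min X (Num.min (dg / (2 * (`|w| + 1))) (m / (2 * (`|w| + 1)))).
have rho0 : 0 < rho by rewrite !lt_min X0 !divr_gt0// mulr_gt0.
have rX : rho <= X by rewrite ge_min lexx.
have rw (u : R) : 0 < u -> rho <= u / (2 * (`|w| + 1)) -> rho * `|w| < u / 2.
  move=> u0; have -> : u / (2 * (`|w| + 1)) = u / 2 / (`|w| + 1) by field; rewrite gt_eqF.
  rewrite ler_pdivlMr//; apply: lt_le_trans.
  by rewrite ltr_pM2l// ltrDl.
have rdg : rho * `|w| < dg / 2 by apply: rw => //; rewrite !ge_min lexx orbT.
have rm : rho * `|w| < m / 2 by apply: rw => //; rewrite !ge_min lexx !orbT.
have gin : gauge K (x - (y + rho *: w)) < dK U K x.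
  have -> : x - (y + rho *: w) = dK U K x *: k t0 + (- rho) *: w.
    by rewrite -xy opprD addrA scaleNr.
  have z0 : `|t0 - t0| < dg by rewrite subrr normr0.
  have nrw : `|- rho *: w| = rho * `|w| by rewrite normrZ normrN gtr0_norm.
  apply: le_lt_trans (HG t0 _ _ z0 (lexx _) _) _.
    by rewrite nrw; apply: lt_trans rdg _; rewrite ltr_pdivrMr// ltr_pMr// ltr1n.
  rewrite nrw -addrA gtrDl [dot _ (_ *: w)]dotZr.
  have h1 : C * (rho * `|w|) ^+ 2 < rho * dot (conormal k t0) w.
    have -> : C * (rho * `|w|) ^+ 2 = rho * (rho * (C * `|w| ^+ 2)) by ring.
    rewrite ltr_pM2l//.
    have h2 : rho * (C * `|w| ^+ 2) <= X * (C * (`|w| + 1) ^+ 2).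
      apply: ler_pM => //; [exact: ltW|by apply: mulr_ge0; [exact: ltW|exact: sqr_ge0]|].
      by rewrite ler_pM2l// lerXn2r ?nnegrE// ?lerDl// ltW.
    apply: le_lt_trans h2 _.
    have -> : X * (C * (`|w| + 1) ^+ 2) = dot (conormal k t0) w / 2.
      by rewrite /X; field; rewrite !gt_eqF.
    by rewrite ltr_pdivrMr// ltr_pMr// ltr1n.
  by move: h1; clear; lra.
have gc : {for y + rho *: w, continuous (fun p : R * R => gauge K (x - p))}.
  apply: (@continuous_comp _ _ _ (fun p : R * R => x - p) (gauge K)); last exact: gauge_continuous ar gb _.
  by apply: (@cvgB _ (R * R)%type); [exact: cvg_cst|exact: cvg_id].
have [m2 m20 HU] : exists2 m2 : R, 0 < m2 & forall p, `|p - (y + rho *: w)| < m2 -> U p.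
  have [m2 m20 h] := near_distP (cvgr_lt _ gc _ gin).
  exists m2 => // p hp; apply: (dK_ball ar gb (pd_open pd) Ux); exact: h hp.
have mm0 : 0 < Num.min m m2 / 4 by rewrite divr_gt0// lt_min m0.
have [dc dc0 Hc] := continuous_dist (arc_continuous ar pd (i := i) in01_1) mm0.
(* [pd_inward] supplies points outside U only at interior parameters, hence a parameter slightly
   below 1. *)
pose ta := 1 - Num.min dl dc / 2.
have tad : 0 < 1 - ta by rewrite /ta opprB addrC subrK divr_gt0// lt_min dl0.
have tad1 : 1 - ta < Num.min dl dc.
  by rewrite /ta opprB addrC subrK ltr_pdivrMr ?ltr_pMr ?ltr1n// lt_min dl0.
have tadl : `|ta - 1| < dl by rewrite distrC gtr0_norm//; move: tad1; rewrite lt_min => /andP[].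
have tadc : `|ta - 1| < dc by rewrite distrC gtr0_norm//; move: tad1; rewrite lt_min => /andP[].
have ta0 : 0 < ta.
  have [_ _ _ _] := dl_ _ tadl; rewrite distrC gtr0_norm//; clear; lra.
have tai : ta \in `]0, 1[ by rewrite in_itv /= ta0 -subr_gt0.
have ta01 := itv_oo_cc tai.
pose nut := nu (S i) ta.
have Sta := Hc _ tadc.
have [ds ds0 Hs] := right_nbhs0 (pd_inward pd i tai).
(* The offset s nu must be negligible against the distance from S i ta to y, which is of order 1 -
   ta. *)
pose Y := (1 - ta) * (D / 2) / (`|dot (perp nut) w| + 1).
have Y1 : 0 < `|dot (perp nut) w| + 1 by rewrite ltr_wpDl.
have Y0 : 0 < Y by rewrite divr_gt0// mulr_gt0// divr_gt0.
have N0 : 0 < `|nut| + 1 by rewrite ltr_wpDl.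
pose s := Num.min (ds / 2) (Num.min Y (Num.min m m2 / (4 * (`|nut| + 1)))).
have s0 : 0 < s by rewrite !lt_min Y0 !divr_gt0 ?mulr_gt0// lt_min m0.
have sds : s < ds by rewrite gt_min; apply/orP; left; rewrite ltr_pdivrMr// ltr_pMr// ltr1n.
have sY : s <= Y by rewrite !ge_min lexx orbT.
have snu : s * `|nut| < Num.min m m2 / 4.
  have : s <= Num.min m m2 / (4 * (`|nut| + 1)) by rewrite !ge_min lexx !orbT.
  have -> : Num.min m m2 / (4 * (`|nut| + 1)) = Num.min m m2 / 4 / (`|nut| + 1).
    by field; rewrite gt_eqF.
  by rewrite ler_pdivlMr//; apply: lt_le_trans; rewrite ltr_pM2l// ltrDl.
have [_ nP0] := Hs s s0 sds.
set P0 := S i ta - s *: nu (S i) ta in nP0.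
have P0y : `|P0 - y| < Num.min m m2 / 2.
  have -> : P0 - y = (S i ta - y) - s *: nut by rewrite /P0 addrAC.
  apply: le_lt_trans (ler_normB _ _) _; rewrite normrZ gtr0_norm//.
  by move: Sta snu; rewrite -/y; move: (Num.min m m2) => q; clear; lra.
have P1U : U (P0 + rho *: w).
  apply: HU; rewrite opprD addrACA subrr addr0; apply: lt_le_trans P0y _.
  have : Num.min m m2 <= m2 by rewrite ge_min lexx orbT.
  by move: m20; move: (Num.min m m2) => q; clear; lra.
have [u [/andP[u0 u1] Bq]] := segment_crossing (pd_open pd) P1U nP0.
pose r' := (1 - u) * rho.
have r'0 : 0 <= r' by rewrite mulr_ge0 ?subr_ge0// ltW.
have r'rho : r' <= rho by apply: ler_piMl; [exact: ltW|rewrite gerBl].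
have qE : P0 + rho *: w + u *: (P0 - (P0 + rho *: w)) = P0 + r' *: w.
  have E (p v : R * R) : p + rho *: v + u *: (p - (p + rho *: v)) = p + ((1 - u) * rho) *: v.
    by apply: pairE; rewrite /= /GRing.scale /=; ring.
  exact: E.
rewrite qE in Bq.
have qm : `|P0 + r' *: w - y| < m.
  have -> : P0 + r' *: w - y = (P0 - y) + r' *: w by rewrite addrAC.
  apply: le_lt_trans (ler_normD _ _) _; rewrite normrZ ger0_norm//.
  have h1 : r' * `|w| <= rho * `|w| by apply: ler_wpM2r.
  have h2 : Num.min m m2 <= m by rewrite ge_min lexx.
  by move: P0y rm h1 h2; move: (Num.min m m2) => q; clear; lra.
have [i' [t [t' [t01 t'01 St' tt' qS]]]] := Hm _ Bq qm.
have i11 : `|1 - 1 : R| < dl by rewrite subrr normr0.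
have nuT : `|vel (S i) ta - T| <= e4 := Hi1 _ tadl.
(* On the arc i the displacement r' w - s nut is parallel to a secant T', yet it pairs strictly
   negatively with perp T'. *)
have [] := arc_corner_unique pd t'01 St'.
  move=> [ii t'1]; rewrite ii in qS; rewrite t'1 in tt'.
  have [T' T'T E] := secant e40 Hi Hi1 tadl tt'.
  have [q1 q2 _] := e4_ _ T'T.
  have [v1 v2 _] := e4_ _ nuT.
  have eq : (t - ta) *: T' = r' *: w - s *: nut.
    have E' (p m1 m2' : R * R) : p - m1 + m2' - p = m2' - m1.
      by apply: pairE; rewrite /=; ring.
    by rewrite -E -qS /P0 E'.
  have := dot_perp T'; rewrite dotC => ort.
  have h1 : 0 < dot (perp T') nut.
    have := H1 (perp T') nut; rewrite -perpB norm_perp => /(_ q1).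
    rewrite /nut /nu -perpB norm_perp => /(_ v1).
    by rewrite ltr_norml => /andP[+ _]; rewrite ltrBrDr addNr.
  have h2 : dot (perp T') w < 0.
    have := H2 (perp T') w; rewrite -perpB norm_perp subrr normr0 => /(_ q2 e20).
    rewrite pbE ltr_norml => /andP[_]; move: bw; rewrite pbE; clear; lra.
  have : dot (perp T') ((t - ta) *: T') = 0 by rewrite dotZr ort mulr0.
  rewrite eq dotBr [dot _ (r' *: _)]dotZr [dot _ (s *: _)]dotZr.
  have h3 : 0 < s * dot (perp T') nut by rewrite mulr_gt0.
  have h4 : r' * dot (perp T') w <= 0 by rewrite mulr_ge0_le0// ltW.
  by move: h3 h4; clear; lra.
(* On the next arc the crossing point is y + t a' with t >= 0, and each alternative of [H3] gives t
   a' the wrong sign. *)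
move=> [ii t'1]; rewrite ii -/j in qS; rewrite t'1 in tt'.
have j00 : `|0 - 0 : R| < dl by rewrite subrr normr0.
have [a' a'a Ea] := secant e40 Hj Hj1 j00 tt'.
have [T' T'T Eb] := secant e40 Hi Hi1 i11 tadl.
have [q1 q2 q3] := e4_ _ T'T; have [v1 v2 _] := e4_ _ nuT; have [_ _ a3] := e4_ _ a'a.
have y0 : y = S j 0 by exact: (pd_next pd i).
rewrite subr0 in Ea.
have t_ge0 : 0 <= t by move: t01; rewrite in_itv /= => /andP[].
have eq : t *: a' = (ta - 1) *: T' - s *: nut + r' *: w.
  have E (p m1 m2' y1 : R * R) : p - m1 + m2' - y1 = p - y1 - m1 + m2'.
    by apply: pairE; rewrite /=; ring.
  by rewrite -Ea -Eb -y0 -qS E.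
have bw' : dot (perp T') w < - (D / 2).
  have := H2 (perp T') w; rewrite -perpB norm_perp subrr normr0 => /(_ q2 e20).
  rewrite ltr_norml => /andP[_]; rewrite /D pbE; clear; lra.
have h1 : 0 < dot (perp T') nut.
  have := H1 (perp T') nut; rewrite -perpB norm_perp => /(_ q1).
  rewrite /nut /nu -perpB norm_perp => /(_ v1).
  by rewrite ltr_norml => /andP[+ _]; rewrite ltrBrDr addNr.
have D0 : 0 < D by [].
case: (H3 T' a' q3 a3) => h.
  have : t * dot (perp a') w <= 0 by rewrite mulr_ge0_le0// ltW.
  have E1 c1 (m1 : R * R) : c1 * dot (perp m1) w = dot (perp (c1 *: m1)) w by rewrite /dot /= /GRing.scale /=; ring.
  rewrite E1 eq.
  have -> : dot (perp ((ta - 1) *: T' - s *: nut + r' *: w)) w =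
     (1 - ta) * - dot (perp T') w - s * dot (perp nut) w.
    have E2 (m1 m2' m3 : R * R) (c1 c2 c3 : R) :
        dot (perp (c1 *: m1 - c2 *: m2' + c3 *: m3)) m3 =
        c1 * dot (perp m1) m3 - c2 * dot (perp m2') m3 by rewrite /dot /= /GRing.scale /=; ring.
    by rewrite E2; ring.
  have z1 : (1 - ta) * (D / 2) < (1 - ta) * - dot (perp T') w.
    by rewrite ltr_pM2l// ltrNr.
  have z2 : `|s * dot (perp nut) w| <= (1 - ta) * (D / 2).
    rewrite normrM gtr0_norm//; apply: (@le_trans _ _ (Y * (`|dot (perp nut) w| + 1))).
      by apply: ler_pM => //; [exact: ltW|rewrite lerDl].
    by rewrite /Y divfK ?gt_eqF.
  move: z1 z2; rewrite ler_norml => z1 /andP[_ z2] z3.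
  by move: z1 z2 z3; clear; lra.
have : 0 <= t * dot (perp T') a' by rewrite mulr_ge0// ltW.
rewrite -[t * _]dotZr eq.
have := dot_perp T'; rewrite dotC => ort.
have E1 (c1 c2 c3 : R) (m1 m2' m3 : R * R) m' : dot m' (c1 *: m1 - c2 *: m2' + c3 *: m3) =
  c1 * dot m' m1 - c2 * dot m' m2' + c3 * dot m' m3 by rewrite !dot_lin.
rewrite E1 ort mulr0 sub0r.
have h3 : 0 < s * dot (perp T') nut by rewrite mulr_gt0.
have h4 : r' * dot (perp T') w <= 0.
  by rewrite mulr_ge0_le0// ltW//; move: bw' D0; clear; lra.
by move: h3 h4; clear; lra.
Qed.

Lemma unit_dot (R : realType) (v : R * R) : v != 0 -> dot (unit_vec v) (unit_vec v) = 1.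
Proof.
move=> v0; have e0 := enorm_gt0 v0.
by rewrite /unit_vec dotZl dotZr -enorm_sqr; field; rewrite gt_eqF.
Qed.

Lemma rotate_dot (R : realType) (theta : R) (v : R * R) :
  dot (perp v) (rotate theta v) = sin theta * dot v v.
Proof. by rewrite /dot /rotate /=; ring. Qed.

Lemma angle_ge_pi (R : realType) (theta : R) : 0 < theta < 2 * pi -> sin theta <= 0 ->
  pi <= theta /\ (sin theta = 0 -> theta = pi).
Proof.
move=> /andP[th0 th2] s0.
have pth : pi <= theta.
  rewrite leNgt; apply/negP => h.
  by move: s0; rewrite leNgt sin_gt0_pi// th0.
split=> // sE; apply/eqP; rewrite eq_le pth andbT leNgt; apply/negP => h.
have : 0 < sin (theta - pi).
  by apply: sin_gt0_pi; rewrite subr_gt0 h /= ltrBlDr; move: th2; clear; lra.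
by rewrite sinB sinpi cospi sE mul0r mulr0 subr0 ltxx.
Qed.

(* If perp b . a < 0, or if a and b are opposite and n points to the wrong side of
   b, some w close to n or b contradicts corner_no_direction. *)
Lemma corner_tangents (R : realType) (r : regularity R) (K U : set (R * R))
    (k : R -> R * R) (N : nat) (S : 'I_N -> R -> R * R) (nxt : {perm 'I_N})
    (x : R * R) (t0 : R) (i : 'I_N) (n := conormal k t0)
    (a := vel (S (nxt i)) 0) (b := - vel (S i) 1) :
  admissible r -> gauge_body r K k -> piecewise_domain U S nxt r -> U x ->
  closest U K x (S i 1) -> x - S i 1 = dK U K x *: k t0 ->
  dot n a <= 0 -> dot n b <= 0 ->
  [/\ reentrant_corner U S nxt (S i 1),
      dot n b = 0 -> 0 < dot n (nu (S i) 1),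
      dot n a = 0 -> 0 < dot n (nu (S (nxt i)) 0)
    & dot n a = 0 -> dot n b = 0 -> exists2 rho, 0 < rho & a = (- rho) *: b].
Proof.
move=> ar gb pd Ux cxy xy na nb.
have NoW w := corner_no_direction (w := w) ar gb pd Ux cxy xy.
have a0 : a != 0 by apply/eqP; exact: (pd_regular pd in01_0).
have b0 : b != 0 by rewrite oppr_eq0; apply/eqP; exact: (pd_regular pd in01_1).
have n0 : n != 0 by exact: (conormal_neq0 ar gb).
have nn := dot_gt0 n0; have aa := dot_gt0 a0; have bb := dot_gt0 b0.
(* With theta the opening angle, cr = - |a| |b| sin theta, so cr >= 0 makes the corner reentrant;
   the sign of [g] tells on which side of [b] the conormal points. *)
pose cr := dot (perp b) a; pose g := dot (perp b) n.
have nE v : v != 0 -> dot n v = 0 -> n = (dot (perp v) n / dot v v) *: perp v.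
  move=> v0 nv; rewrite {1}(perp_decomp n v0) [dot v n]dotC nv mul0r scale0r add0r //.
have g0 v : v != 0 -> dot n v = 0 -> dot (perp v) n != 0.
  by move=> v0 nv; apply/eqP => E; move: n0; rewrite (nE v v0 nv) E mul0r scale0r eqxx.
have nb_na : dot n b = 0 -> dot n a = g / dot b b * cr.
  by move=> h; rewrite {1}(nE b b0 h) dotZl.
have cr_ge0 : 0 <= cr.
  rewrite leNgt; apply/negP => cr0.
  have [nb0|nb0] := eqVneq (dot n b) 0.
    have gpos : 0 < g.
      rewrite lt_def; apply/andP; split; first exact: g0.
      have : g / dot b b * cr <= 0 by rewrite -nb_na.
      rewrite nmulr_lle0// pmulr_lge0 ?invr_gt0//.
    by apply: (NoW n) => //; right.
  have nbn : dot n b < 0 by rewrite lt_def eq_sym nb0.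
  (* The direction s perp b - b leans slightly from - b towards perp b; [s] is small enough to keep
     its pairing with [n] positive. *)
  pose s := - dot n b / (2 * (`|g| + 1)).
  have g1 : 0 < `|g| + 1 by rewrite ltr_wpDl.
  have s0 : 0 < s by rewrite divr_gt0 ?oppr_gt0// mulr_gt0.
  have sg : `|s * g| <= - dot n b / 2.
    rewrite normrM gtr0_norm//; apply: (@le_trans _ _ (s * (`|g| + 1))).
      by rewrite ler_pM2l// lerDl.
    by rewrite /s le_eqVlt; apply/orP; left; apply/eqP; field; rewrite gt_eqF.
  apply: (NoW (s *: perp b - b)); last by right.
    rewrite dotBr dotZr dot_perp_perp [dot (perp b) b]dotC dot_perp subr0.
    exact: mulr_gt0.
  rewrite dotBr dotZr [dot _ (perp b)]dotC -/g.
  by move: sg nbn; rewrite ler_norml; clear; lra.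
have [theta [th1 th2 th3]] := pd_angle pd i.
have e_a := enorm_gt0 a0; have e_b := enorm_gt0 b0.
have sinE : sin theta = - cr / (enorm a * enorm b).
  have := rotate_dot theta (unit_vec a); rewrite -th2 unit_dot// mulr1 => <-.
  rewrite /unit_vec /cr.
  have E (u v : R) (p q : R * R) : dot (perp (u *: p)) (v *: q) = - (dot (perp q) p) * (u * v).
    by rewrite /dot /= /GRing.scale /=; ring.
  by rewrite E invfM.
have sin_le0 : sin theta <= 0.
  by rewrite sinE mulNr oppr_le0 divr_ge0// mulr_ge0// ltW.
have [pith thE] := angle_ge_pi th1 sin_le0.
have cr0_case : cr = 0 -> exists2 rho, 0 < rho & a = (- rho) *: b.
  move=> cr0; have {}thE : theta = pi by apply: thE; rewrite sinE cr0 oppr0 mul0r.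
  exists (enorm a / enorm b); first exact: divr_gt0.
  have : unit_vec b = - unit_vec a.
    rewrite th2 thE; apply: pairE; rewrite /rotate /= cospi sinpi; ring.
  rewrite /unit_vec => E.
  have aE : a = enorm a *: ((enorm a)^-1 *: a) by rewrite scalerA divff ?scale1r// gt_eqF.
  by rewrite [LHS]aE -[(enorm a)^-1 *: a]opprK -E scalerN scalerA scaleNr.
have both : dot n a = 0 -> dot n b = 0 -> cr = 0.
  move=> na0 nb0; have := nb_na nb0; rewrite na0 => /esym/eqP.
  rewrite mulf_eq0 => /orP[|/eqP//]; rewrite mulf_eq0 invr_eq0 (gt_eqF bb) orbF => h.
  by have := g0 b b0 nb0; rewrite -/g h.
(* For opposite tangents the angle leaves the side of the conormal undecided; on the wrong side, w =
   n would be an admissible direction. *)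
have g_neg : cr = 0 -> dot n b = 0 -> g < 0.
  move=> cr0 nb0; have [rho rho0 aE] := cr0_case cr0.
  rewrite ltNge; apply/negP => gge.
  have gpos : 0 < g by rewrite lt_def gge g0.
  apply: (NoW n) => //; left; rewrite -/a aE.
  have -> : dot (perp ((- rho) *: b)) n = - (rho * g) by rewrite /g /dot /= /GRing.scale /=; clear; ring.
  by rewrite oppr_lt0 mulr_gt0.
have nui : nu (S i) 1 = - perp b by rewrite /nu /b; apply: pairE; rewrite /= ?opprK.
split.
- by exists i, theta.
- move=> nb0; rewrite nui dotNr oppr_gt0 dotC -/g.
  have [cr0|cr0] := eqVneq cr 0; first exact: g_neg.
  have crp : 0 < cr by rewrite lt_def cr0.
  rewrite lt_def eq_sym g0//=.
  have : g / dot b b * cr <= 0 by rewrite -nb_na.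
  by rewrite pmulr_lle0// pmulr_lle0 ?invr_gt0.
- move=> na0; rewrite /nu dotC -/a.
  have [cr0|cr0] := eqVneq cr 0.
    have [rho rho0 aE] := cr0_case cr0.
    have nb0 : dot n b = 0.
      have := na0; rewrite aE dotZr => /eqP; rewrite mulf_eq0 oppr_eq0 (gt_eqF rho0) => /eqP //.
    have -> : dot (perp a) n = rho * - g by rewrite aE /g /dot /= /GRing.scale /=; ring.
    by rewrite mulr_gt0// oppr_gt0 g_neg.
  have crp : 0 < cr by rewrite lt_def cr0.
  rewrite lt_def g0//=.
  have : dot n b = dot (perp a) n / dot a a * - cr.
    rewrite {1}(nE a a0 na0) dotZl; congr (_ * _).
    by rewrite /cr /dot /=; ring.
  move=> E; have : dot (perp a) n / dot a a * - cr <= 0 by rewrite -E.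
  by rewrite nmulr_lle0 ?oppr_lt0// pmulr_lge0 ?invr_gt0.
- by move=> na0 nb0; apply: cr0_case; exact: both.
Qed.

(** At an interior parameter [first_order] applies in both directions. *)
Lemma closest_interior (R : realType) (r : regularity R) (K U : set (R * R))
    (k : R -> R * R) (N : nat) (S : 'I_N -> R -> R * R) (nxt : {perm 'I_N})
    (z : R * R) (th t : R) (i : 'I_N) :
  admissible r -> gauge_body r K k -> piecewise_domain U S nxt r -> U z ->
  closest U K z (S i t) -> z - S i t = dK U K z *: k th -> t \in `]0, 1[ ->
  dot (conormal k th) (vel (S i) t) = 0.
Proof.
move=> ar gb pd Uz cz zE ti; have t01 := itv_oo_cc ti.
have Bc := boundary_compact ar pd; have Bn := boundary_nonempty pd Uz.
have l0 : 0 < dK U K z := dK_gt0 ar gb (pd_open pd) Bc Bn Uz.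
have [d d0 C2] := arc_C2 ar pd i t01.
pose m := Num.min t (1 - t).
have m0 : 0 < m by move: ti; rewrite in_itv /= lt_min subr_gt0.
have inm e s : `|e| <= 1 -> 0 < s -> s < m -> boundary U (S i (t + e * s)).
  move=> e1 s0; rewrite lt_min => /andP[s1 s2]; apply: (arc_boundary pd).
  have es : `|e * s| <= s by rewrite normrM (gtr0_norm s0) ler_piMl// ltW.
  rewrite in_itv /=; apply/andP; move: es s1 s2; rewrite ler_norml => /andP[].
  by move: (e * s) => a; clear; split; lra.
have f e : `|e| <= 1 -> e * dot (conormal k th) (vel (S i) t) <= 0.
  move=> e1; apply: (first_order ar gb l0 cz zE d0 C2 erefl e1 m0) => s s0 sm.
  exact: inm.
have n1 : `|1 : R| <= 1 by rewrite normr1.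
have n2 : `|-1 : R| <= 1 by rewrite normrN normr1.
have := f _ n1; have := f _ n2; rewrite mul1r mulN1r oppr_le0.
by move=> h1 h2; apply: le_anti; rewrite h1 h2.
Qed.

(* Near a point y of the boundary nearest to x, the boundary consists of two
   legs s |-> S i (t + e s) and s |-> S j (t' + e' s), s >= 0. At an interior
   point of an arc they are its two halves. *)
Record legs_at (R : realType) (U : set (R * R)) (N : nat) (S : 'I_N -> R -> R * R)
    (nxt : {perm 'I_N}) (y n : R * R) (i j : 'I_N) (t t' e e' d : R) : Prop := {
  la_d : 0 < d;
  la_e : `|e| = 1;
  la_e' : `|e'| = 1;
  la_t : t \in `[0, 1];
  la_t' : t' \in `[0, 1];
  la_y : S i t = y;
  la_y' : S j t' = y;
  la_in : forall s, 0 < s -> s < d -> t + e * s \in `]0, 1[;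
  la_in' : forall s, 0 < s -> s < d -> t' + e' * s \in `]0, 1[;
  la_cover : forall dl, 0 < dl -> exists2 m, 0 < m & forall q, boundary U q -> `|q - y| < m ->
    exists s, [/\ 0 <= s, s < dl & q = S i (t + e * s) \/ q = S j (t' + e' * s)];
  la_fo : e * dot n (vel (S i) t) <= 0;
  la_fo' : e' * dot n (vel (S j) t') <= 0;
  la_nu : dot n (vel (S i) t) = 0 -> 0 < dot n (nu (S i) t);
  la_nu' : dot n (vel (S j) t') = 0 -> 0 < dot n (nu (S j) t');
  la_opp : dot n (vel (S i) t) = 0 -> dot n (vel (S j) t') = 0 ->
    exists2 rho, 0 < rho & e' *: vel (S j) t' = (- (rho * e)) *: vel (S i) t;
  la_ba : (t \in `]0, 1[) \/ reentrant_corner U S nxt (S i t);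
  la_ba' : (t' \in `]0, 1[) \/ reentrant_corner U S nxt (S j t');
  la_reent : reentrant_corner U S nxt y \/ dot n (vel (S i) t) = 0 /\ i = j /\ t = t';
  la_uniq : forall i1 t1, t1 \in `[0, 1] -> S i1 t1 = y ->
    (i1 = i /\ t1 = t) \/ (i1 = j /\ t1 = t')
}.

(** At an interior point the legs have e = -1 and e' = 1 on one arc. At a corner, arc i runs
    backwards from 1 and arc [nxt i] forwards from 0, and [corner_tangents] supplies the side
    conditions. *)
Lemma closest_legs (R : realType) (r : regularity R) (K U : set (R * R))
    (k : R -> R * R) (N : nat) (S : 'I_N -> R -> R * R) (nxt : {perm 'I_N})
    (x y : R * R) (t0 : R) :
  admissible r -> gauge_body r K k -> piecewise_domain U S nxt r -> U x ->
  closest U K x y -> x - y = dK U K x *: k t0 ->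
  exists i j t t' e e' d, legs_at U S nxt y (conormal k t0) i j t t' e e' d.
Proof.
move=> ar gb pd Ux cxy xy.
have Bc := boundary_compact ar pd; have Bn := boundary_nonempty pd Ux.
have l0 : 0 < dK U K x := dK_gt0 ar gb (pd_open pd) Bc Bn Ux.
set n := conormal k t0.
have fo i t e dl : t \in `[0, 1] -> S i t = y -> `|e| <= 1 -> 0 < dl ->
    (forall s, 0 < s -> s < dl -> t + e * s \in `]0, 1[) -> e * dot n (vel (S i) t) <= 0.
  move=> t01 Sy e1 dl0 H; have [d d0 C2] := arc_C2 ar pd i t01.
  apply: (first_order ar gb l0 cxy xy d0 C2 Sy e1 dl0) => s s0 sd.
  by apply: (arc_boundary pd); apply: itv_oo_cc; exact: H.
have [By _] := cxy; have [i [t [t01 yE]]] := boundary_arc pd By.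
have n1 : `|-1 : R| = 1 by rewrite normrN normr1.
have [ti|tn] := boolP (t \in `]0, 1[).
  pose d := Num.min t (1 - t).
  have d0 : 0 < d by move: ti; rewrite in_itv /= lt_min subr_gt0.
  have inm s : 0 < s -> s < d -> t + -1 * s \in `]0, 1[.
    rewrite lt_min => s0 /andP[s1 s2]; rewrite in_itv /=; apply/andP.
    by move: s0 s1 s2; clear; split; lra.
  have inp s : 0 < s -> s < d -> t + 1 * s \in `]0, 1[.
    move: ti; rewrite in_itv /= => /andP[u0 u1].
    rewrite lt_min => s0 /andP[s1 s2]; rewrite in_itv /=; apply/andP.
    by move: s0 s1 s2 u0 u1; clear; split; lra.
  have Sy : S i t = y by rewrite yE.
  have cyi : closest U K x (S i t) by rewrite Sy.
  have f0 : dot n (vel (S i) t) = 0.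
    by apply: (closest_interior ar gb pd Ux cyi _ ti); rewrite Sy.
  have f1 : -1 * dot n (vel (S i) t) <= 0 by rewrite f0 mulr0.
  have f2 : 1 * dot n (vel (S i) t) <= 0 by rewrite f0 mulr0.
  (* If the pairing were negative, short steps along - nu would stay in the gauge ball, hence in U,
     against [nu_into]. It is not zero, as [n] is nonzero and orthogonal to the tangent. *)
  have nupos : 0 < dot n (nu (S i) t).
    have T0 : vel (S i) t != 0 by apply/eqP; exact: (pd_regular pd t01).
    have nn := conormal_neq0 ar gb t0.
    rewrite lt_def; apply/andP; split.
      apply/eqP => E; move: nn; rewrite -/n (perp_decomp n T0) [dot _ n]dotC f0.
      by rewrite [dot (perp _) n]dotC E !mul0r !scale0r addr0 eqxx.
    rewrite leNgt; apply/negP => neg.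
    have [C [dg [C0 dg0 HG]]] := gauge_upper ar gb t0 l0.
    have [ds ds0 Hs] := right_nbhs0 (pd_inward pd i ti).
    set v := nu (S i) t in neg Hs.
    have v1 : 0 < `|v| + 1 by rewrite ltr_wpDl.
    have D0 : 0 < C * (`|v| + 1) ^+ 2 by apply: mulr_gt0 => //; exact: exprn_gt0.
    pose s := Num.min (ds / 2) (Num.min (dg / (`|v| + 1) / 2) (- dot n v / (C * (`|v| + 1) ^+ 2) / 2)).
    have s0 : 0 < s by rewrite !lt_min !divr_gt0// oppr_gt0.
    have half (u : R) : 0 < u -> u / 2 < u by move=> u0; rewrite ltr_pdivrMr// ltr_pMr// ltr1n.
    have sds : s < ds by rewrite gt_min half.
    have sdg : s < dg / (`|v| + 1) by rewrite !gt_min half ?orbT// divr_gt0.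
    have sX : s < - dot n v / (C * (`|v| + 1) ^+ 2).
      by rewrite !gt_min half ?orbT// divr_gt0// oppr_gt0.
    have [_ nUs] := Hs s s0 sds; apply: nUs.
    apply: (dK_ball ar gb (pd_open pd) Ux).
    have -> : x - (S i t - s *: v) = dK U K x *: k t0 + s *: v.
      by rewrite -xy -yE opprB addrCA addrC.
    have z0 : `|t0 - t0| < dg by rewrite subrr normr0.
    have sv : `|s *: v| <= s * (`|v| + 1) by rewrite normrZ gtr0_norm// ler_pM2l// lerDl.
    apply: le_lt_trans (HG t0 _ _ z0 (lexx _) _) _.
      by apply: le_lt_trans sv _; rewrite -ltr_pdivlMr.
    rewrite -addrA gtrDl dotZr -/n.
    apply: (@le_lt_trans _ _ (s * dot n v + C * (s * (`|v| + 1)) ^+ 2)).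
      by rewrite lerD2l ler_pM2l// lerXn2r ?nnegrE// mulr_ge0// ltW.
    have -> : s * dot n v + C * (s * (`|v| + 1)) ^+ 2 = s * (dot n v + s * (C * (`|v| + 1) ^+ 2)) by ring.
    by rewrite pmulr_rlt0// -ltrBrDl sub0r -ltr_pdivlMr.
  exists i, i, t, t, (-1), 1, d; split => //.
  - by rewrite normr1.
  - move=> dl dl0; have [m m0 H] := arcs_near ar pd y dl0.
    exists m => // q Bq qy; have [i' [u [u' [u01 u'01 Su' uu qE]]]] := H q Bq qy.
    have [ii tt] := arc_interior_unique pd ti u'01 (etrans Su' (esym Sy)).
    rewrite ii in qE; rewrite tt in uu.
    have [ut|tu] := leP u t.
      exists (t - u); split; first by rewrite subr_ge0.
        by move: uu; rewrite distrC ger0_norm// subr_ge0.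
      by left; rewrite mulN1r opprB subrKC.
    exists (u - t); split; first by rewrite subr_ge0 ltW.
      by move: uu; rewrite ger0_norm// subr_ge0 ltW.
    by right; rewrite mul1r subrKC.
  - by move=> _ _; exists 1; rewrite // mul1r opprK.
  - by left.
  - by left.
  - by right.
  - move=> i1 t1 t101 E; left.
    exact: (arc_interior_unique pd ti t101 (etrans E (esym Sy))).
(* An initial point is the endpoint of the predecessor under [nxt], so every corner is described
   from its incoming arc. *)
have [i' yi'] : exists i', S i' 1 = y.
  move: t01 tn; rewrite !in_itv /= => /andP[u0 u1] h.
  have [t1|t1] := eqVneq t 1; first by exists i; rewrite yE t1.
  have t_0 : t = 0.
    apply/eqP; rewrite eq_le u0 andbT leNgt; apply/negP => tpos.
    by move: h; rewrite tpos lt_def eq_sym t1 u1.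
  by exists (nxt^-1 i)%g; rewrite (pd_next pd) permKV yE t_0.
move: i' yi' => {i t t01 yE tn} i yE; set j := nxt i.
have yj : S j 0 = y by rewrite -(pd_next pd).
have inm s : 0 < s -> s < 1 -> 1 + -1 * s \in `]0 : R, 1[.
  by move=> s0 s1; rewrite in_itv /=; apply/andP; move: s0 s1; clear; split; lra.
have inp s : 0 < s -> s < 1 -> 0 + 1 * s \in `]0 : R, 1[.
  by move=> s0 s1; rewrite in_itv /=; apply/andP; move: s0 s1; clear; split; lra.
have f1 := fo i 1 (-1) 1 in01_1 yE (eq_ind_r (fun u => u <= 1) (lexx 1) n1) ltr01 inm.
have f2 := fo j 0 1 1 in01_0 yj (eq_ind_r (fun u => u <= 1) (lexx 1) (normr1 R)) ltr01 inp.
rewrite -yE in cxy xy.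
have h1 : dot n (vel (S j) 0) <= 0 by move: f2; rewrite mul1r.
have h2 : dot n (- vel (S i) 1) <= 0 by move: f1; rewrite mulN1r dotNr.
have [re nui nuj opp] := corner_tangents ar gb pd Ux cxy xy h1 h2.
exists i, j, 1, 0, (-1), 1, 1; split => //.
- by rewrite normr1.
- exact: in01_1.
- exact: in01_0.
- move=> dl dl0; have [m m0 H] := arcs_near ar pd y dl0.
  exists m => // q Bq qy; have [i' [u [u' [u01 u'01 Su' uu qE]]]] := H q Bq qy.
  have [[ii tt]|[ii tt]] := arc_corner_unique pd u'01 (etrans Su' (esym yE)).
    rewrite ii in qE; rewrite tt in uu; move: u01; rewrite in_itv /= => /andP[u0 u1].
    exists (1 - u); split; first by rewrite subr_ge0.
      by move: uu; rewrite distrC ger0_norm// subr_ge0.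
    by left; rewrite mulN1r opprB subrKC.
  rewrite ii in qE; rewrite tt in uu; move: u01; rewrite in_itv /= => /andP[u0 u1].
  exists u; split => //; first by move: uu; rewrite subr0 ger0_norm.
  by right; rewrite mul1r add0r.
- by move=> h; apply: nui; rewrite dotNr h oppr0.
- move=> hi hj; have [|rho rho0 aE] := opp hj; first by rewrite dotNr hi oppr0.
  by exists rho => //; rewrite scale1r aE mulrN1 opprK scalerN scaleNr opprK.
- by right; exact: re.
- by right; rewrite yj -yE; exact: re.
- by left; rewrite -yE.
- move=> i1 t1 t101 E.
  exact: (arc_corner_unique pd t101 (etrans E (esym yE))).
Qed.

(** * K-curvature *)

Lemma vel_nu (R : realType) (c c2 : R -> R * R) (t : R) : has_vel (vel c) c2 t ->
  vel (nu c) t = perp (c2 t).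
Proof.
move=> [h1 h2]; apply: (@has_vel_velE _ (nu c) (fun s => perp (c2 s))); split; last exact: h1.
by have := is_deriveN h2.
Qed.

Lemma curvE (R : realType) (c : R -> R * R) (t : R) : has_vel (vel c) (vel (vel c)) t ->
  curv c t = dot (vel (vel c) t) (nu c t) / enorm (nu c t) ^+ 3.
Proof.
move=> h; rewrite /curv.
rewrite (vel_nu h).
by move: (vel (vel c) t) (nu c t) => u v; rewrite dot_perp_perp.
Qed.

Lemma derive1_periodic (R : realType) (f : R -> R) (m t : R) :
  (forall s, f (s + m) = f s) -> derive1 f (t + m) = derive1 f t.
Proof.
move=> H; rewrite /derive1.
suff -> : (fun h => h^-1 *: (f (h + (t + m)) - f (t + m))) = (fun h => h^-1 *: (f (h + t) - f t)) by [].
by apply/funext => h; rewrite addrA !H.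
Qed.

Lemma vel_periodic (R : realType) (c : R -> R * R) (m t : R) :
  (forall s, c (s + m) = c s) -> vel c (t + m) = vel c t.
Proof. by move=> H; apply: pairE; apply: derive1_periodic => s; rewrite H. Qed.

Lemma unit_vec_scale (R : realType) (l : R) (v : R * R) : 0 < l -> v != 0 ->
  unit_vec (l *: v) = unit_vec v.
Proof.
move=> l0 v0; have e0 := enorm_gt0 v0.
have E : enorm (l *: v) = l * enorm v.
  rewrite /enorm dotZl dotZr mulrA sqrtrM ?mulr_ge0 ?ltW//.
  by rewrite -expr2 sqrtr_sqr gtr0_norm.
rewrite /unit_vec E scalerA; congr (_ *: _); field.
by rewrite !gt_eqF.
Qed.

Section FlatNormals.
Context {R : realType} (r : regularity R) (K : set (R * R)) (k : R -> R * R).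
Hypotheses (ar : admissible r) (gb : gauge_body r K k).
Implicit Types (t s : R) (v w : R * R).

Local Notation n := (conormal k).
Local Notation A := (fun t => - dot (n t) (vel (vel k) t)).

Lemma gb_period (m : int) t : k (t + m%:~R) = k t.
Proof.
have P (j : nat) s : k (s + j%:R) = k s.
  elim: j s => [|j IH] s; first by rewrite addr0.
  by rewrite -natr1 addrA (gb_periodic gb) IH.
case: m => j; first exact: P.
by rewrite NegzE mulrNz -(P j.+1 (t - _)) subrK.
Qed.

(** Injectivity is given on [0, 1) only, so both parameters are first reduced by their integer
    parts. *)
Lemma gb_eq_period t s : k t = k s -> exists m : int, t = s + m%:~R.
Proof.
move=> E; have fl (u : R) : u - (Num.floor u)%:~R \in `[0, 1[.
  rewrite in_itv /= subr_ge0 Num.Theory.floor_le_tmp ltrBlDl.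
  by have := Num.Theory.floorD1_gt u; rewrite intrD.
exists (Num.floor t - Num.floor s).
have : t - (Num.floor t)%:~R = s - (Num.floor s)%:~R.
  apply: (gb_injective gb) => //.
  by rewrite -!mulrNz !gb_period.
by rewrite intrB => h; rewrite addrCA addrC -h; ring.
Qed.

Lemma curv_k t : curv k t = A t * (- dot (nu k t) (k t) / enorm (nu k t) ^+ 3).
Proof.
rewrite (curvE (gb_acc ar gb t)) {1}(conormal_nu ar gb t) dotZr [dot _ (n t)]dotC.
by rewrite /=; ring.
Qed.

Lemma curv_k_eq0 t : (curv k t == 0) = (A t == 0).
Proof.
rewrite curv_k mulf_eq0 orbC.
have -> : (- dot (nu k t) (k t) / enorm (nu k t) ^+ 3 == 0) = false.
  apply: gt_eqF; apply: divr_gt0; first by rewrite oppr_gt0 (gb_nu_pos ar gb).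
  by apply: exprn_gt0; apply: enorm_gt0; exact: (gb_nu_neq0 gb).
by [].
Qed.

Lemma unit_conormal t : - unit_vec (nu k t) = unit_vec (n t).
Proof.
have ne := conormal_neq0 ar gb t; have neg := gb_nu_pos ar gb t.
have nn : - n t != 0 by rewrite oppr_eq0.
have -> : nu k t = (- dot (nu k t) (k t)) *: - n t.
  by rewrite scalerN scaleNr opprK; exact: (conormal_nu ar gb).
rewrite unit_vec_scale ?oppr_gt0//.
by rewrite /unit_vec /enorm dotNl dotNr opprK scalerN opprK.
Qed.

(** [k t] and [k s] maximize the same functional on K, so they coincide by strict convexity, and the
    parameters agree up to a period. *)
Lemma conormal_proportional t s l : 0 < l -> n t = l *: n s -> exists m : int, t = s + m%:~R.
Proof.
move=> l0 E; apply: gb_eq_period.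
have h1 : l * dot (n s) (k t) = 1 by rewrite -dotZl -E (conormal_k ar gb).
have h2 : dot (n t) (k s) = l by rewrite E dotZl (conormal_k ar gb) mulr1.
have l1 : l <= 1 by rewrite -h2; apply: (conormal_le1 ar gb); exact: (gb_mem gb).
have h3 : dot (n s) (k t) <= 1 by apply: (conormal_le1 ar gb); exact: (gb_mem gb).
apply: (conormal_eq1 ar gb) => //; first exact: (gb_mem gb).
apply/eqP; rewrite eq_le h3 /=.
by rewrite -h1 ler_piMl// ltW// -(pmulr_rgt0 _ l0) h1.
Qed.

(** A flat normal is recorded at a parameter [s] that may differ from [t] by a period, so the
    vanishing curvature is carried over by periodicity. *)
Lemma flat_conormal t v c : 0 < c -> v = c *: n t ->
  (exists2 mu, flat_normals k mu & same_direction v mu) <-> A t = 0.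
Proof.
move=> c0 vE; have ne := conormal_neq0 ar gb t; split; last first.
  move=> A0; exists (unit_vec (n t)).
    by exists t; [apply/eqP; rewrite curv_k_eq0 A0|exact: unit_conormal].
  exists (c * enorm (n t)); first by rewrite mulr_gt0// enorm_gt0.
  by rewrite vE /unit_vec [RHS]scalerA mulfK// gt_eqF// enorm_gt0.
move=> [_ [s cs <-] [l l0 E]]; rewrite /= in cs.
have nes := conormal_neq0 ar gb s.
have E2 : n t = (c^-1 * (l * (enorm (n s))^-1)) *: n s.
  have -> : n t = c^-1 *: v by rewrite vE scalerA mulVf ?scale1r// gt_eqF.
  by rewrite E unit_conormal /unit_vec !scalerA mulrA.
have [m tE] := conormal_proportional (mulr_gt0 (etrans (invr_gt0 _) c0) (divr_gt0 l0 (enorm_gt0 nes))) E2.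
apply/eqP; rewrite -curv_k_eq0 -cs tE; apply/eqP.
have V u : vel k (u + m%:~R) = vel k u by apply: vel_periodic; exact: gb_period.
have W u : nu k (u + m%:~R) = nu k u by rewrite /nu V.
by rewrite /curv (vel_periodic _ W) !W.
Qed.

(** The functional [v] is maximized over the boundary of K; at the contact point the tangent is
    orthogonal to [v]. *)
Lemma conormal_ex v : v != 0 -> exists t c, 0 < c /\ v = c *: n t.
Proof.
move=> v0; pose f s := dot v (k s).
have fd s : is_derive s 1 f (dot v (vel k s)) by apply: has_vel_dot; exact: gb_vel ar gb s.
have fc : continuous f by move=> s; exact: is_derive_continuous (fd s).
have [t _ tmax] := EVT_max ler01 (continuous_subspaceT fc).
(* A maximum over one period is a maximum over the line, so the derivative vanishes even if [t] is
   an end of [0, 1]. *)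
have {}tmax s : f s <= f t.
  have -> : f s = f (s - (Num.floor s)%:~R) by rewrite /f -mulrNz gb_period.
  apply: tmax; rewrite in_itv /= subr_ge0 Num.Theory.floor_le_tmp lerBlDl.
  by apply: ltW; have := Num.Theory.floorD1_gt s; rewrite intrD.
have f0 : dot v (vel k t) = 0.
  have dv s : s \in `]t - 1, t + 1[ -> derivable f s 1 by move=> _; have [] := fd s.
  have tin : t \in `]t - 1, t + 1[ by rewrite in_itv /= ltrDl ltrBlDr ltrDl ltr01.
  have lt_ : t - 1 <= t + 1 by lra.
  have [_ <-] := fd t.
  by have [_ ] := derive1_at_max lt_ dv tin (fun s _ => tmax s).
exists t, (dot v (k t)); split; last exact: (orth_conormal ar gb).
have [gv [s sE]] := gauge_attained gb v0.
apply: lt_le_trans (tmax s); rewrite /f -(pmulr_rgt0 _ gv) -dotZr -sE.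
exact: dot_gt0.
Qed.

(** Here [be] is negative: nu of the curve points along the outward conormal, nu of [k] into K.
    [hess_gp] contributes the factor 1 / (l A), and the remaining lengths combine to be^2. *)
Lemma K_curvature_value c c2 t t0 be l (kap : R) : has_vel (vel c) c2 t ->
  vel c t = be *: vel k t0 -> 0 < l -> nu c t = l *: n t0 -> 0 < A t0 ->
  (K_curvature K (flat_normals k) c t kap <->
    kap = dot (n t0) (c2 t) / (be ^+ 2 * A t0)).
Proof.
move=> hv vE l0 nE A0.
have k0 : vel k t0 != 0 by apply/eqP; exact: (gb_regular gb).
have kk := dot_gt0 k0.
have kap0 := gb_nu_pos ar gb t0.
have nuE : nu c t = (be * dot (nu k t0) (k t0)) *: n t0.
  rewrite -scalerA -(conormal_nu ar gb) /nu vE.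
  by apply: pairE; rewrite /= /GRing.scale /=; ring.
have lE : l = be * dot (nu k t0) (k t0).
  have nn := dot_gt0 (conormal_neq0 ar gb t0).
  have : l * dot (n t0) (n t0) = (be * dot (nu k t0) (k t0)) * dot (n t0) (n t0).
    by rewrite -[LHS]dotZl -[RHS]dotZl -nuE nE.
  by move=> /(mulIf (lt0r_neq0 nn)).
have be0 : be != 0 by apply/eqP => E; move: l0; rewrite lE E mul0r ltxx.
have nf : ~ exists2 mu, flat_normals k mu & same_direction (nu c t) mu.
  by move=> /(flat_conormal l0 nE) h; move: A0; rewrite h ltxx.
have val : dot (hess (gauge (polar K)) (nu c t) (vel (nu c) t)) (perp (nu c t))
    / enorm (nu c t) ^+ 2 = dot (n t0) (c2 t) / (be ^+ 2 * A t0).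
  rewrite (vel_nu hv) {1}nE (hess_gp ar gb _ A0 l0) dotZl enorm_sqr.
  rewrite /nu perpK dot_perp_perp vE dotNr ![dot _ (be *: vel k t0)]dotZr ![dot (be *: vel k t0) _]dotZl.
  have E : dot (perp (c2 t)) (vel k t0) = - (dot (nu k t0) (k t0) * dot (n t0) (c2 t)).
    rewrite -dotZl -(conormal_nu ar gb) /nu; move: (vel k t0) (c2 t) => u w.
    by rewrite [dot (perp u) w]dotC dot_perpC opprK.
  rewrite E lE; move: (dot (vel k t0) _) kk (dot (nu k t0) _) kap0 A0 => X X0 Y Y0.
  move: (dot (n t0) (c2 t)) (dot (n t0) _) be0; clear -X0 Y0 => a b be0 b0.
  field; rewrite be0 (gt_eqF X0) (lt_eqF Y0) /=.
  by move: b0; rewrite oppr_gt0 => /lt_eqF ->.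
split; first by case=> [[_ ->]|[/nf]].
by move=> ->; left; split.
Qed.

End FlatNormals.

(** * Separation within one leg and across two legs *)

Lemma dot_near_neg (R : realType) (u v : R -> R * R) (s0 t0 : R) :
  {for s0, continuous u} -> {for t0, continuous v} -> dot (u s0) (v t0) < 0 ->
  exists2 d, 0 < d & forall s t, `|s - s0| < d -> `|t - t0| < d -> dot (u s) (v t) < 0.
Proof.
move=> uc vc neg; have e0 : 0 < - dot (u s0) (v t0) by rewrite oppr_gt0.
have [d d0 H] := dot_near uc vc e0; exists d => // s t hs ht.
have := H s t hs ht; rewrite ltr_norml => /andP[_].
by rewrite ltrBlDr addNr.
Qed.

(* The second derivative condition, the case of an arc whose tangent is not
   supporting, and that of a segment parallel to a flat part of the boundary of K. *)
Definition leg_kind (R : realType) (k : R -> R * R) (t0 la d : R) (c c1 c2 : R -> R * R) : Prop :=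
  let n := conormal k t0 in let A := - dot n (vel (vel k) t0) in
  [\/ dot n (c1 0) < 0,
      0 < A /\ exists2 be, c1 0 = be *: vel k t0 & la * dot n (c2 0) < be ^+ 2 * A
    | A = 0 /\ [/\ exists2 be, be != 0 & c1 0 = be *: vel k t0,
        forall u u', 0 <= u -> u < d -> 0 <= u' -> u' < d ->
          exists a, c u' - c u = a *: vel k t0
        & forall s, 0 < s -> s < d -> exists2 a, a != 0 & c1 s = a *: vel k t0]].

(** The first order condition is an equation for s > 0 and only an inequality at s = 0. A leg that
    is not tangent has no solution with small s > 0; a curved one falls under [leg_same]; on a flat
    one the secants are parallel to vel k t0 and th' = th works. *)
Lemma same_leg_margin (R : realType) (r : regularity R) (K : set (R * R)) (k : R -> R * R)
    (t0 la d e : R) (c c1 c2 : R -> R * R) :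
  admissible r -> gauge_body r K k -> 0 < la -> 0 < d -> C2_ball 0 d c c1 c2 ->
  leg_kind k t0 la d c c1 c2 -> 0 < e ->
  exists2 dl, 0 < dl & forall th l s s', `|th - t0| < dl -> `|l - la| < dl ->
    0 <= s -> s < dl -> 0 <= s' -> s' < dl ->
    (0 < s -> dot (conormal k th) (c1 s) = 0) ->
    (s = 0 -> dot (conormal k th) (c1 0) <= 0) ->
    exists2 th', `|th' - t0| < e & l <= dot (conormal k th') (l *: k th - (c s' - c s)).
Proof.
move=> ar gb la0 d0 HC kind e0.
have i0 : `|0 - 0 : R| < d by rewrite subrr normr0.
have c1c : {for 0, continuous c1} by have [_ h _] := HC 0 i0; exact: has_vel_continuous h.
have nc := conormal_continuous ar gb (t := t0).
have Hv s : `|s - 0| < d -> has_vel c c1 s by move=> /HC[].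
have abs0 (s m : R) : 0 <= s -> s < m -> `|s - 0| < m by move=> s0 sm; rewrite subr0 ger0_norm.
have fin th l (v : R * R) : dot (conormal k th) v <= 0 ->
    l <= dot (conormal k th) (l *: k th - v).
  by move=> h; rewrite dotBr dotZr (conormal_k ar gb) mulr1 lerDl oppr_ge0.
case: kind.
- move=> neg; have [m m0 H] := dot_near_neg nc c1c neg.
  exists (Num.min e (Num.min d m)); first by rewrite !lt_min e0 d0 m0.
  move=> th l s s'; rewrite !lt_min => /and3P[th1 _ th3] _ s0 /and3P[_ s1 s3] s'0 /and3P[_ s'1 s'3] f1 _.
  exists th => //; apply: fin.
  have [sp|sn] := ltP 0 s.
    have := H th s th3 (abs0 _ _ s0 s3).
    by rewrite (f1 sp) ltxx.
  have sE : s = 0 by apply: le_anti; rewrite sn s0.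
  rewrite sE dotBr.
  have Hv' u : `|u - 0| < Num.min d m -> has_vel c c1 u by rewrite lt_min => /andP[/Hv].
  have a0 : `|0 - 0 : R| < Num.min d m by rewrite subrr normr0 lt_min d0.
  have a1 : `|s' - 0| < Num.min d m by rewrite lt_min !abs0.
  have [xi xib ->] := MVT_dot (conormal k th) Hv' a0 a1.
  move: xib; rewrite lt_min => /andP[_ x3].
  rewrite subr0 addrAC subrr add0r; apply: mulr_le0_ge0 => //; apply: ltW; exact: H.
- move=> [A0 [be c1E crit]].
  have [m m0 H] := leg_same ar gb la0 d0 HC c1E crit e0.
  exists m => // th l s s' th1 l1 s0 s1 s'0 s'1 f1 f2.
  apply: H => //; rewrite ?ger0_norm//.
  move: s0; rewrite le_eqVlt => /orP[/eqP sE|sp]; last by rewrite f1// mulr0.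
  by rewrite -sE subr0; apply: mulr_ge0_le0 => //; apply: f2.
- move=> [A0 [[be be0 c1E] par tan]].
  pose v := vel k t0.
  have v0 : v != 0 by apply/eqP; exact: (gb_regular gb).
  have vv := dot_gt0 v0.
  have cst : {for 0, continuous (fun _ : R => (- be) *: v)} by exact: cvg_cst.
  have neg : dot ((- be) *: v) (c1 0) < 0.
    rewrite c1E dotZl [X in _ * X]dotZr mulrA mulNr mulNr oppr_lt0.
    by rewrite mulr_gt0// -expr2 lt_def sqr_ge0 andbT expf_neq0.
  have [m m0 H] := dot_near_neg cst c1c neg.
  exists (Num.min e (Num.min d m)); first by rewrite !lt_min e0 d0 m0.
  move=> th l s s'; rewrite !lt_min => /and3P[th1 _ th3] _ s0 /and3P[_ s1 s3] s'0 /and3P[_ s'1 s'3] f1 f2.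
  exists th => //; apply: fin.
  move: (s0); rewrite le_eqVlt => /orP[/eqP sE|sp]; last first.
    have [a a0 c1s] := tan s sp s1.
    have := f1 sp; rewrite c1s dotZr => /eqP; rewrite mulf_eq0 (negPf a0) /= => /eqP nv.
    by have [b ->] := par s s' s0 s1 s'0 s'1; rewrite dotZr nv mulr0.
  (* The sign of [be] is unknown: a be >= 0 for the secant, be dot (n th) v <= 0 by the first order
     condition, and the product of the two settles the claim. *)
  rewrite -sE; have [a aE] := par 0 s' (lexx _) d0 s'0 s'1; rewrite aE dotZr -/v.
  have Hv' u : `|u - 0| < Num.min d m -> has_vel c c1 u by rewrite lt_min => /andP[/Hv].
  have a0 : `|0 - 0 : R| < Num.min d m by rewrite subrr normr0 lt_min d0.
  have a1 : `|s' - 0| < Num.min d m by rewrite lt_min !abs0.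
  have [xi xib E] := MVT_dot ((- be) *: v) Hv' a0 a1.
  have x3 : `|xi - 0| < m by move: xib; rewrite lt_min => /andP[].
  have hneg := H 0 xi (eq_ind_r (fun u => u < m) m0 (etrans (congr1 _ (subrr 0)) (normr0 _))) x3.
  have : dot ((- be) *: v) (c s' - c 0) <= 0.
    rewrite dotBr E subr0 addrAC subrr add0r; apply: mulr_le0_ge0 => //; exact: ltW.
  rewrite aE dotZl [X in _ * X]dotZr -/v mulrA pmulr_lle0// mulNr oppr_le0 => ba.
  have nb : be * dot (conormal k th) v <= 0.
    by have := f2 (esym sE); rewrite c1E dotZr.
  have b2 : 0 < be ^+ 2 by rewrite lt_def sqr_ge0 andbT expf_neq0.
  rewrite -(pmulr_rle0 _ b2).
  have -> : be ^+ 2 * (a * dot (conormal k th) v) = (be * a) * (be * dot (conormal k th) v) by ring.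
  exact: mulr_ge0_le0.
Qed.

(** If [c] is not tangent, no such s exists. If only [g] is not tangent, the displacement is split
    at the common point: [same_leg_margin] handles the part along [c], and the part along [g] pairs
    nonpositively. Two tangent legs are both curved or both flat, since [A] belongs to K. *)
Lemma cross_leg_margin (R : realType) (r : regularity R) (K : set (R * R)) (k : R -> R * R)
    (t0 la d : R) (c c1 c2 g g1 g2 : R -> R * R) :
  admissible r -> gauge_body r K k -> 0 < la -> 0 < d ->
  C2_ball 0 d c c1 c2 -> C2_ball 0 d g g1 g2 ->
  leg_kind k t0 la d c c1 c2 -> leg_kind k t0 la d g g1 g2 -> c 0 = g 0 ->
  (dot (conormal k t0) (c1 0) = 0 -> dot (conormal k t0) (g1 0) = 0 ->
    exists2 rho, 0 < rho & g1 0 = (- rho) *: c1 0) ->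
  exists2 dl, 0 < dl & forall th l s s', `|th - t0| < dl -> `|l - la| < dl ->
    0 < s -> s < dl -> 0 <= s' -> s' < dl -> dot (conormal k th) (c1 s) = 0 ->
    exists th', l <= dot (conormal k th') (l *: k th - (g s' - c s)).
Proof.
move=> ar gb la0 d0 HC HG kc kg cg opp.
have i0 : `|0 - 0 : R| < d by rewrite subrr normr0.
have c1c : {for 0, continuous c1} by have [_ h _] := HC 0 i0; exact: has_vel_continuous h.
have g1c : {for 0, continuous g1} by have [_ h _] := HG 0 i0; exact: has_vel_continuous h.
have nc := conormal_continuous ar gb (t := t0).
have abs0 (s m : R) : 0 <= s -> s < m -> `|s - 0| < m by move=> s0 sm; rewrite subr0 ger0_norm.
have nk := conormal_vel k t0.
have [negc|] := ltP (dot (conormal k t0) (c1 0)) 0.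
  have [m m0 H] := dot_near_neg nc c1c negc.
  exists m => // th l s s' th1 _ s0 s1 _ _ f.
  by have := H th s th1 (abs0 _ _ (ltW s0) s1); rewrite f ltxx.
move=> nnc.
have [negg|nng] := ltP (dot (conormal k t0) (g1 0)) 0.
  have [m m0 H] := dot_near_neg nc g1c negg.
  (* Taking th' within [m] of t0 keeps the tangents of [g] pairing negatively with the tilted
     conormal. *)
  have [m' m'0 H'] := same_leg_margin ar gb la0 d0 HC kc m0.
  exists (Num.min m' (Num.min d m)); first by rewrite !lt_min m'0 d0 m0.
  move=> th l s s'; rewrite !lt_min => /and3P[th1 _ _] /and3P[l1 _ _] s0 /and3P[s1 _ _] s'0 /and3P[_ s'2 s'3] f.
  have sE : s = 0 -> dot (conormal k th) (c1 0) <= 0 by move=> E; move: s0; rewrite E ltxx.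
  have [th' th'1 h] := H' th l s 0 th1 l1 (ltW s0) s1 (lexx _) m'0 (fun _ => f) sE.
  exists th'; apply: le_trans h _.
  have -> : l *: k th - (g s' - c s) = l *: k th - (c 0 - c s) - (g s' - g 0).
    by rewrite cg; apply: pairE; rewrite /=; ring.
  rewrite [leRHS]dotBr lerDl oppr_ge0 dotBr.
  have Hv' u : `|u - 0| < Num.min d m -> has_vel g g1 u by rewrite lt_min => /andP[/HG[]].
  have a0 : `|0 - 0 : R| < Num.min d m by rewrite subrr normr0 lt_min d0.
  have a1 : `|s' - 0| < Num.min d m by rewrite lt_min !abs0.
  have [xi xib ->] := MVT_dot (conormal k th') Hv' a0 a1.
  move: xib; rewrite lt_min => /andP[_ x3].
  rewrite subr0 addrAC subrr add0r; apply: mulr_le0_ge0 => //; apply: ltW; exact: H.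
case: kc => [negc|[A0 [be c1E critc]]|[A0 [[be be0 c1E] par tan]]].
- by move: nnc; rewrite leNgt negc.
- case: kg => [negg|[_ [be' g1E critg]]|[A1 _]]; first by move: nng; rewrite leNgt negg.
  + have cz : dot (conormal k t0) (c1 0) = 0 by rewrite c1E dotZr nk mulr0.
    have gz : dot (conormal k t0) (g1 0) = 0 by rewrite g1E dotZr nk mulr0.
    have [rho rho0 gE] := opp cz gz.
    have g1E' : g1 0 = (- (rho * be)) *: vel k t0 by rewrite gE c1E scalerA mulNr.
    have vv : dot (vel k t0) (vel k t0) != 0.
      by apply: lt0r_neq0; apply: dot_gt0; apply/eqP; exact: (gb_regular gb).
    have bE : be' = - (rho * be).
      by apply: (mulIf vv); rewrite -[LHS]dotZl -[RHS]dotZl -g1E g1E'.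
    rewrite bE sqrrN in critg.
    have [m m0 H] := leg_cross ar gb la0 d0 HC HG cg rho0 c1E g1E' critc critg ltr01.
    exists m => // th l s s' th1 l1 s0 s1 s'0 s'1 f.
    by have [th' _ h] := H th l s s' th1 l1 (ltW s0) s1 s'0 s'1 f; exists th'.
  + by move: A0; rewrite A1 ltxx.
- case: kg => [negg|[A1 _]|[_ [[be' be'0 g1E] par' _]]]; first by move: nng; rewrite leNgt negg.
  + by move: A1; rewrite A0 ltxx.
  + exists d => // th l s s' _ _ s0 s1 s'0 s'1 f; exists th.
    have [a a0 c1s] := tan s s0 s1.
    have nv : dot (conormal k th) (vel k t0) = 0.
      by move: f; rewrite c1s dotZr => /eqP; rewrite mulf_eq0 (negPf a0) /= => /eqP.
    have [a1 E1] := par s 0 (ltW s0) s1 (lexx _) d0.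
    have [a2 E2] := par' 0 s' (lexx _) d0 s'0 s'1.
    have -> : g s' - c s = (a1 + a2) *: vel k t0.
      rewrite scalerDl -E1 -E2 cg; apply: pairE; rewrite /=; ring.
    by rewrite dotBr !dotZr nv mulr0 subr0 (conormal_k ar gb) mulr1.
Qed.

Lemma leg_kind_le (R : realType) (k : R -> R * R) (t0 la d d' : R) (c c1 c2 : R -> R * R) :
  d' <= d -> leg_kind k t0 la d c c1 c2 -> leg_kind k t0 la d' c c1 c2.
Proof.
move=> dd; case=> [h|h|[A0 [b par tan]]]; [exact: Or31|exact: Or32|apply: Or33].
split; first exact: A0.
split; first exact: b.
- by move=> u u' u0 ud u'0 u'd; apply: par => //; apply: lt_le_trans dd.
- by move=> s s0 sd; apply: tan => //; apply: lt_le_trans dd.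
Qed.

Lemma has_vel_affine (R : realType) (c c1 : R -> R * R) (t e s : R) :
  has_vel c c1 (t + e * s) ->
  has_vel (fun u => c (t + e * u)) (fun u => e *: c1 (t + e * u)) s.
Proof.
have aff : is_derive s 1 (fun u : R => t + e * u) e.
  have -> : (fun u : R => t + e * u) = cst t \+ e \*: id by apply/funext.
  have := is_deriveD (is_derive_cst t s 1) (is_deriveZ e (is_derive_id s 1)).
  by rewrite add0r scaler1 => h; exact: h.
move=> [h1 h2]; split.
- by have := is_derive1_comp (g := fun u : R => t + e * u) h1 aff; rewrite mulrC.
- by have := is_derive1_comp (g := fun u : R => t + e * u) h2 aff; rewrite mulrC.
Qed.

Lemma has_velZ (R : realType) (c c1 : R -> R * R) (e t : R) :
  has_vel c c1 t -> has_vel (fun u => e *: c u) (fun u => e *: c1 u) t.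
Proof. by move=> [h1 h2]; split; [exact: (is_deriveZ e h1)|exact: (is_deriveZ e h2)]. Qed.

(** As e^2 = 1, reversing the parameter leaves the second derivative unchanged. *)
Lemma C2_ball_affine (R : realType) (t d e : R) (c c1 c2 : R -> R * R) : `|e| = 1 ->
  C2_ball t d c c1 c2 ->
  C2_ball 0 d (fun s => c (t + e * s)) (fun s => e *: c1 (t + e * s)) (fun s => c2 (t + e * s)).
Proof.
move=> e1 H s; rewrite subr0 => sd.
have ee : e * e = 1 by rewrite -expr2 -real_normK ?num_real// e1 expr1n.
have [|h1 h2 h3] := H (t + e * s).
  by rewrite addrAC subrr add0r normrM e1 mul1r.
split; first exact: has_vel_affine.
  have := has_velZ e (has_vel_affine h2).
  suff -> : (fun u => e *: (e *: c2 (t + e * u))) = (fun u => c2 (t + e * u)) by [].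
  by apply/funext => u; rewrite scalerA ee scale1r.
apply: (@continuous_comp _ _ _ (fun s => t + e * s) c2) => //.
by apply: cvgD; [exact: cvg_cst|apply: cvgM; [exact: cvg_cst|exact: cvg_id]].
Qed.

(* The orthogonal component of a curve on a line is constant, so both the secants
   and the tangents lie along the line, and t0 is its direction by the tangent at 0. *)
Lemma segment_leg (R : realType) (v D p : R * R) (d be : R) (c c1 c2 : R -> R * R) :
  0 < d -> C2_ball 0 d c c1 c2 -> v != 0 -> D != 0 -> be != 0 -> c1 0 = be *: v ->
  (forall s, 0 <= s -> s < d -> exists a, c s = p + a *: D) ->
  (forall s, 0 < s -> s < d -> c1 s != 0) ->
  (forall u u', 0 <= u -> u < d -> 0 <= u' -> u' < d -> exists a, c u' - c u = a *: v) /\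
  (forall s, 0 < s -> s < d -> exists2 a, a != 0 & c1 s = a *: v).
Proof.
move=> d0 HC v0 D0 be0 c1E line reg.
have i0 : `|0 - 0 : R| < d by rewrite subrr normr0.
have c1c : {for 0, continuous c1} by have [_ h _] := HC 0 i0; exact: has_vel_continuous h.
have DD := dot_gt0 D0.
have wc s : 0 <= s -> s < d -> dot (perp D) (c s) = dot (perp D) p.
  move=> s0 sd; have [a ->] := line s s0 sd.
  by rewrite dotDr dotZr [dot (perp D) D]dotC dot_perp mulr0 addr0.
(* The normal component is constant, so every interior parameter is a maximum and the derivative
   vanishes there. *)
have w1 s : 0 < s -> s < d -> dot (perp D) (c1 s) = 0.
  move=> s0 sd; pose f u := dot (perp D) (c u).
  have fd u : u \in `]0, d[ -> is_derive u 1 f (dot (perp D) (c1 u)).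
    rewrite in_itv /= => /andP[u0 ud]; apply: has_vel_dot.
    by have [|h _ _] := HC u; first by rewrite subr0 gtr0_norm.
  have sin : s \in `]0, d[ by rewrite in_itv /= s0 sd.
  have dv u : u \in `]0, d[ -> derivable f u 1 by move=> /fd[].
  have mx u : u \in `]0, d[ -> f u <= f s.
    by rewrite in_itv /= => /andP[u0 ud]; rewrite /f !wc// ltW.
  have [_ <-] := fd s sin.
  by have [_] := derive1_at_max (ltW d0) dv sin mx.
(* At 0 the line condition is one-sided, so the tangent is reached by continuity. *)
have w0 : dot (perp D) (c1 0) = 0.
  apply/eqP; apply: contraT => ne; pose x := dot (perp D) (c1 0).
  have cst : {for 0, continuous (fun _ : R => perp D)} by exact: cvg_cst.
  have x0 : 0 < `|x| by rewrite normr_gt0.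
  have [m m0 H] := dot_near cst c1c x0.
  pose s := Num.min m d / 2.
  have mn : 0 < Num.min m d by rewrite lt_min m0.
  have s0 : 0 < s by rewrite divr_gt0.
  have : s < Num.min m d by rewrite ltr_pdivrMr// ltr_pMr// ltr1n.
  rewrite lt_min => /andP[sm sd].
  have := H 0 s (eq_ind_r (fun u => u < m) m0 (etrans (congr1 _ (subrr 0)) (normr0 _))).
  rewrite subr0 (gtr0_norm s0) => /(_ sm); rewrite (w1 s s0 sd) sub0r normrN.
  by rewrite -/x ltxx.
have along u : dot (perp D) u = 0 -> u = (dot D u / dot D D) *: D.
  by move=> h; rewrite {1}(perp_decomp u D0) h mul0r scale0r addr0.
pose b := dot D v / dot D D.
have vE : v = b *: D.
  apply: along; apply: (mulfI be0); rewrite mulr0 -dotZr -c1E; exact: w0.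
have b0 : b != 0 by apply/eqP => h; move: v0; rewrite vE h scale0r eqxx.
have DE : D = b^-1 *: v by rewrite [X in _ *: X]vE scalerA mulVf// scale1r.
split=> [u u' u0 ud u'0 u'd|s s0 sd].
  have [a1 ->] := line u u0 ud; have [a2 ->] := line u' u'0 u'd.
  exists ((a2 - a1) * b^-1); rewrite -scalerA -DE.
  by rewrite scalerBl; apply: pairE; rewrite /=; ring.
have E : c1 s = (dot D (c1 s) / dot D D / b) *: v.
  by rewrite -[RHS]scalerA -DE; exact: along (w1 s s0 sd).
exists (dot D (c1 s) / dot D D / b) => //.
by apply/eqP => h; have := reg s s0 sd; rewrite E h scale0r eqxx.
Qed.

(** For A > 0 a tangent leg satisfies the weak second order inequality, and equality would make x
    critical. The radius d' is left free so that two legs can share one. *)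
Lemma arc_leg_kind (R : realType) (r : regularity R) (K U : set (R * R))
    (k : R -> R * R) (N : nat) (S : 'I_N -> R -> R * R) (nxt : {perm 'I_N})
    (x y : R * R) (t0 t e dl : R) (i : 'I_N) :
  admissible r -> gauge_body r K k -> piecewise_domain U S nxt r ->
  boundary_assumption U S nxt (flat_normals k) -> U x ->
  closest U K x y -> x - y = dK U K x *: k t0 ->
  ~ critical U S nxt K (flat_normals k) x y ->
  t \in `[0, 1] -> S i t = y -> `|e| = 1 -> 0 < dl ->
  (forall s, 0 < s -> s < dl -> t + e * s \in `]0, 1[) ->
  e * dot (conormal k t0) (vel (S i) t) <= 0 ->
  (dot (conormal k t0) (vel (S i) t) = 0 -> 0 < dot (conormal k t0) (nu (S i) t)) ->
  (t \in `]0, 1[) \/ reentrant_corner U S nxt (S i t) ->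
  exists d, [/\ 0 < d, d <= dl & forall d', d' <= d ->
    C2_ball 0 d' (fun s => S i (t + e * s)) (fun s => e *: vel (S i) (t + e * s))
      (fun s => vel (vel (S i)) (t + e * s)) /\
    leg_kind k t0 (dK U K x) d' (fun s => S i (t + e * s)) (fun s => e *: vel (S i) (t + e * s))
      (fun s => vel (vel (S i)) (t + e * s))].
Proof.
move=> ar gb pd ba Ux cxy xy ncr t01 Sy e1 dl0 tin fo nup bac.
have Bc := boundary_compact ar pd; have Bn := boundary_nonempty pd Ux.
have l0 : 0 < dK U K x := dK_gt0 ar gb (pd_open pd) Bc Bn Ux.
have [d1 d10 C2] := arc_C2 ar pd i t01.
pose d := Num.min d1 dl; have d0 : 0 < d by rewrite lt_min d10.
have C2d := C2_ball_affine e1 C2.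
exists d; split; [exact: d0|by rewrite ge_min lexx orbT|].
have dd1 : d <= d1 by rewrite ge_min lexx.
have dddl : d <= dl by rewrite ge_min lexx orbT.
suff kd : leg_kind k t0 (dK U K x) d (fun s => S i (t + e * s)) (fun s => e *: vel (S i) (t + e * s))
      (fun s => vel (vel (S i)) (t + e * s)).
  move=> d' d'd; split; first exact: C2_ball_le (le_trans d'd dd1) C2d.
  exact: leg_kind_le d'd kd.
have z0 : t + e * 0 = t by rewrite mulr0 addr0.
have HB s : 0 < s -> s < dl -> boundary U (S i (t + e * s)).
  by move=> s0 sd; apply: (arc_boundary pd); apply: itv_oo_cc; exact: tin.
set n := conormal k t0 in fo nup *.
have [neg|] := ltP (dot n (e *: vel (S i) (t + e * 0))) 0; first exact: Or31 neg.
rewrite z0 dotZr => pos.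
have e0 : e != 0 by rewrite -normr_eq0 e1 oner_eq0.
have nv : dot n (vel (S i) t) = 0.
  have : e * dot n (vel (S i) t) = 0 by apply: le_anti; rewrite fo pos.
  by move=> /eqP; rewrite mulf_eq0 (negPf e0) /= => /eqP.
have nn0 : n != 0 := conormal_neq0 ar gb t0.
have k0 : vel k t0 != 0 by apply/eqP; exact: (gb_regular gb).
have T0 : vel (S i) t != 0 by apply/eqP; exact: (pd_regular pd t01).
have nk : dot n (vel k t0) = 0 := conormal_vel k t0.
have vE := orth_parallel nn0 nk nv k0.
set be := dot (vel k t0) (vel (S i) t) / dot (vel k t0) (vel k t0) in vE.
have be0 : be != 0 by apply/eqP => h; move: T0; rewrite vE h scale0r eqxx.
have hv : has_vel (vel (S i)) (vel (vel (S i))) t.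
  by have [|_ h _] := C2 t; first by rewrite subrr normr0.
have nuk : dot (nu (S i) t) (vel k t0) = 0.
  apply: (mulfI be0); rewrite mulr0 -dotZr -vE /nu dotC; exact: dot_perp.
have nuE := orth_conormal ar gb nuk.
set l := dot (nu (S i) t) (k t0) in nuE.
have nn := dot_gt0 nn0.
have lpos : 0 < l by have := nup nv; rewrite nuE [dot n _]dotZr pmulr_lgt0.
have so := second_order_necessary ar gb l0 cxy xy d10 C2 Sy e1 dl0 HB vE.
rewrite -/n in so.
set A := - dot n (vel (vel k) t0) in so.
have A_ge0 : 0 <= A by rewrite oppr_ge0; exact: conormal_acc_le0 ar gb t0.
have [A0|A0] := eqVneq A 0; last first.
  have Ap : 0 < A by rewrite lt_def A0.
  apply: Or32; split; first exact: Ap.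
  exists (e * be); first by rewrite z0 vE scalerA.
  have ee : e ^+ 2 = 1 by rewrite -real_normK ?num_real// e1 expr1n.
  rewrite z0 exprMn ee mul1r lt_neqAle so andbT; apply/eqP => E; apply: ncr.
  pose kap := dot n (vel (vel (S i)) t) / (be ^+ 2 * A).
  exists i, t, kap; split; [exact: t01|by rewrite Sy| | |].
  - move=> _; exists (dK U K x); first exact: l0.
    by rewrite xy /K_normal nuE (grad_gp ar gb Ap lpos).
  - by apply/(K_curvature_value ar gb kap hv vE lpos nuE Ap).
  - have b2 : 0 < be ^+ 2 by rewrite lt_def sqr_ge0 andbT expf_neq0.
    rewrite /kap mulrAC mulrC [dot _ _ * _]mulrC -/n E mulVf//.
    by rewrite mulf_neq0// gt_eqF.
have acc0 : curv k t0 = 0 by apply/eqP; rewrite (curv_k_eq0 ar gb) -/n -/A A0.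
have uM : flat_normals k (unit_vec (nu (S i) t)).
  rewrite nuE (unit_vec_scale lpos nn0) -(unit_conormal ar gb).
  by exists t0.
(* With A = 0 the second order condition becomes a sign, which excludes positive curvature and
   leaves the segment in the Boundary Assumption. *)
have so0 : dot n (vel (vel (S i)) t) <= 0.
  by move: so; rewrite A0 mulr0 pmulr_rle0.
case: (ba i t t01 bac uM) => [|[p [q [pq seg]]]].
  rewrite (curvE hv) pmulr_lgt0; last first.
    rewrite invr_gt0 exprn_gt0// enorm_gt0// nuE scaler_eq0 negb_or nn0 andbT.
    by rewrite gt_eqF.
  by rewrite nuE [dot _ (l *: _)]dotZr pmulr_rgt0// [dot _ n]dotC ltNge so0.
have D0 : q - p != 0 by rewrite subr_eq0 eq_sym; apply/eqP.
apply: Or33; split; first exact: A0.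
have c10 : e *: vel (S i) (t + e * 0) = (e * be) *: vel k t0 by rewrite z0 vE scalerA.
have eb0 : e * be != 0 by rewrite mulf_neq0.
have inS s : 0 <= s -> s < d -> t + e * s \in `[0, 1].
  rewrite le_eqVlt => /orP[/eqP <- _|s0 sd]; first by rewrite z0.
  by apply: itv_oo_cc; apply: tin => //; apply: lt_le_trans dddl.
have line s : 0 <= s -> s < d -> exists a, S i (t + e * s) = p + a *: (q - p).
  move=> s0 sd; have : (S i @` `[0, 1]) (S i (t + e * s)).
    by exists (t + e * s) => //; exact: inS.
  rewrite seg => -[a _ <-]; exists a.
  by apply: pairE; rewrite /= /GRing.scale /=; ring.
have reg s : 0 < s -> s < d -> e *: vel (S i) (t + e * s) != 0.
  move=> s0 sd; rewrite scaler_eq0 negb_or e0 /=; apply/eqP.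
  exact: (pd_regular pd (inS s (ltW s0) sd)).
have [par tan] := segment_leg d0 (C2_ball_le dd1 C2d) k0 D0 eb0 c10 line reg.
split; [by exists (e * be)|exact: par|exact: tan].
Qed.

(** * Prolongation of rays *)

(** For s > 0 the closest point is interior to its arc and [closest_interior] gives orthogonality.
    At s = 0 there is one inequality of [first_order] for each leg, and a point q' on [g] is then
    compared within [g]. *)
Lemma leg_extension (R : realType) (r : regularity R) (K U : set (R * R))
    (k : R -> R * R) (N : nat) (S : 'I_N -> R -> R * R) (nxt : {perm 'I_N})
    (t0 la d t t' e e' : R) (i j : 'I_N)
    (c := fun s => S i (t + e * s)) (c1 := fun s => e *: vel (S i) (t + e * s))
    (c2 := fun s => vel (vel (S i)) (t + e * s))
    (g := fun s => S j (t' + e' * s)) (g1 := fun s => e' *: vel (S j) (t' + e' * s))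
    (g2 := fun s => vel (vel (S j)) (t' + e' * s)) :
  admissible r -> gauge_body r K k -> piecewise_domain U S nxt r -> 0 < la -> 0 < d ->
  `|e| = 1 -> `|e'| = 1 -> t \in `[0, 1] -> t' \in `[0, 1] ->
  (forall s, 0 < s -> s < d -> t + e * s \in `]0, 1[) ->
  (forall s, 0 < s -> s < d -> t' + e' * s \in `]0, 1[) ->
  C2_ball 0 d c c1 c2 -> leg_kind k t0 la d c c1 c2 ->
  C2_ball 0 d g g1 g2 -> leg_kind k t0 la d g g1 g2 ->
  S i t = S j t' ->
  (dot (conormal k t0) (c1 0) = 0 -> dot (conormal k t0) (g1 0) = 0 ->
    exists2 rho, 0 < rho & g1 0 = (- rho) *: c1 0) ->
  exists2 dl, 0 < dl & forall th l s s' z q', `|th - t0| < dl -> `|l - la| < dl ->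
    0 <= s -> s < dl -> 0 <= s' -> s' < dl -> U z -> closest U K z (c s) ->
    z - c s = dK U K z *: k th -> q' = c s' \/ q' = g s' ->
    l <= gauge K (c s + l *: k th - q').
Proof.
move=> ar gb pd la0 d0 e1 e'1 t01 t'01 tin tin' Cc kc Cg kg cg opp.
have c0 : c 0 = S i t by rewrite /c mulr0 addr0.
have g0 : g 0 = S j t' by rewrite /g mulr0 addr0.
have cg0 : c 0 = g 0 by rewrite c0 g0.
have [m1 m10 H1] := same_leg_margin ar gb la0 d0 Cc kc ltr01.
have [m2 m20 H2] := same_leg_margin ar gb la0 d0 Cg kg ltr01.
have [m3 m30 H3] := cross_leg_margin ar gb la0 d0 Cc Cg kc kg cg0 opp.
exists (Num.min d (Num.min m1 (Num.min m2 m3))).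
  by rewrite !lt_min d0 m10 m20 m30.
move=> th l s s' z q'.
rewrite !lt_min => /and4P[_ th1 th2 th3] /and4P[_ l1 l2 l3] s0 /and4P[sd s1 s2 s3].
move=> s'0 /and4P[s'd s'1 s'2 s'3] Uz cz zE q'E.
have Bc := boundary_compact ar pd; have Bn := boundary_nonempty pd Uz.
have lz : 0 < dK U K z := dK_gt0 ar gb (pd_open pd) Bc Bn Uz.
suff [th' h] : exists th', l <= dot (conormal k th') (l *: k th - (q' - c s)).
  apply: le_trans h _; have -> : c s + l *: k th - q' = l *: k th - (q' - c s).
    by apply: pairE; rewrite /=; ring.
  exact: (conormal_le_gauge ar gb).
move: (s0); rewrite le_eqVlt => /orP[/eqP sE|sp]; last first.
  have f1 : dot (conormal k th) (c1 s) = 0.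
    by rewrite /c1 dotZr (closest_interior ar gb pd Uz cz zE) ?mulr0//; exact: tin.
  case: q'E => ->.
    have [||th' _ h] := H1 th l s s' th1 l1 s0 s1 s'0 s'1; [by []| |by exists th'].
    by move=> E; move: sp; rewrite E ltxx.
  by have [th' h] := H3 th l s s' th3 l3 sp s3 s'0 s'3 f1; exists th'.
rewrite -sE in cz zE *.
have fo i0 u e0 : `|e0| = 1 -> u \in `[0, 1] -> S i0 u = c 0 ->
    (forall s, 0 < s -> s < d -> u + e0 * s \in `]0, 1[) ->
    e0 * dot (conormal k th) (vel (S i0) u) <= 0.
  move=> e01 u01 uE uin; have [b b0 C2] := arc_C2 ar pd i0 u01.
  apply: (first_order ar gb lz cz zE b0 C2 uE _ d0); first by rewrite e01.
  by move=> v v0 vd; apply: (arc_boundary pd); apply: itv_oo_cc; exact: uin.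
case: q'E => ->.
  have [||th' _ h] := H1 th l 0 s' th1 l1 (lexx _) m10 s'0 s'1; [by rewrite ltxx| |by exists th'].
  by move=> _; rewrite /c1 dotZr mulr0 addr0; exact: (fo i t e e1 t01 (esym c0) tin).
have [||th' _ h] := H2 th l 0 s' th2 l2 (lexx _) m20 s'0 s'2; [by rewrite ltxx| |].
  move=> _; rewrite /g1 dotZr mulr0 addr0.
  by apply: (fo j t' e' e'1 t'01 _ tin'); rewrite c0 cg.
by exists th'; rewrite cg0.
Qed.

(* Moving from q along its K-normal stays at distance l from the boundary near y,
   so the rays through the points z near x extend beyond z. *)
Lemma local_extension (R : realType) (r : regularity R) (K U : set (R * R))
    (k : R -> R * R) (N : nat) (S : 'I_N -> R -> R * R) (nxt : {perm 'I_N})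
    (x y : R * R) (t0 : R) :
  admissible r -> gauge_body r K k -> piecewise_domain U S nxt r ->
  boundary_assumption U S nxt (flat_normals k) -> U x ->
  closest U K x y -> x - y = dK U K x *: k t0 ->
  ~ critical U S nxt K (flat_normals k) x y ->
  exists2 dl, 0 < dl & forall th l z q q', `|th - t0| < dl -> `|l - dK U K x| < dl ->
    U z -> closest U K z q -> z - q = dK U K z *: k th -> `|q - y| < dl ->
    boundary U q' -> `|q' - y| < dl -> l <= gauge K (q + l *: k th - q').
Proof.
move=> ar gb pd ba Ux cxy xy ncr.
have Bc := boundary_compact ar pd; have Bn := boundary_nonempty pd Ux.
have la0 : 0 < dK U K x := dK_gt0 ar gb (pd_open pd) Bc Bn Ux.
have [i [j [t [t' [e [e' [d L]]]]]]] := closest_legs ar gb pd Ux cxy xy.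
have [d1 [d10 d1d H1]] := arc_leg_kind ar gb pd ba Ux cxy xy ncr (la_t L) (la_y L) (la_e L)
  (la_d L) (la_in L) (la_fo L) (la_nu L) (la_ba L).
have [d2 [d20 d2d H2]] := arc_leg_kind ar gb pd ba Ux cxy xy ncr (la_t' L) (la_y' L) (la_e' L)
  (la_d L) (la_in' L) (la_fo' L) (la_nu' L) (la_ba' L).
pose m := Num.min d1 d2; have m0 : 0 < m by rewrite lt_min d10.
have md1 : m <= d1 by rewrite ge_min lexx.
have md2 : m <= d2 by rewrite ge_min lexx orbT.
have [Cc kc] := H1 m md1; have [Cg kg] := H2 m md2.
have tin s : 0 < s -> s < m -> t + e * s \in `]0, 1[.
  by move=> s0 sm; apply: (la_in L) => //; apply: lt_le_trans sm (le_trans md1 d1d).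
have tin' s : 0 < s -> s < m -> t' + e' * s \in `]0, 1[.
  by move=> s0 sm; apply: (la_in' L) => //; apply: lt_le_trans sm (le_trans md1 d1d).
have yy : S i t = S j t' by rewrite (la_y L) (la_y' L).
have sq (a : R) : `|a| = 1 -> a * a = 1.
  by move=> a1; rewrite -expr2 -real_normK ?num_real// a1 expr1n.
have ne0 (a : R) : `|a| = 1 -> a != 0 by move=> a1; rewrite -normr_eq0 a1 oner_eq0.
have dz (a u : R) (v : R -> R * R) : `|a| = 1 ->
    dot (conormal k t0) (a *: v (u + a * 0)) = 0 -> dot (conormal k t0) (v u) = 0.
  by move=> /ne0 a0; rewrite mulr0 addr0 dotZr => /eqP; rewrite mulf_eq0 (negPf a0) => /eqP.
have op1 : dot (conormal k t0) (e *: vel (S i) (t + e * 0)) = 0 ->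
    dot (conormal k t0) (e' *: vel (S j) (t' + e' * 0)) = 0 ->
    exists2 rho, 0 < rho & e' *: vel (S j) (t' + e' * 0) = (- rho) *: (e *: vel (S i) (t + e * 0)).
  move=> /(dz _ _ _ (la_e L)) h1 /(dz _ _ _ (la_e' L)) h2.
  have [rho r0 E] := la_opp L h1 h2; exists rho; first exact: r0.
  by rewrite !mulr0 !addr0 scalerA mulNr.
have op2 : dot (conormal k t0) (e' *: vel (S j) (t' + e' * 0)) = 0 ->
    dot (conormal k t0) (e *: vel (S i) (t + e * 0)) = 0 ->
    exists2 rho, 0 < rho & e *: vel (S i) (t + e * 0) = (- rho) *: (e' *: vel (S j) (t' + e' * 0)).
  move=> h2 h1; have [rho r0 E] := op1 h1 h2; exists rho^-1; first by rewrite invr_gt0.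
  by rewrite E scalerA mulrNN mulVf ?scale1r// gt_eqF.
have [n1 n10 E1] := leg_extension ar gb pd la0 m0 (la_e L) (la_e' L) (la_t L) (la_t' L)
  tin tin' Cc kc Cg kg yy op1.
have [n2 n20 E2] := leg_extension ar gb pd la0 m0 (la_e' L) (la_e L) (la_t' L) (la_t L)
  tin' tin Cg kg Cc kc (esym yy) op2.
pose dl := Num.min n1 n2; have dl0 : 0 < dl by rewrite lt_min n10.
have [b b0 cov] := la_cover L dl0.
exists (Num.min dl b); first by rewrite lt_min dl0.
move=> th l z q q'; rewrite !lt_min => /andP[/andP[th1 th2] _] /andP[/andP[l1 l2] _].
move=> Uz cz zq /andP[_ qb] Bq' /andP[_ q'b].
have [s [s0]] := cov q (proj1 cz) qb; rewrite lt_min => /andP[s1 s2] sE.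
have [s' [s'0]] := cov q' Bq' q'b; rewrite lt_min => /andP[s'1 s'2] s'E.
case: sE => qE; rewrite qE in cz zq *.
  exact: (E1 th l s s' z q' th1 l1 s0 s1 s'0 s'1 Uz cz zq s'E).
apply: (E2 th l s s' z q' th2 l2 s0 s2 s'0 s'2 Uz cz zq).
by case: s'E; [right|left].
Qed.

(** * The ridge and the critical points *)

(** The upper and the lower expansion have the same slope [conormal k th], because q, z and the
    prolonged point lie on one ray. *)
Lemma noncritical_C11 (R : realType) (r : regularity R) (K U : set (R * R))
    (k : R -> R * R) (N : nat) (S : 'I_N -> R -> R * R) (nxt : {perm 'I_N})
    (x y : R * R) :
  admissible r -> gauge_body r K k -> piecewise_domain U S nxt r ->
  boundary_assumption U S nxt (flat_normals k) -> U x -> ~ ridge0 U K x ->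
  closest U K x y -> ~ critical U S nxt K (flat_normals k) x y ->
  exists V, [/\ open V, V x & C11_on V (dK U K)].
Proof.
move=> ar gb pd ba Ux nr0 cxy ncr.
have Bc := boundary_compact ar pd; have Bn := boundary_nonempty pd Ux.
have la0 : 0 < dK U K x := dK_gt0 ar gb (pd_open pd) Bc Bn Ux.
set f := dK U K in la0 *.
have [t0 xy _] := gauge_ex gb (x - y).
rewrite -(proj2 cxy) -/f in xy.
have [dl dl0 ext] := local_extension ar gb pd ba Ux cxy xy ncr.
have [M M0 HM] := gauge_bound gb.
have lip := dK_lip ar gb Bc Bn HM.
have glip := gauge_lip ar gb HM.
have [MK MK0 HMK] := gb_bounded gb.
have [m0 m00 gap0] := closest_gap ar gb Bc cxy nr0 Ux dl0.
(* One prolongation length for all z: the first bound keeps f z + eps near f x, the second keeps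
   boundary points away from y out of reach, as the gauge changes by at most eps M MK. *)
pose eps := Num.min (dl / 2) (m0 / 2 / (M * MK + 1)).
have MM0 : 0 < M * MK + 1 by rewrite ltr_wpDl// mulr_ge0// ltW.
have eps0 : 0 < eps by rewrite lt_min !divr_gt0.
have eps1 : eps <= dl / 2 by rewrite ge_min lexx.
have eps2 : eps * (M * MK + 1) <= m0 / 2 by rewrite -ler_pdivlMr// ge_min lexx orbT.
have l20 : 0 < f x / 2 by rewrite divr_gt0.
(* Two radii occur: at least f x / 2 for the ball from q to z, and eps for the ball from z to the
   prolonged point. *)
have [C1 [d1 [C10 d10 up1]]] := gauge_upper ar gb t0 l20.
have [C2 [d2 [C20 d20 up2]]] := gauge_upper ar gb t0 eps0.
pose dm := Num.min dl (Num.min d1 d2).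
have dm0 : 0 < dm by rewrite !lt_min dl0 d10 d20.
have [b b0 par] := param_near ar gb t0 la0 dm0.
pose e' := Num.min dl (b / 2).
have e'0 : 0 < e' by rewrite lt_min dl0 divr_gt0.
have [m1 m10 gap1] := closest_gap ar gb Bc cxy nr0 Ux e'0.
have [u u0 Uu] : exists2 u : R, 0 < u & forall z, `|z - x| < u -> U z.
  by have := pd_open pd; rewrite openE => /(_ x Ux) /near_distP.
(* The four bounds serve, in order: f z near f x, q near y, boundary points far from y, and f z >= f
   x / 2. *)
pose mu := Num.min (dl / 2) (Num.min (m1 / 2) (Num.min (m0 / 4) (f x / 2))).
have mu0 : 0 < mu by rewrite !lt_min !divr_gt0.
pose d := Num.min (mu / M) (Num.min u (Num.min (b / 2) (Num.min d1 d2))).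
have d0 : 0 < d by rewrite !lt_min d10 d20 u0 !divr_gt0.
apply: (@C11_criterion R f x (C1 + C2) d d0); first by rewrite addr_ge0// ltW.
move=> z; rewrite !lt_min => /and5P[z1 z2 z3 _ _].
have Uz := Uu z z2.
have zM : M * `|z - x| < mu by rewrite mulrC -ltr_pdivlMr.
move: zM; rewrite !lt_min => /and4P[zm1 zm2 zm3 zm4].
have [q cq] := closest_ex ar gb Bc Bn z.
have fz : `|f z - f x| <= M * `|z - x| := lip z x.
have gq q' : `|gauge K (z - q') - gauge K (x - q')| <= M * `|z - x|.
  by have := glip (z - q') (x - q'); rewrite opprB addrA subrK.
(* A closest point of z far from y would be at gauge distance at least f x + m1 from x, more than
   the Lipschitz bounds allow. *)
have qy : `|q - y| < e'.
  rewrite ltNge; apply/negP => h; have := gap1 q (proj1 cq) h.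
  have := gq q; rewrite -(proj2 cq) -/f; move: fz zm2; rewrite !ler_norml -/f.
  move: (M * `|z - x|) (f z) (f x) (gauge K (x - q)) => Y a1 a2 a3.
  by clear; move=> /andP[h1 h2] h3 /andP[h4 h5] h6; lra.
move: (qy); rewrite lt_min => /andP[qdl qb].
have vb : `|z - q - f x *: k t0| < b.
  have -> : z - q - f x *: k t0 = (z - x) - (q - y).
    by rewrite -xy; apply: pairE; rewrite /=; ring.
  apply: le_lt_trans (ler_normB _ _) _.
  by move: z3 qb; clear; lra.
have [th thd zq] := par (z - q) vb.
rewrite -(proj2 cq) -/f in zq.
move: thd; rewrite !lt_min => /and3P[th1 th2 th3].
have fz2 : f x / 2 <= f z.
  move: fz zm4; rewrite ler_norml => /andP[h _]; move: h.
  by move: (M * `|z - x|) => Y; clear; lra.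
have fzx : f z <= f x + M * `|z - x|.
  by move: fz; rewrite ler_norml => /andP[_]; rewrite lerBlDl.
have lnear : `|f z + eps - f x| < dl.
  have -> : f z + eps - f x = (f z - f x) + eps by ring.
  apply: le_lt_trans (ler_normD _ _) _; rewrite (gtr0_norm eps0).
  by apply: le_lt_trans (lerD fz eps1) _; move: zm1; clear; lra.
have rayE : z + eps *: k th = q + (f z + eps) *: k th.
  by rewrite scalerDl -zq; apply: pairE; rewrite /=; ring.
have ray : f z + eps <= f (z + eps *: k th).
  apply: (dK_ge ar gb Bc Bn) => q' Bq'.
  have [near|far] := ltP `|q' - y| dl.
    by rewrite rayE; exact: (ext th _ z q q' th1 lnear Uz cq zq qdl Bq' near).
  have g0 := gap0 q' Bq' far; rewrite -/f in g0.
  have := gq q'; rewrite ler_norml => /andP[g1 _].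
  have g2 : `|gauge K (z + eps *: k th - q') - gauge K (z - q')| <= M * (eps * MK).
    apply: le_trans (glip _ _) _; apply: ler_wpM2l; first exact: ltW.
    have -> : z + eps *: k th - q' - (z - q') = eps *: k th.
      by apply: pairE; rewrite /=; ring.
    by rewrite normrZ (gtr0_norm eps0); apply: ler_wpM2l; [exact: ltW|apply: HMK; exact: (gb_mem gb)].
  move: g2; rewrite ler_norml => /andP[g2 _].
  move: g0 g1 g2 zm3 fzx eps2.
  have -> : M * (eps * MK) = eps * (M * MK + 1) - eps by ring.
  move: (gauge K (z + _ - q')) (gauge K (z - q')) (gauge K (x - q')) (f z) (f x).
  move: (M * `|z - x|) (eps * (_ + 1)) => a1 a2 a3 a4 a5 a6 a7.
  by clear; lra.
exists (conormal k th) => h; rewrite !lt_min => /and5P[_ _ _ h1 h2].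
have hi : f (z + h) <= f z + dot (conormal k th) h + C1 * `|h| ^+ 2.
  apply: le_trans (dK_le gb (z + h) (proj1 cq)) _.
  have -> : z + h - q = f z *: k th + h by rewrite -zq; apply: pairE; rewrite /=; ring.
  exact: up1.
(* The prolonged point has distance at least f z + eps, of which the path to z + h uses at most eps
   - n.h + C2 |h|^2. *)
have lo : f z + dot (conormal k th) h - C2 * `|h| ^+ 2 <= f (z + h).
  have tri := dK_triangle ar gb Bc Bn (z + eps *: k th) (z + h).
  have nh : `|- h| < d2 by rewrite normrN.
  have := up2 th eps (- h) th3 (lexx _) nh; rewrite dotNr normrN.
  have -> : eps *: k th - h = z + eps *: k th - (z + h) by apply: pairE; rewrite /=; ring.
  move: ray tri; rewrite -/f.
  move: (f (z + _ *: _)) (gauge K _) (f (z + h)) (f z) (dot _ h) (C2 * _).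
  by move=> a1 a2 a3 a4 a5 a6; clear; lra.
have C1h : 0 <= C1 * `|h| ^+ 2 by rewrite mulr_ge0// ?exprn_ge0// ltW.
have C2h : 0 <= C2 * `|h| ^+ 2 by rewrite mulr_ge0// ?exprn_ge0// ltW.
rewrite mulrDl ler_norml; apply/andP; move: hi lo C1h C2h.
move: (f (z + h)) (f z) (dot _ h) (C1 * _) (C2 * _) => a1 a2 a3 a4 a5.
by clear; split; lra.
Qed.

(* A ray of length dK x + s that still realizes the distance contradicts the
   second order condition, whose right-hand side does not depend on s. *)
Lemma critical_not_C11 (R : realType) (r : regularity R) (K U : set (R * R))
    (k : R -> R * R) (N : nat) (S : 'I_N -> R -> R * R) (nxt : {perm 'I_N})
    (x y : R * R) (V : set (R * R)) :
  admissible r -> gauge_body r K k -> piecewise_domain U S nxt r -> U x ->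
  closest U K x y -> critical U S nxt K (flat_normals k) x y ->
  open V -> V x -> ~ C11_on V (dK U K).
Proof.
move=> ar gb pd Ux cxy [i [t [kap [t01 yE par Kk kapE]]]] Vo Vx [dif _].
have Bc := boundary_compact ar pd; have Bn := boundary_nonempty pd Ux.
have la0 : 0 < dK U K x := dK_gt0 ar gb (pd_open pd) Bc Bn Ux.
have T0 : vel (S i) t != 0 by apply/eqP; exact: (pd_regular pd t01).
have nu0 : nu (S i) t != 0 by rewrite perp_eq0.
(* The product kap d_K(x) is 1, which excludes the segment branch of [K_curvature], where kap =
   0. *)
have kap0 : kap != 0 by apply/eqP => h; move: kapE; rewrite h mul0r => /eqP; rewrite eq_sym oner_eq0.
have nflat : ~ exists2 mu, flat_normals k mu & same_direction (nu (S i) t) mu.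
  by move=> h; case: Kk => [[/(_ h)]//|[_ _ E]]; move: kap0; rewrite E eqxx.
have curved (t1 l : R) : 0 < l -> nu (S i) t = l *: conormal k t1 ->
    0 < - dot (conormal k t1) (vel (vel k) t1).
  move=> l0 nE; rewrite lt_def oppr_ge0 (conormal_acc_le0 ar gb t1) andbT.
  by apply/eqP => h; apply: nflat; apply/(flat_conormal ar gb l0 nE).
(* At a reentrant corner the parallelism in [critical] places x - y on the K-normal of the chosen
   arc; otherwise both legs at y belong to one arc, tangent to the ball. *)
have [t0 [l [l0 nE xy]]] : exists t0 l, [/\ 0 < l, nu (S i) t = l *: conormal k t0
    & x - y = dK U K x *: k t0].
  have [t0 xy _] := gauge_ex gb (x - y); rewrite -(proj2 cxy) in xy.
  have [i1 [j1 [t1 [t1' [e [e' [d L]]]]]]] := closest_legs ar gb pd Ux cxy xy.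
  case: (la_reent L) => [re|[nv [ij tt]]].
    have [t2 [l [l0 nE]]] := conormal_ex ar gb nu0.
    have := par re; rewrite /K_normal nE (grad_gp ar gb (curved _ _ l0 nE) l0).
    move=> [b b_gt0 E]; exists t2, l; split; [exact: l0|by []|].
    rewrite E; congr (_ *: _).
    have := proj2 cxy; rewrite E => ->.
    by rewrite (gauge_k ar gb)// ltW.
  have [ii tE] : i = i1 /\ t = t1.
    have [//|[-> ->]] := la_uniq L t01 (esym yE).
    by rewrite -ij -tt.
  have nn0 := conormal_neq0 ar gb t0.
  have k0 : vel k t0 != 0 by apply/eqP; exact: (gb_regular gb).
  rewrite -ii -tE in nv.
  have vE := orth_parallel nn0 (conormal_vel k t0) nv k0.
  have nuk : dot (nu (S i) t) (vel k t0) = 0.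
    have b0 : dot (vel k t0) (vel (S i) t) / dot (vel k t0) (vel k t0) != 0.
      by apply/eqP => h; move: T0; rewrite vE h scale0r eqxx.
    by apply: (mulfI b0); rewrite mulr0 -dotZr -vE /nu dotC; exact: dot_perp.
  have nE := orth_conormal ar gb nuk.
  set l := dot (nu (S i) t) (k t0) in nE.
  exists t0, l; split; [|exact: nE|exact: xy].
  have h := la_nu L; rewrite -ii -tE in h; have := h nv.
  by rewrite nE [dot (conormal k t0) _]dotZr pmulr_lgt0// dot_gt0.
have A0 := curved _ _ l0 nE.
have nn0 := conormal_neq0 ar gb t0.
have k0 : vel k t0 != 0 by apply/eqP; exact: (gb_regular gb).
have nv : dot (conormal k t0) (vel (S i) t) = 0.
  apply: (mulfI (lt0r_neq0 l0)); rewrite mulr0 -dotZl -nE /nu dotC; exact: dot_perp.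
have vE := orth_parallel nn0 (conormal_vel k t0) nv k0.
set be := _ / _ in vE.
have be0 : be != 0 by apply/eqP => h; move: T0; rewrite vE h scale0r eqxx.
have b2 : 0 < be ^+ 2 by rewrite lt_def sqr_ge0 andbT expf_neq0.
have [d d0 C2] := arc_C2 ar pd i t01.
have hv : has_vel (vel (S i)) (vel (vel (S i))) t.
  by have [|_ h _] := C2 t; first by rewrite subrr normr0.
move: Kk => /(K_curvature_value ar gb kap hv vE l0 nE A0) kE.
have [b b0 bV] : exists2 b : R, 0 < b & forall z, `|z - x| < b -> V z.
  by move: Vo; rewrite openE => /(_ x Vx) /near_distP.
have dif' z : `|z - x| < b -> differentiable (dK U K) z by move=> /bV; exact: dif.
have [s [s0 cs ds]] := differentiable_ray ar gb (pd_open pd) Bc Bn Ux cxy xy b0 dif'.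
have l's : 0 < dK U K (x + s *: k t0) by rewrite ds addr_gt0.
have xs : x + s *: k t0 - y = dK U K (x + s *: k t0) *: k t0.
  by rewrite ds scalerDl -xy; apply: pairE; rewrite /=; ring.
(* One side of t within [0, 1] suffices, as the second order condition does not depend on the sign
   of [e]. *)
have [e [e1 [dl dl0 ein]]] : exists e : R, `|e| = 1 /\
    exists2 dl, 0 < dl & forall s, 0 < s -> s < dl -> t + e * s \in `[0, 1].
  move: (t01); rewrite in_itv /= => /andP[t0' t1'].
  have [th|th] := ltP t 1.
    exists 1; rewrite normr1; split => //; exists (1 - t); first by rewrite subr_gt0.
    move=> u u0 ut; rewrite in_itv /= mul1r; apply/andP; move: t0' u0 ut.
    by clear; split; lra.
  exists (-1); rewrite normrN normr1; split => //; exists 1 => // u u0 u1.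
  rewrite in_itv /= mulN1r; apply/andP; move: th t1' u0 u1.
  by clear; split; lra.
have HB u : 0 < u -> u < dl -> boundary U (S i (t + e * u)).
  by move=> u0 ud; apply: (arc_boundary pd); exact: ein.
have := second_order_necessary ar gb l's cs xs d0 C2 (esym yE) e1 dl0 HB vE.
rewrite ds; set X := be ^+ 2 * - dot (conormal k t0) (vel (vel k) t0) in kE *.
have X0 : 0 < X by rewrite mulr_gt0.
have -> : dot (conormal k t0) (vel (vel (S i)) t) = kap * X.
  by rewrite kE divfK// gt_eqF.
(* As kap d_K(x) = 1, the condition at the prolonged point reads (1 + kap s) X <= X, although kap, s
   and X are positive. *)
clearbody X; rewrite mulrA [(_ + s) * kap]mulrC mulrDr kapE ger_pMl//.
have : 0 < kap * s by rewrite mulr_gt0// -(pmulr_lgt0 _ la0) kapE.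
by rewrite gerDl leNgt => ->.
Qed.

Theorem theorem4 (R : realType) (r : regularity R)
    (K U : set (R * R)) (k : R -> R * R)
    (N : nat) (S : 'I_N -> R -> R * R) (nxt : {perm 'I_N}) :
  admissible r ->
  gauge_body r K k ->
  piecewise_domain U S nxt r ->
  boundary_assumption U S nxt (flat_normals k) ->
  ridge U K =
    ridge0 U K `|`
    [set x | [/\ U x, ~ ridge0 U K x &
      exists y, closest U K x y /\
                critical U S nxt K (flat_normals k) x y]].
Proof.
move=> ar gb pd ba; apply/seteqP; split=> x /=.
  move=> [Ux nC]; have [r0|nr0] := pselect (ridge0 U K x); first by left.
  right; split=> //.
  have [y cxy] := closest_ex ar gb (boundary_compact ar pd) (boundary_nonempty pd Ux) x.
  exists y; split=> //; have [//|ncr] := pselect (critical U S nxt K (flat_normals k) x y).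
  by exfalso; apply: nC; exact: (noncritical_C11 ar gb pd ba Ux nr0 cxy ncr).
case=> [[Ux [y [y' [cy cy' ne]]]]|[Ux _ [y [cy cr]]]]; split=> // -[V [Vo Vx VC]].
  apply: ne; apply: (differentiable_unique ar gb (boundary_compact ar pd)
    (boundary_nonempty pd Ux) _ cy cy').
  exact: (proj1 VC).
exact: (critical_not_C11 ar gb pd Ux cy cr Vo Vx VC).
Qed.
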